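(* Let $\mathbb F$ be a real closed field, $V_{\mathbb F}$ a symplectic $\mathbb F$-vector space of dimension $2n$, and $\mathcal O\subset\mathbb F$ an order convex local subring with residue field $\mathbb F_{\mathcal O}$. Let $\rho:\Gamma\to\mathrm{Sp}(V_{\mathbb F})$ be a representation and assume that there is a symplectic basis of $V_{\mathbb F}$ with respect to which $\rho(\Gamma)\subset\mathrm{Sp}(2n,\mathcal O)$. Let $\rho_{\mathcal O}:\Gamma\to\mathrm{Sp}(2n,\mathbb F_{\mathcal O})$ be the composition of $\rho$ with the quotient homomorphism $\mathrm{Sp}(2n,\mathcal O)\to\mathrm{Sp}(2n,\mathbb F_{\mathcal O})$. If $\rho$ admits a maximal framing, then the reduction $\rho_{\mathcal O}$ admits a maximal framing as well.
   Context: Surface: $\Sigma$ is an oriented surface of genus $g$ with $p\ge 0$ punctures, endowed with a complete hyperbolic metric of finite area; $\Gamma=\pi_1(\Sigma)$ is identified with a discrete subgroup of $\mathrm{PSL}(2,\mathbb R)$ with $\Sigma=\Gamma\backslash\mathbb H^2$. Order convex subring: a subring $\mathcal O\subset\mathbb F$ such that $0<x<y$, $y\in\mathcal O$ implies $x\in\mathcal O$. It is local with maximal ideal $\mathcal I=\{x\in\mathcal O: x=0 \text{ or } x^{-1}\notin\mathcal O\}$, and $\mathbb F_{\mathcal O}=\mathcal O/\mathcal I$ is again real closed. Maximal triples: let $V$ be a symplectic vector space over a real closed field and $\mathcal L(V)$ its set of Lagrangians. For pairwise transverse $l_1,l_2,l_3\in\mathcal L(V)$ and $v\in l_1$ let $T(v)\in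 l_3$ be the unique vector with $v+T(v)\in l_2$; put $Q_{l_1,l_2,l_3}(v)=\langle v,T(v)\rangle$, a quadratic form on $l_1$. The triple is maximal if $Q_{l_1,l_2,l_3}$ is positive definite. Maximal framing: a representation $\rho:\Gamma\to\mathrm{Sp}(V)$ admits a maximal framing if there is a $\rho$-equivariant map $\phi:S\to\mathcal L(V)$, where $S\subseteq\partial\mathbb H^2$ is a $\Gamma$-invariant subset containing all fixed points of hyperbolic elements of $\Gamma$, such that for every positively oriented triple $(x,y,z)$ in $S$ the triple $(\phi(x),\phi(y),\phi(z))$ is maximal. *)

(* Defs.v *)
From HB Require Import structures.
From mathcomp Require Import all_boot all_order all_algebra.
From mathcomp Require Import ring_quotient sesquilinear.
From mathcomp Require Import all_classical all_reals all_analysis.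
From mathcomp Require Import complex.

Set Implicit Arguments.
Unset Strict Implicit.
Unset Printing Implicit Defensive.

Import Order.TTheory GRing.Theory Num.Theory.
Import numFieldNormedType.Exports.

Local Open Scope quotient_scope.
Local Open Scope ring_scope.

Definition order_convex (F : rcfType) (O : {pred F}) : Prop :=
  forall x y, 0 < x -> x < y -> y \in O -> x \in O.

Record convexSubring (F : rcfType) := ConvexSubring {
  convex_pred :> {pred F};
  convex_subring_closed : subring_closed convex_pred;
  convex_order_convex : order_convex convex_pred
}.

Section ResidueField.
Variables (F : rcfType) (O : convexSubring F).

HB.instance Definition _ :=
  GRing.isSubringClosed.Build F (convex_pred O) (convex_subring_closed O).

Record convex_ring := ConvexRing {
  convex_val :> F;
  convex_valP : convex_val \in convex_pred O
}.

HB.instance Definition _ := [isSub for convex_val].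
HB.instance Definition _ := [Choice of convex_ring by <:].
HB.instance Definition _ := [SubChoice_isSubComNzRing of convex_ring by <:].

Definition convex_ideal : {pred convex_ring} :=
  [pred x | (val x == 0) || ((val x)^-1 \notin O)].

Lemma convex_le (x y : F) : y \in O -> `|x| <= `|y| -> x \in O.
Proof.
move=> Oy; have Oay : `|y| \in O.
  by case: (ger0P y) => _; rewrite ?rpredN.
move=> xy; have Oax : `|x| \in O.
  have [->|x0] := eqVneq x 0; first by rewrite normr0 rpred0.
  move: xy; rewrite le_eqVlt => /orP[/eqP-> //|xy].
  by apply: (convex_order_convex _ xy Oay); rewrite normr_gt0.
by move: Oax; case: (ger0P x) => _; rewrite ?rpredN.
Qed.

Lemma convex_ideal_le (x y : convex_ring) :
  y \in convex_ideal -> `|val x| <= `|val y| -> x \in convex_ideal.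
Proof.
rewrite !inE => Iy xy; have [//|x0 /=] := eqVneq (val x) 0.
have y0 : val y != 0.
  by apply: contraNneq x0 => y0; rewrite -normr_le0 (le_trans xy) // y0 normr0.
move: Iy; rewrite (negPf y0) /=; apply: contra => Ox.
by apply: (convex_le Ox); rewrite !normfV lef_pV2 ?posrE ?normr_gt0.
Qed.

Lemma convex_ideal_closed : idealr_closed convex_ideal.
Proof.
split; first by rewrite inE rmorph0 eqxx.
  by rewrite inE rmorph1 oner_eq0 invr1 /= negbK rpred1.
move=> a u v Iu Iv.
have Iau : a * u \in convex_ideal.
  move: (Iu); rewrite !inE rmorphM /= mulf_eq0.
  have [_ _|u0] := eqVneq (val u) 0; first by rewrite orbT.
  have [//|a0 /=] := eqVneq (val a) 0.
  apply: contra => Oau.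
  by rewrite -[(val u)^-1](mulVKf a0) -invfM rpredM // (valP a).
have mono (x y : convex_ring) : x \in convex_ideal -> y \in convex_ideal ->
    `|val y| <= `|val x| -> x + y \in convex_ideal.
  move=> Ix Iy yx; apply: (@convex_ideal_le _ (2%:R * x)).
    move: (Ix); rewrite !inE rmorphM rmorph_nat mulf_eq0 pnatr_eq0 /=.
    case: eqP => //= _; apply: contra => O2.
    have n2 : 2%:R != 0 :> F by rewrite pnatr_eq0.
    by rewrite -[(val x)^-1](mulVKf n2) -invfM rpredM // rpred_nat.
  rewrite rmorphM rmorph_nat rmorphD normrM normr_nat.
  by rewrite mulr_natl mulr2n (le_trans (ler_normD _ _)) // lerD2l.
case: (lerP `|val v| `|val (a * u)|) => [|/ltW] h; first exact: mono.
by rewrite addrC; exact: mono.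
Qed.

HB.instance Definition _ :=
  isIdealr.Build convex_ring convex_ideal convex_ideal_closed.

Definition residue_field : Type := {ideal_quot convex_ideal}.

HB.instance Definition _ := GRing.ComNzRing.on residue_field.

Definition residue_class (x : convex_ring) : residue_field :=
  \pi_{ideal_quot convex_ideal} x.

Fact residue_class_zmod : zmod_morphism residue_class.
Proof. exact: (raddfB (\pi_{ideal_quot convex_ideal} : {additive _ -> _})). Qed.

Fact residue_class_monoid : monoid_morphism residue_class.
Proof.
split; first exact: (rmorph1 (\pi_{ideal_quot convex_ideal} : {rmorphism _ -> _})).
exact: (rmorphM (\pi_{ideal_quot convex_ideal} : {rmorphism _ -> _})).
Qed.

HB.instance Definition _ := GRing.isZmodMorphism.Build
  convex_ring residue_field residue_class residue_class_zmod.
HB.instance Definition _ :=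
  GRing.isMonoidMorphism.Build convex_ring residue_field residue_class
    residue_class_monoid.

Lemma residue_class_eq0 x : (residue_class x == 0) = (x \in convex_ideal).
Proof.
rewrite -[x in RHS]subr0 Quotient.idealrBE /residue_class.
by rewrite [\pi 0](rmorph0 (\pi_{ideal_quot convex_ideal} : {rmorphism _ -> _})).
Qed.

Definition residue_lift (x : residue_field) : convex_ring := repr x.

Lemma residue_liftK : cancel residue_lift residue_class.
Proof. by move=> x; rewrite /residue_class reprK. Qed.

Definition residue_inv (x : residue_field) : residue_field :=
  residue_class (insubd 0 (val (residue_lift x))^-1).

Lemma residue_mulVf x : x != 0 -> residue_inv x * x = 1.
Proof.
rewrite -{1}[x]residue_liftK residue_class_eq0 inE negb_or negbK => /andP[x0 Ox].
rewrite -{2}[x]residue_liftK -rmorphM -(rmorph1 residue_class).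
by congr residue_class; apply: val_inj; rewrite rmorphM rmorph1 /= insubdK // mulVf.
Qed.

Lemma residue_inv0 : residue_inv 0 = 0.
Proof.
have: residue_lift 0 \in convex_ideal by rewrite -residue_class_eq0 residue_liftK.
rewrite inE /residue_inv => /orP[/eqP->|nO].
  rewrite invr0; apply/eqP; rewrite residue_class_eq0 inE.
  by rewrite insubdK ?rpred0 // eqxx.
by rewrite /insubd insubN // rmorph0.
Qed.

HB.instance Definition _ :=
  GRing.ComNzRing_isField.Build residue_field residue_mulVf residue_inv0.

(** The sign of a nonzero class is the sign of any of its representatives in O
    (lemma [residue_ge0E]). *)
Definition residue_ge0 (x : residue_field) : bool :=
  (x == 0) || (0 < val (residue_lift x)).

Definition residue_le (x y : residue_field) : bool := residue_ge0 (y - x).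

Definition residue_lt (x y : residue_field) : bool :=
  (y != x) && residue_le x y.

Definition residue_norm (x : residue_field) : residue_field :=
  if residue_ge0 x then x else - x.

Lemma convex_ideal_sign (a b : convex_ring) :
  a - b \in convex_ideal -> a \notin convex_ideal -> 0 < val a -> 0 < val b.
Proof.
move=> Iab nIa a0; rewrite ltNge; apply/negP => b0; move/negP: nIa; apply.
apply: (convex_ideal_le Iab); rewrite rmorphB /=.
by rewrite !ger0_norm ?subr_ge0 ?(ltW a0) ?(le_trans b0 (ltW a0)) // lerDl oppr_ge0.
Qed.

Lemma residue_ge0E a :
  residue_ge0 (residue_class a) = (a \in convex_ideal) || (0 < val a).
Proof.
rewrite /residue_ge0 residue_class_eq0.
have [//|nIa /=] := boolP (a \in convex_ideal).
have Iab : a - residue_lift (residue_class a) \in convex_ideal.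
  by rewrite -residue_class_eq0 rmorphB /= residue_liftK subrr.
have nIb : residue_lift (residue_class a) \notin convex_ideal.
  by rewrite -residue_class_eq0 residue_liftK residue_class_eq0.
apply/idP/idP; last exact: convex_ideal_sign.
by apply: convex_ideal_sign => //; rewrite -opprB rpredN.
Qed.

Lemma residue_ge0_le (a : convex_ring) :
  0 <= val a -> residue_ge0 (residue_class a).
Proof.
rewrite residue_ge0E le_eqVlt => /orP[/eqP a0|->]; last by rewrite orbT.
by rewrite inE -a0 eqxx.
Qed.

Lemma residue_ge0_lift x : residue_ge0 x ->
  exists2 a, residue_class a = x & 0 <= val a.
Proof.
move=> /orP[/eqP->|x0]; first by exists 0; rewrite ?rmorph0.
by exists (residue_lift x); [exact: residue_liftK | exact: ltW].
Qed.

Lemma residue_le0_add x y :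
  residue_le 0 x -> residue_le 0 y -> residue_le 0 (x + y).
Proof.
rewrite /residue_le !subr0 => /residue_ge0_lift[a <- a0] /residue_ge0_lift[b <- b0].
by rewrite -rmorphD; apply: residue_ge0_le; rewrite rmorphD addr_ge0.
Qed.

Lemma residue_le0_mul x y :
  residue_le 0 x -> residue_le 0 y -> residue_le 0 (x * y).
Proof.
rewrite /residue_le !subr0 => /residue_ge0_lift[a <- a0] /residue_ge0_lift[b <- b0].
by rewrite -rmorphM; apply: residue_ge0_le; rewrite rmorphM mulr_ge0.
Qed.

Lemma residue_le0_anti x : residue_le 0 x -> residue_le x 0 -> x = 0.
Proof.
rewrite /residue_le subr0 sub0r => /residue_ge0_lift[a <- a0].
rewrite -rmorphN residue_ge0E rpredN => /orP[Ia|]; last first.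
  by rewrite rmorphN oppr_gt0 ltNge a0.
by apply/eqP; rewrite residue_class_eq0.
Qed.

Lemma residue_sub_ge0 x y : residue_le 0 (y - x) = residue_le x y.
Proof. by rewrite /residue_le subr0. Qed.

Lemma residue_le0_total x : residue_le 0 x || residue_le x 0.
Proof.
rewrite /residue_le subr0 sub0r -[x]residue_liftK -rmorphN.
case: (lerP 0 (val (residue_lift x))) => a0; apply/orP; [left|right];
  apply: residue_ge0_le => //.
by rewrite rmorphN oppr_ge0 ltW.
Qed.

Lemma residue_normN x : residue_norm (- x) = residue_norm x.
Proof.
have := residue_le0_total x; have := @residue_le0_anti x.
rewrite /residue_norm /residue_le subr0 sub0r opprK.
case: ifP => Nx; case: ifP => // x0; first by move=> /(_ isT isT)->; rewrite oppr0.
Qed.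

Lemma residue_ge0_norm x : residue_le 0 x -> residue_norm x = x.
Proof. by rewrite /residue_le /residue_norm subr0 => ->. Qed.

Lemma residue_lt_def x y : residue_lt x y = (y != x) && residue_le x y.
Proof. by []. Qed.

HB.instance Definition _ := Num.IntegralDomain_isLeReal.Build residue_field
  residue_le0_add residue_le0_mul residue_le0_anti residue_sub_ge0
  residue_le0_total residue_normN residue_ge0_norm residue_lt_def.

Lemma residue_class_gt0 a :
  (0 < residue_class a) = (0 < val a) && (a \notin convex_ideal).
Proof.
rewrite lt_def residue_class_eq0 andbC.
have -> : (0 <= residue_class a) = residue_ge0 (residue_class a - 0) by [].
by rewrite subr0 residue_ge0E; case: (a \in convex_ideal); rewrite ?andbF ?andbT.
Qed.

Lemma residue_class_le (a b : convex_ring) :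
  val a <= val b -> residue_class a <= residue_class b.
Proof.
move=> ab; have -> : (residue_class a <= residue_class b) =
  residue_ge0 (residue_class b - residue_class a) by [].
by rewrite -rmorphB; apply: residue_ge0_le; rewrite rmorphB subr_ge0.
Qed.

Lemma residue_real_closed : Num.real_closed_axiom residue_field.
Proof.
move=> p a b ab /andP[pa pb].
have [a0|pa0] := eqVneq p.[a] 0; first by exists a; rewrite ?lexx // rootE a0.
have [b0|pb0] := eqVneq p.[b] 0; first by exists b; rewrite ?ab ?lexx // rootE b0.
pose q := \poly_(i < size p) residue_lift p`_i.
have qp : map_poly residue_class q = p.
  apply/polyP => i; rewrite coef_map coef_poly.
  case: ltnP => [_|pi]; first exact: residue_liftK.
  by rewrite raddf0 nth_default.
have qE (c : convex_ring) : p.[residue_class c] = residue_class q.[c].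
  by rewrite -qp horner_map.
have QE (c : convex_ring) : (map_poly val q).[val c] = val q.[c].
  by rewrite horner_map.
pose al := residue_lift a; pose be := residue_lift b.
have {}pa : p.[residue_class al] < 0.
  by rewrite residue_liftK lt_neqAle pa0.
have {}pb : 0 < p.[residue_class be].
  by rewrite residue_liftK lt_neqAle eq_sym pb0.
have ale : val al <= val be.
  have [//|/ltW ba] := lerP (val al) (val be).
  have /eqP ab' : a == b.
    by rewrite eq_le ab -[b]residue_liftK -[a]residue_liftK residue_class_le.
  by move: (lt_trans pa pb); rewrite !residue_liftK ab' ltxx.
have Qa : (map_poly val q).[val al] <= 0.
  rewrite QE; move: pa; rewrite qE -oppr_gt0 -rmorphN residue_class_gt0.
  by move=> /andP[+ _]; rewrite rmorphN oppr_gt0 => /ltW.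
have Qb : 0 <= (map_poly val q).[val be].
  by rewrite QE; move: pb; rewrite qE residue_class_gt0 => /andP[/ltW].
have Qab : (map_poly val q).[val al] <= 0 <= (map_poly val q).[val be].
  by rewrite Qa Qb.
have [x /andP[ax xb] /rootP Qx] := poly_ivt ale Qab.
have Ox : x \in O.
  have Oab : `|val al| + `|val be| \in O.
    by rewrite rpredD //; [apply: (@convex_le _ (val al)) | apply: (@convex_le _ (val be))];
      rewrite ?normr_id ?(valP al) ?(valP be).
  apply: (convex_le Oab); rewrite [leRHS]ger0_norm ?addr_ge0 // ler_norml.
  apply/andP; split; last by rewrite (le_trans xb) // (le_trans (ler_norm _)) // lerDr.
  by apply: (le_trans _ ax); rewrite lerNl (le_trans (ler_norm _)) // normrN lerDl.
exists (residue_class (ConvexRing Ox)).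
  rewrite -[a]residue_liftK -[b]residue_liftK.
  by rewrite !residue_class_le.
have q0 : q.[ConvexRing Ox] = 0 by apply: val_inj; rewrite -QE; exact: Qx.
by rewrite rootE qE q0 raddf0.
Qed.

HB.instance Definition _ :=
  Num.RealField_isClosed.Build residue_field residue_real_closed.

(** The quotient map O -> O / I, extended by 0 outside O. *)
Definition residue (x : F) : residue_field := residue_class (insubd 0 x).

Lemma residueE (x : F) (Ox : x \in O) : residue x = residue_class (ConvexRing Ox).
Proof.
by congr residue_class; apply: val_inj; rewrite insubdK.
Qed.

End ResidueField.

Section Symplectic.
Variables (K : rcfType) (V : vectType K) (w : {skew_symmetric V}).

Definition lagrangian (l : {vspace V}) : Prop := orthov w l = l.

Definition transverse (l l' : {vspace V}) : Prop := (l :&: l' = 0)%VS.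

(** [triple_map l2 l3 v] is the vector T(v) of l3 with v + T(v) in l2: it is
    minus the component of v along l3 in the decomposition V = l3 (+) l2. *)
Definition triple_map (l2 l3 : {vspace V}) (v : V) : V := - daddv_pi l3 l2 v.

Definition triple_form (l2 l3 : {vspace V}) (v : V) : K :=
  w v (triple_map l2 l3 v).

Definition maximal_triple (l1 l2 l3 : {vspace V}) : Prop :=
  [/\ [/\ lagrangian l1, lagrangian l2 & lagrangian l3],
      [/\ transverse l1 l2, transverse l2 l3 & transverse l1 l3] &
      forall v, v \in l1 -> v != 0 -> 0 < triple_form l2 l3 v].

Lemma triple_mapP (l2 l3 : {vspace V}) (v : V) :
  transverse l2 l3 -> (l2 + l3 = fullv)%VS ->
  forall u, (u \in l3) && (v + u \in l2) = (u == triple_map l2 l3 v).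
Proof.
rewrite /transverse capvC addvC => tr32 sum32 u.
have dec : daddv_pi l3 l2 v + daddv_pi l2 l3 v = v.
  by apply: daddv_pi_add; rewrite ?sum32 ?memvf.
have Tl2 : v + triple_map l2 l3 v \in l2.
  by rewrite -{1}dec /triple_map addrAC subrr add0r memv_pi.
have Tl3 : triple_map l2 l3 v \in l3 by rewrite memvN memv_pi.
apply/andP/eqP => [[ul3 ul2]|->//]; apply/eqP; rewrite -subr_eq0 -memv0 -tr32.
rewrite memv_cap memvB //=.
by have := memvB ul2 Tl2; rewrite opprD addrACA subrr add0r.
Qed.

End Symplectic.

Definition symplectic_mx (K : nzRingType) n : 'M[K]_(n + n) :=
  block_mx 0 1%:M (- 1%:M) 0.

Section StandardForm.
Variables (K : fieldType) (n : nat).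

Definition std_form (u v : 'cV[K]_(n + n)) : K :=
  (u^T *m symplectic_mx K n *m v) 0 0.

Fact std_form_bilinear : bilinear_for
  (GRing.Scale.Law.clone _ _ *%R _) (GRing.Scale.Law.clone _ _ (idfun \; *%R) _)
  std_form.
Proof.
split=> [v|u] a x y /=; rewrite /std_form.
  by rewrite linearP /= !mulmxDl -!scalemxAl !mxE.
by rewrite mulmxDr -scalemxAr !mxE.
Qed.

HB.instance Definition _ :=
  bilinear_isBilinear.Build K 'cV[K]_(n + n) 'cV[K]_(n + n) K _ _ std_form
    std_form_bilinear.

Lemma tr_symplectic_mx : (symplectic_mx K n)^T = - symplectic_mx K n.
Proof.
by rewrite /symplectic_mx tr_block_mx opp_block_mx !trmx0 linearN /= !trmx1 opprK !oppr0.
Qed.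

Fact std_form_skew (u v : 'cV[K]_(n + n)) :
  std_form u v = (-1) ^+ true * idfun (std_form v u).
Proof.
rewrite expr1 mulN1r /= /std_form -[in RHS](trmxK (v^T *m _ *m u)) [in RHS]mxE.
by rewrite !trmx_mul trmxK tr_symplectic_mx mulmxA mulmxN mulNmx [X in _ = - X]mxE opprK.
Qed.

HB.instance Definition _ :=
  isHermitianSesquilinear.Build K 'cV[K]_(n + n) true idfun std_form std_form_skew.

End StandardForm.

Lemma symplectic_mxK (K : fieldType) n :
  symplectic_mx K n *m symplectic_mx K n = - 1%:M.
Proof.
rewrite /symplectic_mx mulmx_block !mul0mx !mulmx0 !mul1mx !mulmx1 !add0r !addr0.
by rewrite [in RHS]scalar_mx_block opp_block_mx !oppr0.
Qed.

Lemma std_form_psymplectic (K : rcfType) n : is_psymplectic (@std_form K n).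
Proof.
split; last by rewrite pchar_num.
  rewrite /nondegenerate -subv0; apply/subvP => u /mem_orthovP uV.
  rewrite memv0 -[u]trmxK -(inj_eq (@trmx_inj _ _ _)) trmxK trmx0; apply/eqP.
  have uJ0 : u^T *m symplectic_mx K n = 0.
    apply/rowP => j; rewrite [RHS]mxE.
    have : std_form u (delta_mx j 0) = 0 := uV _ (memvf _).
    by rewrite /std_form -colE mxE.
  by rewrite -[u^T]mulmx1 -[1%:M]opprK -symplectic_mxK mulmxN mulmxA uJ0 mul0mx oppr0.
by split.
Qed.

Section SymplecticBasis.
Variables (K : rcfType) (V : vectType K) (w : {skew_symmetric V}).
Variables (n : nat) (e : (n + n).-tuple V).

Definition symplectic_basis : Prop :=
  basis_of fullv e /\ forall i j, w (tnth e i) (tnth e j) = symplectic_mx K n i j.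

(** Column convention: f (e_j) = sum_i (basis_mx f) i j *: e_i. *)
Definition basis_mx (f : 'End(V)) : 'M[K]_(n + n) :=
  \matrix_(i, j) coord e i (f (tnth e j)).

Lemma basis_mxE (f : 'End(V)) j : symplectic_basis ->
  f (tnth e j) = \sum_i basis_mx f i j *: tnth e i.
Proof.
move=> eP; rewrite {1}(coord_basis eP.1 (memvf (f (tnth e j)))).
by apply: eq_bigr => i _; rewrite mxE -tnth_nth.
Qed.

Lemma basis_mx1 : symplectic_basis -> basis_mx \1%VF = 1%:M.
Proof.
move=> eP; apply/matrixP => i j; rewrite !mxE id_lfunE (tnth_nth 0).
by rewrite coord_free ?(basis_free eP.1) // eq_sym.
Qed.

Lemma basis_mxM (f g : 'End(V)) : symplectic_basis ->
  basis_mx (f \o g)%VF = basis_mx f *m basis_mx g.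
Proof.
move=> eP; apply/matrixP => i j; rewrite [LHS]mxE [RHS]mxE comp_lfunE (basis_mxE g _ eP).
rewrite !linear_sum /=.
by apply: eq_bigr => k _; rewrite !linearZ /= [basis_mx f i k]mxE mulrC.
Qed.

Lemma basis_mx_symplectic (f : 'End(V)) : symplectic_basis -> (forall u v, w (f u) (f v) = w u v) ->
  (basis_mx f)^T *m symplectic_mx K n *m basis_mx f = symplectic_mx K n.
Proof.
move=> eP fw; apply/matrixP => i j; rewrite -(eP.2 i j) -fw !(basis_mxE _ _ eP).
rewrite linear_sumr /= mxE; apply: eq_bigr => k _.
rewrite linearZr /= linear_sumlz mxE mulrC; congr (_ * _).
by apply: eq_bigr => l _; rewrite linearZl /= (eP.2 l k) !mxE.
Qed.

End SymplecticBasis.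

Section Hyperbolic.
Variable R : realType.
Local Open Scope classical_set_scope.
Local Open Scope complex_scope.

Definition upper_half_plane : set R[i] := [set z | 0 < complex.Im z].

Definition mobius (A : 'M[R]_2) (z : R[i]) : R[i] :=
  ((A 0 0)%:C * z + (A 0 1)%:C) / ((A 1 0)%:C * z + (A 1 1)%:C).

(** [half_plane_chart D] is D seen in the real coordinates x, y of z = x + i y. *)
Definition half_plane_chart (D : set R[i]) :
    set (measurableTypeR R * measurableTypeR R) :=
  [set p | D (p.1 +i* p.2)].

Definition hyperbolic_area (D : set R[i]) : \bar R :=
  (\int[(@lebesgue_measure R) \x (@lebesgue_measure R)]_(p in half_plane_chart D)
     ((p.2 : R) ^- 2)%:E)%E.

Definition fundamental_domain (G : set 'M[R]_2) (D : set R[i]) : Prop :=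
  D `<=` upper_half_plane /\
  forall z, upper_half_plane z ->
    exists! z', D z' /\ exists2 A, G A & z' = mobius A z.

(** A subgroup Gamma of PSL(2,R) = SL(2,R)/{1,-1} is encoded by its full preimage
    G in SL(2,R). Gamma is discrete and acts freely, so it is the fundamental
    group of the hyperbolic surface Gamma \ H^2, whose area is that of a
    fundamental domain; finite area forces finite genus and finitely many cusps. *)
Record surface_group (G : set 'M[R]_2) : Prop := SurfaceGroup {
  surface_group_det : forall A, G A -> \det A = 1;
  surface_group1 : G 1%:M;
  surface_groupN : forall A, G A -> G (- A);
  surface_groupM : forall A B, G A -> G B -> G (A *m B);
  surface_groupV : forall A, G A -> G (invmx A);
  surface_group_discrete : isolated G = G;
  surface_group_free : forall A z, G A -> upper_half_plane z ->
    mobius A z = z -> A = 1%:M \/ A = - 1%:M;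
  surface_group_area : exists D, [/\ fundamental_domain G D,
    measurable (half_plane_chart D) & (hyperbolic_area D < +oo)%E]
}.

(** The boundary circle is R with a point at infinity, [None]. *)
Definition boundary : Type := option R.

Definition boundary_mobius (A : 'M[R]_2) (x : boundary) : boundary :=
  match x with
  | Some t => if A 1 0 * t + A 1 1 == 0 then None
              else Some ((A 0 0 * t + A 0 1) / (A 1 0 * t + A 1 1))
  | None => if A 1 0 == 0 then None else Some (A 0 0 / A 1 0)
  end.

Definition boundary_lt (x y : boundary) : bool :=
  match x, y with
  | Some s, Some t => s < t
  | Some _, None => true
  | None, _ => false
  end.

(** Cyclic order of the circle R u {oo}, oriented by increasing reals, i.e. as
    the boundary of the upper half plane. *)
Definition positively_oriented (x y z : boundary) : Prop :=
  [\/ boundary_lt x y && boundary_lt y z,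
      boundary_lt y z && boundary_lt z x |
      boundary_lt z x && boundary_lt x y].

Definition hyperbolic (A : 'M[R]_2) : Prop := 2 < `|\tr A|.

End Hyperbolic.

Section Representations.
Variables (R : realType) (G : set 'M[R]_2).
Variables (K : rcfType) (V : vectType K) (w : {skew_symmetric V}).

(** rho 1 = 1 follows, and rho (-1) = 1 says that rho factors through the image
    of G in PSL(2,R). *)
Definition symplectic_representation (rho : 'M[R]_2 -> 'End(V)) : Prop :=
  [/\ forall A, G A -> forall u v, w (rho A u) (rho A v) = w u v,
      forall A B, G A -> G B -> rho (A *m B) = (rho A \o rho B)%VF &
      rho (- 1%:M) = \1%VF].

Definition maximal_framing (rho : 'M[R]_2 -> 'End(V)) (S : set (boundary R))
    (phi : boundary R -> {vspace V}) : Prop :=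
  [/\ forall A x, G A -> S x -> S (boundary_mobius A x),
      forall A x, G A -> hyperbolic A -> boundary_mobius A x = x -> S x,
      forall x, S x -> lagrangian w (phi x),
      forall A x, G A -> S x -> phi (boundary_mobius A x) = (rho A @: phi x)%VS &
      forall x y z, S x -> S y -> S z -> positively_oriented x y z ->
        maximal_triple w (phi x) (phi y) (phi z)].

Definition admits_maximal_framing (rho : 'M[R]_2 -> 'End(V)) : Prop :=
  exists S phi, maximal_framing rho S phi.

End Representations.

Section Reduction.
Variables (R : realType) (F : rcfType) (O : convexSubring F).
Variables (V : vectType F) (n : nat) (e : (n + n).-tuple V).

Definition integral_in (f : 'End(V)) : Prop :=
  forall i j, basis_mx e f i j \in O.

Definition reduction (rho : 'M[R]_2 -> 'End(V)) (A : 'M[R]_2) :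
    'End('cV[residue_field O]_(n + n)) :=
  linfun (mulmx (map_mx (@residue F O) (basis_mx e (rho A)))).

Let lift_mx (M : 'M[F]_(n + n)) : 'M[convex_ring O]_(n + n) := map_mx (insubd 0) M.

Let lift_mxK (M : 'M[F]_(n + n)) :
  (forall i j, M i j \in O) -> map_mx val (lift_mx M) = M.
Proof. by move=> MO; apply/matrixP => i j; rewrite !mxE insubdK. Qed.

Let map_val_inj : injective (map_mx val : 'M[convex_ring O]_(n + n) -> 'M[F]_(n + n)).
Proof.
by move=> M N /matrixP MN; apply/matrixP => i j; apply: val_inj; have := MN i j; rewrite !mxE.
Qed.

Let residue_mx (M : 'M[F]_(n + n)) :
  map_mx (@residue F O) M = map_mx (@residue_class F O) (lift_mx M).
Proof. by apply/matrixP => i j; rewrite !mxE. Qed.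

Let map_symplectic_mx (K L : nzRingType) (f : {rmorphism K -> L}) :
  map_mx f (symplectic_mx K n) = symplectic_mx L n.
Proof. by rewrite /symplectic_mx map_block_mx !map_mx0 map_mxN !map_mx1. Qed.

Lemma reduction_symplectic (G : set 'M[R]_2) (w : {skew_symmetric V}) rho :
    (forall A B, G A -> G B -> G (A *m B)) ->
    symplectic_basis w e -> symplectic_representation G w rho ->
    (forall A, G A -> integral_in (rho A)) ->
  symplectic_representation G (@std_form (residue_field O) n) (reduction rho).
Proof.
move=> GM eP [rw rM rN] rO; split.
- move=> A GA u v; rewrite /reduction !lfunE /= /std_form.
  rewrite trmx_mul !mulmxA -[u^T *m _ *m _]mulmxA -[u^T *m (_ *m _) *m _]mulmxA.
  congr ((u^T *m _ *m v) 0 0); rewrite residue_mx map_trmx.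
  rewrite -(map_symplectic_mx (@residue_class F O)) -!map_mxM; congr map_mx.
  apply: map_val_inj; rewrite !map_mxM -map_trmx lift_mxK; last exact: rO.
  by rewrite map_symplectic_mx (basis_mx_symplectic eP (rw A GA)).
- move=> A B GA GB; apply/lfunP => u; rewrite comp_lfunE !lfunE /= mulmxA.
  congr (_ *m u); rewrite rM // (basis_mxM _ _ eP) !residue_mx -map_mxM; congr map_mx.
  apply: map_val_inj; rewrite map_mxM !lift_mxK //; try exact: rO.
  by rewrite -(basis_mxM _ _ eP) -rM //; apply: rO; exact: GM.
- apply/lfunP => u; rewrite id_lfunE lfunE /= rN (basis_mx1 eP) residue_mx.
  rewrite (_ : lift_mx 1%:M = 1%:M) ?map_mx1 ?mul1mx //.
  by apply: map_val_inj; rewrite map_mx1 lift_mxK // => i j; rewrite mxE rpred_nat.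
Qed.

End Reduction.

(* Main.v *)
Require Import Defs.
From HB Require Import structures.
From mathcomp Require Import all_boot all_order all_algebra.
From mathcomp Require Import ring_quotient sesquilinear.
From mathcomp Require Import all_classical all_reals all_analysis.
From mathcomp Require Import measurable_realfun complex ring lra zify.

Set Implicit Arguments.
Unset Strict Implicit.
Unset Printing Implicit Defensive.

Import Order.TTheory GRing.Theory Num.Theory.
Import numFieldNormedType.Exports.

Local Open Scope ring_scope.

(** The new framing sends a fixed point x of a hyperbolic element of G to the reduction
    of the integral vectors of phi x; this is a Lagrangian, equivariantly in x. Once the
    reductions at distinct points are known to be transverse, positivity passes to the
    residue field up to semidefiniteness, and semidefinite nondegenerate is definite.

    Transversality at the two fixed points of a hyperbolic b: finite area yields a in G
    whose axis crosses that of b. On phi b- consider the positive form of the triple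
    (b+, a+, b-). A collar estimate, comparing a and large powers of b, shows that a power
    of b contracts this form by a factor C / (C + 1) with C in O, so that after reduction
    all its eigenvalues on phi b- have modulus < 1; on phi b+ they have modulus > 1.

    For other pairs x, y, with x fixed by b, a conjugate of b has its two fixed points
    between y and x; the reductions at x and y meet inside the reductions at both of
    these fixed points, which are transverse by the previous case. *)

(** * Invariant area of the upper half plane *)

Section LineMeasures.
Variable R : realType.
Local Open Scope classical_set_scope.
Local Open Scope ereal_scope.
Local Notation mu := (@lebesgue_measure R).
Local Notation T := (measurableTypeR R).

(** Transversality is the obstacle: it need not survive reduction, since a quantity that is positive
    in [F] may be infinitesimal, and limits along powers of an element are out of reach when [F] is
    non-archimedean. Every strict inequality must therefore hold with a margin that is not
    infinitesimal, that is, with constants in [O]. Their source is the integrality of the matrices: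
    an integral matrix that expands a positive form is also bounded for that form, by a constant of
    [O] built from the coefficients of its characteristic polynomial (Cayley-Hamilton). Applied to
    [a], this gives [C]; the crossing of the axes is what lets the collar estimate transfer the
    bound from [a] to powers of [b]. The forms themselves may be far from integral; the estimates
    reach the residue field through determinants, which can be computed in an orthonormal basis of
    the form. Finite area yields crossing because, if the orbits of the ends of an axis stayed on
    one side of it, a thin strip of infinite area on the other side would be disjoint from its
    translates. *)

Lemma pushforward_lebesgue_unique (f : T -> T) (k : R) (A : set T) :
    measurable_fun setT f -> (0 <= k)%R ->
    (forall b c : R, mu `]b, c]%classic = k%:E * mu (f @^-1` `]b, c]%classic)) ->
  measurable A -> mu A = k%:E * mu (f @^-1` A).
Proof.
move=> mf k0 fE mA.
pose nu : {measure set T -> \bar R} := mscale (NngNum k0) (measure_function_pushforward__canonical__measure_function_Measure mu mf).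
suff H X : ocitv X -> mu X = nu X by exact: (@lebesgue_measure_unique _ nu H A mA).
by move=> [[b c]] _ <-; exact: fE.
Qed.

Lemma lebesgue_measure_translate (a : R) (A : set T) : measurable A ->
  mu [set x | A (x + a)%R] = mu A.
Proof.
move=> mA; have mf : measurable_fun setT (fun x : T => (x + a)%R : T).
  exact: measurable_funD.
apply/esym; rewrite -[RHS]mul1e; apply: (pushforward_lebesgue_unique mf) => // b c.
rewrite mul1e (_ : _ @^-1` _ = `](b - a)%R, (c - a)%R]%classic); last first.
  by apply/seteqP; split=> x /=; rewrite !in_itv /= ltrBlDr lerBrDr.
rewrite !lebesgue_measure_itv /= !lte_fin ltrD2r.
by case: ifPn => // _; rewrite -!EFinB; congr EFin; ring.
Qed.

Lemma lebesgue_measure_reflect (a : R) (A : set T) : measurable A ->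
  mu [set x | A (a - x)%R] = mu A.
Proof.
move=> mA; rewrite -[RHS](lebesgue_measure_translate a) //.
have mB : measurable [set x : T | A (x + a)%R].
  rewrite -[X in measurable X]setTI.
  have : measurable_fun setT (fun x : T => (x + a)%R : T) by exact: measurable_funD.
  exact.
rewrite -[RHS]lebesgue_measureN // /pushforward.
by congr (mu _); apply/seteqP; split=> x /=; rewrite addrC.
Qed.

Lemma lebesgue_measure_scale (k : R) (A : set T) : (0 < k)%R -> measurable A ->
  mu [set x | A (k * x)%R] = k^-1%:E * mu A.
Proof.
move=> k0 mA; have mf : measurable_fun setT (fun x : T => (k * x)%R : T).
  exact: measurable_funM.
have k0' : (0 <= k)%R by exact: ltW.
rewrite [in RHS](pushforward_lebesgue_unique mf k0') //.
  by rewrite muleA -EFinM mulVf ?gt_eqF // mul1e.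
move=> b c.
rewrite (_ : _ @^-1` _ = `](b / k)%R, (c / k)%R]%classic); last first.
  by apply/seteqP; split=> x /=; rewrite !in_itv /= ltr_pdivrMr // ler_pdivlMr // mulrC.
rewrite !lebesgue_measure_itv /= !lte_fin ltr_pM2r ?invr_gt0 //.
case: ifPn => // _; rewrite ?mule0 // -!EFinB -EFinM; congr EFin.
by rewrite -mulrBl mulrCA divff ?mulr1 // gt_eqF.
Qed.

Lemma measurable_fun_inv_pos (D : set T) : measurable D ->
  D `<=` [set y | (0 < y)%R] -> measurable_fun D (fun y : T => (y^-1)%R : T).
Proof.
move=> mD D0; apply: (eq_measurable_fun (fun y => expR (- ln y))).
  by move=> y /set_mem /D0 y0; rewrite expRN lnK.
apply: measurableT_comp => //; apply: measurable_funTS.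
by apply: measurableT_comp.
Qed.

Lemma measurable_pos : measurable [set y : T | (0 < y)%R].
Proof.
rewrite (_ : [set _ | _] = `]0%R, +oo[%classic) //.
by apply/seteqP; split=> x /=; rewrite in_itv /= andbT.
Qed.

(** Substitution y = exp s. The measure with density 1/y, transported by [ln], agrees with Lebesgue
    measure on half-open intervals by the fundamental theorem of calculus, hence on all measurable
    sets. *)
Lemma integral_inv_pos (A : set T) : measurable A -> A `<=` [set y | (0 < y)%R] ->
  \int[mu]_(y in A) (y^-1)%:E = mu [set s | A (expR s)].
Proof.
move=> mA A0.
(* The density is extended by 0, so the default values of [ln] on nonpositive reals carry no
   mass. *)
pose f (y : T) : \bar R := if (0 < y)%R then (y^-1)%:E else 0.
have f0 y : 0 <= f y by rewrite /f; case: ifPn => // y0; rewrite lee_fin invr_ge0 ltW.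
have mf : measurable_fun setT f.
  rewrite /f; apply: measurable_fun_if => //.
  - by apply: measurable_fun_ltr.
  - apply/measurable_EFinP; apply: measurable_fun_inv_pos.
      by rewrite setTI; exact: measurable_pos.
    by move=> x [].
pose m (B : set T) := \int[mu]_(y in B) f y.
have m0 : m set0 = 0 by exact: integral_set0.
have mge0 B : 0 <= m B by apply: integral_ge0.
have msa : semi_sigma_additive m by exact: semi_sigma_additive_nng_induced.
pose mM := isMeasure.Build _ _ _ m m0 mge0 msa.
pose mm : {measure set T -> \bar R} := HB.pack m mM.
have mln : measurable_fun setT (fun y : T => ln y : T) by exact: measurable_ln.
have mP (C : set T) : measurable C -> measurable [set y : T | (0 < y)%R /\ C (ln y)].
  move=> mC; rewrite -[X in measurable X]/([set y : T | (0 < y)%R] `&` (@ln R @^-1` C)).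
  apply: measurableI; first exact: measurable_pos.
  by rewrite -[X in measurable X]setTI; exact: mln.
have mE (C : set T) : measurable C -> m (@ln R @^-1` C) = m [set y | (0 < y)%R /\ C (ln y)].
  move=> mC; rewrite /m -[X in _ = integral _ X _]/([set y : T | (0 < y)%R] `&` (@ln R @^-1` C)).
  rewrite integral_mkcondl; apply: eq_integral => y _; rewrite patchE /f /mem.
  by case: ifPn => y0; [rewrite mem_set | rewrite memNset //; exact/negP].
have E (B : set T) : measurable B -> mu B = m [set y | (0 < y)%R /\ B (ln y)].
  move=> mB; rewrite -mE //.
  pose nu : {measure set T -> \bar R} :=
    measure_function_pushforward__canonical__measure_function_Measure mm mln.
  suff H X : ocitv X -> mu X = nu X by exact: (@lebesgue_measure_unique _ nu H B mB).
  move=> [[b c]] _ <-; rewrite -[RHS]/(m (@ln R @^-1` `]b, c]%classic)) mE //=.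
  have [cb|bc] := leP c b.
    rewrite set_itv_ge ?bnd_simp -?leNgt // measure0.
    rewrite (_ : [set y | _] = set0) ?m0 //.
    rewrite -subset0 => x /= []; rewrite in_itv /= => _ /andP[bx xc].
    by move: (lt_le_trans bx xc); rewrite ltNge cb.
  rewrite lebesgue_measure_itv /= lte_fin bc.
  rewrite (_ : [set y | _] = `](expR b), (expR c)]%classic); last first.
    apply/seteqP; split=> x /=; rewrite !in_itv /=.
      by move=> [x0]; rewrite -ltr_expR -[(ln x <= c)%R]ler_expR lnK.
    move=> /andP[bx xc]; have x0 : (0 < x)%R by apply: lt_trans bx; exact: expR_gt0.
    by split=> //; rewrite -ltr_expR -[(ln x <= c)%R]ler_expR lnK // bx xc.
  have pos y : (y \in `[expR b, expR c] -> 0 < y)%R.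
    by rewrite in_itv /= => /andP[+ _]; apply: lt_le_trans; exact: expR_gt0.
  rewrite /m integral_itv_obnd_cbnd; last exact: measurable_funTS.
  transitivity (\int[mu]_(y in `[(expR b), (expR c)]) ((y : R)^-1)%:E); last first.
    by apply: eq_integral => y; rewrite inE => /pos y0; rewrite /f y0.
  rewrite (@continuous_FTC2 _ _ (@ln R)) ?expRK ?ltr_expR //.
  - apply: continuous_in_subspaceT => y; rewrite inE => /pos y0.
    by apply: inv_continuous; rewrite gt_eqF.
  - split.
    + by move=> y /subset_itv_oo_cc /pos y0; apply: ex_derive; exact: is_derive1_ln.
    + by apply: cvg_at_right_filter; apply: continuous_ln; exact: expR_gt0.
    + by apply: cvg_at_left_filter; apply: continuous_ln; exact: expR_gt0.
  - move=> y /subset_itv_oo_cc /pos y0; rewrite derive1E.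
    by have [_ ->] := is_derive1_ln y0.
rewrite E; last first.
  by rewrite -[X in measurable X]setTI; apply: measurable_expR.
rewrite (_ : [set y | _] = A); last first.
  apply/seteqP; split=> y /=; first by move=> [y0]; rewrite lnK.
  by move=> Ay; have y0 := A0 _ Ay; rewrite lnK.
by apply: eq_integral => y /set_mem/A0 y0; rewrite /f ifT.
Qed.
End LineMeasures.

(** * Hyperbolic area in the coordinates x, y *)

Section PlaneArea.
Variable R : realType.
Local Open Scope classical_set_scope.
Local Open Scope ereal_scope.
Local Notation mu := (@lebesgue_measure R).
Local Notation T := (measurableTypeR R).

Lemma weighted_tonelli (C : set (T * T)) (g : T -> \bar R) : measurable C ->
    measurable_fun setT g -> (forall y, 0 <= g y) ->
  \int[mu]_y (g y * mu (ysection C y)) = \int[mu]_x \int[mu]_(y in xsection C x) g y.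
Proof.
move=> mC mg g0; pose f (p : T * T) := (\1_C p)%:E * g p.2.
have f0 p : 0 <= f p by rewrite mule_ge0 // lee_fin.
have mf : measurable_fun setT f.
  apply: emeasurable_funM; first by apply/measurable_EFinP; exact: measurable_indic.
  by apply: measurableT_comp.
transitivity (\int[mu]_y \int[mu]_x f (x, y)).
  apply: eq_integral => y _; rewrite /f /=.
  have yE x : (\1_C (x, y))%:E = (\1_(ysection C y) x)%:E :> \bar R.
    by rewrite !indicE mem_ysection.
  under [RHS]eq_integral do rewrite yE.
  rewrite ge0_integralZr //; last first.
    by apply/measurable_EFinP; apply: measurable_indic; exact: measurable_ysection.
  by rewrite integral_indic ?setIT 1?muleC //; exact: measurable_ysection.
rewrite -(fubini_tonelli f mf f0); apply: eq_integral => x _.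
rewrite [RHS]integral_mkcond; apply: eq_integral => y _.
rewrite /f /= patchE indicE mem_xsection.
by case: ifPn => _; rewrite ?mul1e ?mul0e.
Qed.

Definition upper_half : set (T * T) := [set p | (0 < p.2)%R].

Definition plane_area (C : set (T * T)) : \bar R :=
  \int[mu \x mu]_(p in C) ((p.2 : R) ^- 2)%:E.

Lemma measurable_upper_half : measurable upper_half.
Proof.
have := @measurable_snd _ _ T T measurableT _ (@measurable_pos R).
by rewrite setTI.
Qed.

Definition pos_inv (n : nat) (y : T) : \bar R :=
  if (0 < y)%R then ((y : R) ^- n)%:E else 0.

Lemma pos_inv_ge0 n y : 0 <= pos_inv n y.
Proof. by rewrite /pos_inv; case: ifPn => // y0; rewrite lee_fin invr_ge0 exprn_ge0 // ltW. Qed.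

Lemma measurable_pos_inv n : measurable_fun setT (pos_inv n).
Proof.
rewrite /pos_inv; apply: measurable_fun_if => //; first exact: measurable_fun_ltr.
apply/measurable_EFinP.
apply: (eq_measurable_fun (fun y : T => (y^-1 : R)%R ^+ n)%R).
  by move=> y _; rewrite exprVn.
apply: measurable_funX; apply: measurable_fun_inv_pos; rewrite setTI //.
exact: measurable_pos.
Qed.

Lemma plane_areaE (C : set (T * T)) : measurable C -> C `<=` upper_half ->
  plane_area C = \int[mu]_y (pos_inv 2 y * mu (ysection C y)).
Proof.
move=> mC C0; rewrite weighted_tonelli //; [|exact: measurable_pos_inv|exact: pos_inv_ge0].
pose f (p : T * T) := (\1_C p)%:E * pos_inv 2 p.2.
have f0 p : 0 <= f p by rewrite mule_ge0 ?pos_inv_ge0 // lee_fin.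
have mf : measurable_fun setT f.
  apply: emeasurable_funM; first by apply/measurable_EFinP; exact: measurable_indic.
  by apply: measurableT_comp => //; exact: measurable_pos_inv.
transitivity (\int[mu \x mu]_p f p).
  rewrite /plane_area integral_mkcond; apply: eq_integral => p _.
  rewrite patchE /f indicE /pos_inv.
  by case: ifPn => [/set_mem/C0 p0|_]; rewrite ?mul0e // mul1e ifT.
rewrite fubini_tonelli1 //; apply: eq_integral => x _.
rewrite [RHS]integral_mkcond; apply: eq_integral => y _.
rewrite /f /= patchE indicE mem_xsection.
by case: ifPn => _; rewrite ?mul1e ?mul0e.
Qed.

(** The coordinates c = x / y and s = ln y. They turn the area dx dy / y^2 into dc ds; scalings
    become translations in s, and the inversion becomes a reflection in s on each line of constant
    c, composed with c -> - c. *)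
Definition log_polar (p : T * T) : T * T := ((p.1 * expR p.2)%R, expR p.2).

Lemma measurable_log_polar : measurable_fun setT log_polar.
Proof.
apply: measurable_fun_pair; last by apply: measurableT_comp => //; exact: measurable_expR.
apply: measurable_funM => //.
by apply: measurableT_comp => //; exact: measurable_expR.
Qed.

(** dx dy / y^2 = dc dy / y = dc ds: the substitution x = y c is made in each horizontal section,
    then y = exp s along each ray from the origin. *)
Lemma plane_area_log_polar (C : set (T * T)) : measurable C -> C `<=` upper_half ->
  plane_area C = (mu \x mu) (log_polar @^-1` C).
Proof.
move=> mC C0; rewrite plane_areaE //.
pose f (p : T * T) : T * T := ((p.2 * p.1)%R, p.2).
have mf : measurable_fun setT f.
  by apply: measurable_fun_pair => //; apply: measurable_funM.
have mfC : measurable (f @^-1` C) by rewrite -[X in measurable X]setTI; exact: mf.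
transitivity (\int[mu]_y (pos_inv 1 y * mu (ysection (f @^-1` C) y))).
  apply: eq_integral => y _; rewrite /pos_inv; case: ifPn => [y0|]; last by rewrite !mul0e.
  rewrite (_ : ysection (f @^-1` C) y = [set x | ysection C y (y * x)%R]); last first.
    by apply/seteqP; split=> x /=; rewrite /ysection /= !inE.
  rewrite lebesgue_measure_scale //; last exact: measurable_ysection.
  by rewrite muleA -EFinM expr1 expr2 invfM.
rewrite weighted_tonelli //; [|exact: measurable_pos_inv|exact: pos_inv_ge0].
apply: eq_integral => c _.
have C1 : xsection (f @^-1` C) c `<=` [set y | (0 < y)%R].
  by move=> y; rewrite /xsection /= inE => /C0.
transitivity (mu [set s | xsection (f @^-1` C) c (expR s)]); last first.
  by congr (mu _); apply/seteqP; split=> x /=; rewrite /xsection /= !inE /f /log_polar /= mulrC.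
rewrite -integral_inv_pos //; last exact: measurable_xsection.
by apply: eq_integral => y /set_mem/C1 y0; rewrite /pos_inv ifT // expr1.
Qed.

(** The preimage is cut down to [upper_half] because the real formulas for a Moebius map are
    meaningful only there; in this form the property is stable under composition. *)
Definition area_preserving (f : T * T -> T * T) :=
  (forall p, upper_half p -> upper_half (f p)) /\
  forall C, measurable C -> C `<=` upper_half ->
    measurable (upper_half `&` f @^-1` C) /\
    plane_area (upper_half `&` f @^-1` C) = plane_area C.

Lemma area_preserving_comp f g : area_preserving f -> area_preserving g ->
  area_preserving (f \o g).
Proof.
move=> [fH fA] [gH gA]; split=> [p /gH/fH//|C mC CH].
have [mfC fCA] := fA _ mC CH.
have fCH : upper_half `&` f @^-1` C `<=` upper_half by move=> p [].
have [mgC gCA] := gA _ mfC fCH.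
suff -> : upper_half `&` (f \o g) @^-1` C =
    upper_half `&` g @^-1` (upper_half `&` f @^-1` C) by rewrite gCA fCA.
by apply/seteqP; split=> p /= [pH fgp]; split=> //; [split=> //; exact: gH | case: fgp].
Qed.

Lemma area_preserving_eq f g : (forall p, upper_half p -> f p = g p) ->
  area_preserving f -> area_preserving g.
Proof.
move=> fg [fH fA]; split=> [p pH|C mC CH]; first by rewrite -fg //; exact: fH.
suff -> : upper_half `&` g @^-1` C = upper_half `&` f @^-1` C by exact: fA.
by apply/seteqP; split=> p /= [pH]; rewrite fg.
Qed.

Lemma area_preserving_translate (a : R) : area_preserving (fun p => (p.1 + a, p.2)%R).
Proof.
split=> // C mC CH; set f := fun p => _.
have -> : upper_half `&` f @^-1` C = f @^-1` C.
  by apply/seteqP; split=> p => [[]//|fC]; split=> //; exact: (CH _ fC).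
have mf : measurable_fun setT f.
  by apply: measurable_fun_pair => //; apply: measurable_funD.
have mfC : measurable (f @^-1` C) by rewrite -[X in measurable X]setTI; exact: mf.
split=> //; rewrite !plane_areaE //; last by move=> p; exact: (CH (f p)).
apply: eq_integral => y _; congr (_ * _).
rewrite -[RHS](lebesgue_measure_translate a); last exact: measurable_ysection.
by congr (mu _); apply/seteqP; split=> x /=; rewrite /ysection /= !inE.
Qed.

Lemma area_preserving_scale (k : R) : (0 < k)%R ->
  area_preserving (fun p => (k * p.1, k * p.2)%R).
Proof.
move=> k0; set f := fun p => _.
have kgt y : ((0 < k * y) = (0 < y))%R by rewrite pmulr_rgt0.
split=> [p|C mC CH]; first by rewrite /upper_half /= kgt.
have -> : upper_half `&` f @^-1` C = f @^-1` C.
  by apply/seteqP; split=> p => [[]//|fC]; split=> //; rewrite /upper_half /= -kgt; exact: (CH _ fC).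
have mf : measurable_fun setT f.
  by apply: measurable_fun_pair => //; apply: measurable_funM.
have mfC : measurable (f @^-1` C) by rewrite -[X in measurable X]setTI; exact: mf.
split=> //; rewrite !plane_area_log_polar //; last by move=> p fC; rewrite /upper_half /= -kgt; exact: (CH _ fC).
have mL : measurable (log_polar @^-1` C).
  by rewrite -[X in measurable X]setTI; exact: measurable_log_polar.
apply: eq_integral => c _.
rewrite -[RHS](lebesgue_measure_translate (ln k)); last exact: measurable_xsection.
have kE s : expR (s + ln k) = (k * expR s)%R by rewrite expRD lnK // mulrC.
by congr (mu _); apply/seteqP; split=> s /=;
  rewrite /xsection /= !inE /log_polar /f /= kE mulrCA.
Qed.

Lemma integral_reflect (h : T -> \bar R) : measurable_fun setT h ->
  (forall x, 0 <= h x) -> \int[mu]_x h (- x)%R = \int[mu]_x h x.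
Proof.
move=> mh h0.
have mN : measurable_fun setT (fun x : T => (- x)%R : T) by exact: measurable_funN.
rewrite -[LHS](@ge0_integral_pushforward _ _ _ _ _ _ mN mu setT h) //.
by apply: eq_measure_integral => //= A mA _; exact: lebesgue_measureN.
Qed.

(** This is z -> -1/z. In logarithmic coordinates it reads (c, s) -> (- c, - ln (1 + c^2) - s),
    which preserves Lebesgue measure. *)
Lemma area_preserving_inversion :
  area_preserving (fun p => (- p.1 / (p.1 ^+ 2 + p.2 ^+ 2), p.2 / (p.1 ^+ 2 + p.2 ^+ 2))%R).
Proof.
set f := fun p => _.
have n0 (x y : R) : (0 < y -> 0 < x ^+ 2 + y ^+ 2)%R.
  by move=> y0; rewrite ltr_wpDl ?sqr_ge0 // exprn_gt0.
split=> [p p0|C mC CH]; first by rewrite /upper_half /= divr_gt0 // n0.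
(* [g] is the same map with division by [d] written through [expR] and [ln], which makes it visibly
   measurable. *)
pose d (p : T * T) : T := (p.1 ^+ 2 + p.2 ^+ 2)%R.
pose g (p : T * T) : T * T := (- p.1 * expR (- ln (d p)), p.2 * expR (- ln (d p)))%R.
have fg p : upper_half p -> f p = g p.
  by move=> p0; rewrite /f /g expRN lnK //; exact: n0.
have mg : measurable_fun setT g.
  have md : measurable_fun setT (fun p : T * T => expR (- ln (d p)) : T).
    apply: measurableT_comp; first exact: measurable_expR.
    apply: measurable_funN; apply: measurableT_comp; first exact: measurable_ln.
    by apply: measurable_funD; apply: measurable_funX.
  apply: measurable_fun_pair; apply: measurable_funM => //.
  exact: measurable_funN.
have mf : measurable (upper_half `&` f @^-1` C).
  rewrite (_ : _ `&` _ = upper_half `&` g @^-1` C).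
    apply: measurableI; first exact: measurable_upper_half.
    by rewrite -[X in measurable X]setTI; exact: mg.
  by apply/seteqP; split=> p /= [p0]; rewrite fg.
have E p : f (log_polar p) = log_polar (- p.1, - ln (1 + p.1 ^+ 2) - p.2)%R.
  rewrite /f /log_polar /= expRD !expRN lnK; last first.
    by rewrite posrE ltr_pwDl ?sqr_ge0.
  have e0 := expR_gt0 p.2; have c0 : (0 < 1 + p.1 ^+ 2)%R by rewrite ltr_pwDl ?sqr_ge0.
  have e1 : expR p.2 != 0%R by rewrite gt_eqF.
  have c1 : (1 + p.1 ^+ 2)%R != 0%R by rewrite gt_eqF.
  have d1 : ((p.1 * expR p.2) ^+ 2 + expR p.2 ^+ 2)%R != 0%R by rewrite gt_eqF // n0.
  by congr pair; field; rewrite e1 c1 d1.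
split=> //; rewrite (plane_area_log_polar mf); last by move=> p [].
rewrite (plane_area_log_polar mC CH).
have mL : measurable (log_polar @^-1` C).
  by rewrite -[X in measurable X]setTI; exact: measurable_log_polar.
rewrite -[RHS]/(\int[mu]_x (mu \o xsection (log_polar @^-1` C)) x) -integral_reflect //; last first.
  exact: measurable_fun_xsection.
apply: eq_integral => c _ /=.
rewrite -[RHS](lebesgue_measure_reflect (- ln (1 + c ^+ 2))%R); last exact: measurable_xsection.
congr (mu _); apply/seteqP; split=> s /=; rewrite /xsection /= !inE /= E //.
  by case.
by split=> //; rewrite /upper_half /= expR_gt0.
Qed.

End PlaneArea.

(** * Moebius transformations in real coordinates *)

Section PlaneMobius.
Variable R : realType.
Local Open Scope classical_set_scope.
Local Open Scope complex_scope.
Local Notation T := (measurableTypeR R).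
Implicit Types (A B : 'M[R]_2) (p : T * T).

(** |c z + d|^2 at z = x + i y. The next definition is (a z + b) / (c z + d) split into real and
    imaginary parts. *)
Definition mobius_den A p : R :=
  (A 1 0 * (p.1 : R) + A 1 1) ^+ 2 + (A 1 0 * (p.2 : R)) ^+ 2.

Definition plane_mobius A p : T * T :=
  (((A 0 0 * (p.1 : R) + A 0 1) * (A 1 0 * (p.1 : R) + A 1 1)
      + A 0 0 * A 1 0 * (p.2 : R) ^+ 2) / mobius_den A p,
   \det A * (p.2 : R) / mobius_den A p).

Lemma det2 A : \det A = A 0 0 * A 1 1 - A 0 1 * A 1 0.
Proof.
rewrite (expand_det_row _ 0) !big_ord_recl big_ord0 addr0 /cofactor !det_mx11 !mxE /=.
rewrite expr0 expr1 mul1r mulN1r mulrN; congr (_ * A _ _ - A _ _ * A _ _); exact/val_inj.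
Qed.

Lemma mobius_den_gt0 A p : \det A = 1 -> 0 < p.2 -> 0 < mobius_den A p.
Proof.
move=> dA p0; have [r0|r0] := eqVneq (A 1 0) 0; last first.
  by rewrite ltr_wpDl ?sqr_ge0 // exprn_even_gt0 //= mulf_neq0 // gt_eqF.
move: dA; rewrite det2 r0 mulr0 subr0 => dA.
rewrite /mobius_den r0 !mul0r add0r expr0n addr0 exprn_even_gt0 //=.
by apply: contra_eq_neq dA => ->; rewrite mulr0 eq_sym oner_eq0.
Qed.

Lemma mobiusE A p : \det A = 1 -> 0 < p.2 ->
  mobius A ((p.1 : R) +i* (p.2 : R)) =
  ((plane_mobius A p).1 : R) +i* ((plane_mobius A p).2 : R).
Proof.
move=> dA p0; have := mobius_den_gt0 dA p0; rewrite /plane_mobius det2 => d0.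
have dn0 : mobius_den A p != 0 by rewrite gt_eqF.
rewrite /mobius; set w := (X in _ / X).
have wE : w = (A 1 0 * (p.1 : R) + A 1 1) +i* (A 1 0 * (p.2 : R)).
  by rewrite /w; simpc.
have w0 : w != 0.
  apply: contra dn0; rewrite wE eq_complex /= => /andP[/eqP a0 /eqP b0].
  by rewrite /mobius_den a0 b0 expr0n addr0.
apply: (mulIf w0); rewrite divfK // wE; simpc.
rewrite /mobius_den in dn0 *.
by apply/eqP; rewrite eq_complex /=; apply/andP; split; apply/eqP; field.
Qed.

Lemma plane_mobius_upper A p : \det A = 1 -> upper_half p -> upper_half (plane_mobius A p).
Proof.
move=> dA p0; rewrite /upper_half /plane_mobius /= dA mul1r divr_gt0 //.
exact: mobius_den_gt0.
Qed.

Definition mx2 (a b c d : R) : 'M[R]_2 :=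
  \matrix_(i, j) if i == 0 then (if j == 0 then a else b) else (if j == 0 then c else d).

Lemma ord2_cases (i : 'I_2) : i = 0 \/ i = 1.
Proof. by case: i => [[|[|i]] Hi] //; [left|right]; exact/val_inj. Qed.

Lemma mx2E A : A = mx2 (A 0 0) (A 0 1) (A 1 0) (A 1 1).
Proof.
apply/matrixP => i j; rewrite mxE.
by case: (ord2_cases i) => ->; case: (ord2_cases j) => ->.
Qed.

(** Bruhat decomposition. If c = 0 the map is z -> a^2 z + a b; otherwise it is z -> a / c - 1 /
    (c^2 (z + d / c)), a product of translations, a scaling and the inversion. *)
Lemma area_preserving_mobius A : \det A = 1 -> area_preserving (plane_mobius A).
Proof.
move=> dA; have := dA; rewrite det2.
set a := A 0 0; set b := A 0 1; set c := A 1 0; set d := A 1 1 => D.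
have [c0|c0] := eqVneq c 0.
  have a0 : a != 0 by apply: contra_eq_neq D => ->; rewrite mul0r c0 mulr0 subr0 eq_sym oner_eq0.
  have k0 : 0 < a ^+ 2 by rewrite exprn_even_gt0.
  apply: area_preserving_eq (area_preserving_comp (area_preserving_translate (a * b)) (area_preserving_scale k0)).
  move=> p p0; rewrite /plane_mobius /mobius_den /= -/a -/b -/c -/d c0 det2 -/a -/b -/c -/d c0.
  have -> : d = a^-1.
    by apply: (mulfI a0); rewrite divff // -D c0 mulr0 subr0.
  by congr pair; field.
have k0 : 0 < c ^+ 2 by rewrite exprn_even_gt0.
apply: area_preserving_eq (area_preserving_comp (area_preserving_translate (a / c))
  (area_preserving_comp (area_preserving_inversion R)
  (area_preserving_comp (area_preserving_scale k0) (area_preserving_translate (d / c))))).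
move=> p p0; have d0 := mobius_den_gt0 dA p0; have dn0 : mobius_den A p != 0 by rewrite gt_eqF.
rewrite /plane_mobius dA /=; rewrite /mobius_den -/c -/d in dn0 *.
rewrite -/a -/b.
have -> : b = (a * d - 1) / c.
  by apply: (mulIf c0); rewrite divfK // -D; ring.
have E : (c ^+ 2 * (p.1 + d / c)) ^+ 2 + (c ^+ 2 * p.2) ^+ 2 =
   c ^+ 2 * ((c * (p.1 : R) + d) ^+ 2 + (c * (p.2 : R)) ^+ 2) by field.
by rewrite /= E; congr pair; field; rewrite c0 dn0.
Qed.
End PlaneMobius.

(** * Countability of discrete sets of matrices *)

Section IsolatedCountable.
Variable R : realType.
Local Open Scope classical_set_scope.

Lemma isolated_mx_ball m n (S : set 'M[R]_(m, n)) (A : 'M[R]_(m, n)) : isolated S A ->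
  exists2 e : R, 0 < e & forall B, S B -> (forall i j, `|A i j - B i j| < e) -> B = A.
Proof.
move=> [_ [V /nbhs_ballP[e /= e0 eV] VS]]; exists e => // B SB AB.
suff : (V `&` S) B by rewrite VS.
by split=> //; apply: eV; split.
Qed.

(** A point [A] is encoded by some k for which the radius 1 / (k + 1) isolates it, together with the
    integer parts of the entries of (k + 1) A. Two points with the same code are closer than that
    radius, hence equal. *)
Lemma isolated_mx_countable m n (S : set 'M[R]_(m, n)) : isolated S = S -> countable S.
Proof.
move=> iS.
pose P (A : 'M[R]_(m, n)) (c : nat * 'M[int]_(m, n)) := S A ->
  (forall B, S B -> (forall i j, `|A i j - B i j| < c.1.+1%:R^-1) -> B = A) /\
  c.2 = \matrix_(i, j) Num.floor (A i j * c.1.+1%:R).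
have /choice[f fP] A : exists c, P A c.
  have [SA|nSA] := pselect (S A); last by exists (0%N, 0) => /nSA.
  have [e e0 eP] : exists2 e : R, 0 < e &
      forall B, S B -> (forall i j, `|A i j - B i j| < e) -> B = A.
    by apply: isolated_mx_ball; rewrite iS.
  have [k ke] : exists k : nat, k.+1%:R^-1 < e.
    have [k _ /(_ _ (leqnn k)) /= kP] := near_infty_natSinv_lt (PosNum e0).
    by exists k.
  exists (k, \matrix_(i, j) Num.floor (A i j * k.+1%:R)) => _; split=> //= B SB AB.
  by apply: eP => // i j; exact: lt_trans ke.
apply/countable_injP; exists (pickle \o f) => A B /set_mem SA /set_mem SB /= fAB.
have {}fAB : f A = f B by apply: (pcan_inj pickleK).
have [eA cA] := fP A SA; have [_ cB] := fP B SB; apply/esym/eA => // i j.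
move: cA; rewrite fAB cB => /matrixP/(_ i j); rewrite !mxE; set k := (f B).1 => E.
have k0 : 0 < k.+1%:R :> R by rewrite ltr0n.
rewrite -(ltr_pM2r k0) mulVf ?gt_eqF // -[X in _ * X]ger0_norm ?ltW // -normrM mulrBl.
have /andP[a1 a2] := Num.Theory.floor_itv (A i j * k.+1%:R).
have /andP[b1 b2] := Num.Theory.floor_itv (B i j * k.+1%:R).
rewrite E rmorphD /= in b1 b2; rewrite rmorphD /= in a2.
by rewrite ltr_norml; apply/andP; split; lra.
Qed.

End IsolatedCountable.

Section MobiusAction.
Variable R : realType.
Local Open Scope complex_scope.
Local Notation T := (measurableTypeR R).
Implicit Types (A B : 'M[R]_2) (p : T * T).

Lemma mulmx2E A B i j : (A *m B) i j = A i 0 * B 0 j + A i 1 * B 1 j.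
Proof.
rewrite mxE !big_ord_recl big_ord0 addr0.
by congr (A _ _ * B _ _ + A _ _ * B _ _); exact/val_inj.
Qed.

Lemma plane_mobiusM A B p : \det A = 1 -> \det B = 1 -> 0 < p.2 ->
  plane_mobius (A *m B) p = plane_mobius A (plane_mobius B p).
Proof.
move=> dA dB p0; have dAB : \det (A *m B) = 1 by rewrite det_mulmx dA dB mulr1.
have q0 : upper_half (plane_mobius B p) by apply: plane_mobius_upper.
have := mobiusE dA q0; rewrite -(mobiusE dB p0).
have := mobiusE dAB p0.
have := mobius_den_gt0 dB p0; have := mobius_den_gt0 dAB p0.
set q := plane_mobius _ p; set q' := plane_mobius A _; set x : R := p.1; set y : R := p.2.
rewrite /mobius_den /= => abn bn E1 E2.
suff E : mobius (A *m B) (x +i* y) = mobius A (mobius B (x +i* y)).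
  have inj (u v : T * T) : (u.1 : R) +i* (u.2 : R) = (v.1 : R) +i* (v.2 : R) -> u = v.
    by case: u v => [? ?] [? ?] /= [-> ->].
  by apply: inj; rewrite -E1 -E2.
have wn0 (c d : R) : 0 < (c * x + d) ^+ 2 + (c * y) ^+ 2 ->
    c%:C * (x +i* y) + d%:C != 0.
  move=> cd; apply: contraTneq cd; simpc => /eqP; rewrite eq_complex /= => /andP[/eqP-> /eqP->].
  by rewrite expr0n addr0 ltxx.
have {}abn := wn0 _ _ abn; have {}bn := wn0 _ _ bn.
rewrite /mobius !mulmx2E in abn *; rewrite !rmorphD !rmorphM /= in abn *.
set z := x +i* y in abn bn *.
set a := (A 0 0)%:C; set b := (A 0 1)%:C; set c := (A 1 0)%:C; set d := (A 1 1)%:C.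
rewrite -/c -/d in abn.
set a' := (B 0 0)%:C in abn *; set b' := (B 0 1)%:C in abn *.
set c' := (B 1 0)%:C in abn bn *; set d' := (B 1 1)%:C in abn bn *.
field; rewrite bn /=; apply: contra abn => /eqP E; apply/eqP; rewrite -[RHS]E; ring.
Qed.

Lemma plane_mobius1 p : plane_mobius 1%:M p = p.
Proof.
rewrite /plane_mobius /mobius_den !det1 !mxE /= !(mul0r, mulr0, add0r, addr0, mul1r).
by rewrite expr0n addr0 expr1n !divr1 mulr1; case: p.
Qed.

Lemma plane_mobiusN A p : plane_mobius (- A) p = plane_mobius A p.
Proof.
rewrite /plane_mobius /mobius_den !det2 !mxE !mulrNN !mulNr -!opprD !sqrrN.
by rewrite !mulrNN.
Qed.

End MobiusAction.

(** * Sets of infinite area meet their translates *)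

Section AreaOverlap.
Variable R : realType.
Local Open Scope classical_set_scope.
Local Open Scope complex_scope.
Local Notation T := (measurableTypeR R).
Local Notation mu := (@lebesgue_measure R).

(* Otherwise the translates of U embed U into a fundamental domain. *)
Lemma infinite_area_overlap (G : set 'M[R]_2) (U : set (T * T)) :
    surface_group G -> measurable U -> U `<=` @upper_half R ->
    plane_area U = +oo%E ->
  exists g, [/\ G g, g <> 1%:M, g <> - 1%:M & exists2 p, U p & U (plane_mobius g p)].
Proof.
move=> HG mU UH areaU; apply: contrapT => noG.
have Gdet := surface_group_det HG; have GN := surface_groupN HG.
have GM := surface_groupM HG; have GV := surface_groupV HG.
have {}noG g p : G g -> U p -> U (plane_mobius g p) -> g = 1%:M \/ g = - 1%:M.
  move=> Gg Up Ugp; apply: contrapT => /not_orP[g1 gN1].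
  by apply: noG; exists g; split=> //; exists p.
have [D [[DH Dfund] mD areaD]] := surface_group_area HG.
set C := half_plane_chart D in mD.
have CH : C `<=` @upper_half R by move=> p /DH.
have /countable_injP[f finj] : countable G.
  by apply: isolated_mx_countable; exact: surface_group_discrete.
(* [f] numbers the elements of [G]. As g and - g act alike, only the one with the smaller number is
   retained. *)
pose Q n g := [/\ G g, f g = n & (f g <= f (- g))%N].
have Q_uniq n g h : Q n g -> Q n h -> g = h.
  by move=> [Gg <- _] [Gh /finj-> //]; rewrite inE.
pose sel n : 'M[R]_2 := if pselect (exists g, Q n g) is left H then sval (cid H) else 1%:M.
have selP n g : Q n g -> sel n = g.
  rewrite /sel; case: pselect => [H Qg|nH Qg]; last by case: nH; exists g.
  by apply: Q_uniq Qg; exact: svalP (cid H).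
(* The part of the fundamental domain that the n-th retained element sends into [U]. A common point
   of two such parts would give an element mapping a point of [U] into [U], so the parts are
   disjoint. Their images [B n] cover [U] and have the same areas, which bounds the area of [U] by
   that of the domain. *)
pose A n := [set p | [/\ C p, exists g, Q n g & U (plane_mobius (sel n) p)]].
have mA n : measurable (A n).
  have [[g Qg]|nQ] := pselect (exists g, Q n g); last first.
    by rewrite (_ : A n = set0) // -subset0 => p [].
  rewrite (_ : A n = C `&` (@upper_half R `&` plane_mobius g @^-1` U)).
    apply: measurableI => //.
    by have [_ /(_ U mU UH)[]] := area_preserving_mobius (Gdet _ (let: And3 Gg _ _ := Qg in Gg)).
  rewrite -(selP _ _ Qg); apply/seteqP; split=> p; first by move=> [Cp _ Up]; split=> //; split=> //; exact: CH.
  by move=> [Cp [_ Up]]; split=> //; exists g.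
have trivA : trivIset setT A.
  move=> n k _ _ [p [[Cp [g Qg] Ug] [_ [h Qh] Uh]]].
  rewrite (selP _ _ Qg) in Ug; rewrite (selP _ _ Qh) in Uh.
  have [Gg fg gN] := Qg; have [Gh fh hN] := Qh.
  have gU : g \in unitmx by rewrite unitmxE Gdet // unitr1.
  have dV : \det (invmx g) = 1 by rewrite det_inv Gdet // invr1.
  have Vg : plane_mobius (invmx g) (plane_mobius g p) = p.
    by rewrite -plane_mobiusM ?mulVmx ?plane_mobius1 ?dV ?(Gdet _ Gg) //; exact: CH.
  have Ggh : G (h *m invmx g) by apply: GM => //; exact: GV.
  have := noG (h *m invmx g) (plane_mobius g p) Ggh Ug.
  rewrite plane_mobiusM ?dV ?(Gdet _ Gh) // ?Vg; last by apply: UH.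
  have hE : h = (h *m invmx g) *m g by rewrite mulmxKV.
  case=> // E; rewrite -fg -fh hE E ?mul1mx // mulNmx mul1mx.
  move: hN gN; rewrite hE E mulNmx mul1mx opprK => h1 h2.
  by apply/eqP; rewrite eqn_leq h1 h2.
pose nu := (mu \x mu)%E; pose L (X : set (T * T)) := @log_polar R @^-1` X.
have mL X : measurable X -> measurable (L X).
  by move=> mX; rewrite -[Y in measurable Y]setTI; exact: measurable_log_polar.
have AH n : A n `<=` @upper_half R by move=> p [/CH].
pose B n := @upper_half R `&` plane_mobius (invmx (sel n)) @^-1` A n.
have detsel n : \det (invmx (sel n)) = 1.
  rewrite det_inv /sel; case: pselect => [H|_]; last by rewrite det1 invr1.
  by have [/Gdet-> _ _] := svalP (cid H); rewrite invr1.
have BP n : measurable (B n) /\ plane_area (B n) = plane_area (A n).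
  by have [_] := area_preserving_mobius (detsel n); exact.
have BH n : B n `<=` @upper_half R by move=> p [].
have UB : U `<=` \bigcup_n B n.
  move=> u Uu; have u0 := UH _ Uu.
  have [z [[Dz [g Gg zE]] _]] := Dfund ((u.1 : R) +i* (u.2 : R)) u0.
  have gU : g \in unitmx by rewrite unitmxE Gdet // unitr1.
  rewrite mobiusE ?Gdet // in zE; set p := plane_mobius g u in zE.
  have Cp : C p by rewrite /C /half_plane_chart /= -zE.
  have up : plane_mobius (invmx g) p = u.
    by rewrite -plane_mobiusM ?mulVmx ?plane_mobius1 ?det_inv ?(Gdet _ Gg) ?invr1.
  pose h := if (f (invmx g) <= f (- invmx g))%N then invmx g else - invmx g.
  have hN : h = invmx g \/ h = - invmx g by rewrite /h; case: ifP; [left|right].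
  have Qh : Q (f h) h.
    rewrite /h; case: ifP => fg; split=> //; rewrite ?opprK; try exact: GV.
      by apply: GN; exact: GV.
    by apply: ltnW; rewrite ltnNge fg.
  have hp : plane_mobius h p = u by case: hN => ->; rewrite ?plane_mobiusN.
  exists (f h) => //; split=> //=; rewrite (selP _ _ Qh).
  have -> : plane_mobius (invmx h) u = p.
    have dh : \det h = 1 by have [/Gdet] := Qh.
    have hU : h \in unitmx by rewrite unitmxE dh unitr1.
    by rewrite -hp -plane_mobiusM ?mulVmx ?plane_mobius1 ?det_inv ?dh ?invr1 //; exact: CH.
  by split=> //; [exists h | rewrite (selP _ _ Qh) hp].
have : (nu (L U) <= \sum_(n <oo) nu (L (B n)))%E.
  apply: measure_sigma_subadditive; last 1 first.
  - by move=> p /UB[n _ Bn]; exists n.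
  - by move=> n; apply: mL; have [] := BP n.
  - exact: mL.
rewrite -[X in (X <= _)%E]plane_area_log_polar // areaU.
rewrite (eq_eseriesr (g := fun n => nu (L (A n)))); last first.
  move=> n _; have [mB aB] := BP n.
  by rewrite -[LHS]plane_area_log_polar // aB plane_area_log_polar.
have trivL : trivIset setT (L \o A).
  by move=> n k _ _ [p [/= Anp Akp]]; apply: trivA => //; exists (log_polar p).
rewrite -(@measure_semi_bigcup _ _ _ nu (L \o A)) //; last 2 first.
- by move=> n; exact: mL.
- by apply: bigcup_measurable => n _; exact: mL.
apply/negP; rewrite -ltNge; apply: le_lt_trans areaD.
rewrite [leRHS](plane_area_log_polar mD CH); apply: le_measure.
- by rewrite inE; apply: bigcup_measurable => n _; exact: mL.
- by rewrite inE; exact: mL.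
- by move=> p [n _ []].
Qed.
End AreaOverlap.

(** * Crossing axes *)

Section CrossingAlgebra.
Variable R : realType.
Local Open Scope classical_set_scope.
Implicit Types (A B P : 'M[R]_2).

Lemma expr_gt_unbounded (c M : R) : 1 < c -> exists k : nat, M < c ^+ k.
Proof.
move=> c1; have c0 : 0 < c - 1 by rewrite subr_gt0.
have bern k : 1 + (c - 1) * k%:R <= c ^+ k.
  elim: k => [|k IH]; first by rewrite mulr0 addr0 expr0.
  have ck : 1 <= c ^+ k by apply: exprn_ege1; exact: ltW.
  by rewrite exprS -natr1; nra.
pose k := Num.bound `|M / (c - 1)|; exists k; apply: lt_le_trans (bern k).
have : M / (c - 1) < k%:R.
  by apply: le_lt_trans (ler_norm _) _; apply: archi_boundP; exact: normr_ge0.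
by rewrite ltr_pdivrMr // mulrC => /lt_trans; apply; rewrite ltrDr ltr01.
Qed.

Lemma mx2_mul a b c d a' b' c' d' :
  mx2 a b c d *m mx2 a' b' c' d' =
  mx2 (a * a' + b * c') (a * b' + b * d') (c * a' + d * c') (c * b' + d * d') :> 'M[R]_2.
Proof.
apply/matrixP => i j; rewrite mulmx2E !mxE.
by case: (ord2_cases i) => ->; case: (ord2_cases j) => ->.
Qed.

Lemma det_mx2 a b c d : \det (mx2 a b c d : 'M[R]_2) = a * d - b * c.
Proof. by rewrite det2 !mxE. Qed.

Lemma invmx2 A : \det A = 1 -> invmx A = mx2 (A 1 1) (- A 0 1) (- A 1 0) (A 0 0).
Proof.
move=> dA; have uA : A \in unitmx by rewrite unitmxE dA unitr1.
apply: (can_inj (mulKmx uA)); rewrite mulmxV // [in RHS](mx2E A) mx2_mul.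
rewrite {}[RHS]mx2E !mxE /=; rewrite det2 in dA.
rewrite [LHS]mx2E !mxE /=; congr mx2; lra.
Qed.

Lemma trace_polynomial_bound (c A B C : R) : 1 < c ->
  (forall k, A * c ^+ k + B + C * c ^- k <= 1) -> A <= 0.
Proof.
move=> c1 H; rewrite leNgt; apply/negP => A0.
have [k] := expr_gt_unbounded ((1 + `|B| + `|C|) / A) c1.
rewrite ltr_pdivrMr // => kP; have := H k.
have ck0 : 0 < c ^- k by rewrite invr_gt0 exprn_gt0 // (lt_trans ltr01).
have ck1 : c ^- k <= 1 by rewrite invf_le1 ?exprn_gt0 ?(lt_trans ltr01) // exprn_ege1 // ltW.
have : - `|C| <= C * c ^- k.
  have := ler_norm (- C); rewrite normrN; have := normr_ge0 C; nra.
have := ler_norm (- B); rewrite normrN; lra.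
Qed.

(* If no element of G maps the axis {0, oo} of diag(l, 1/l) across itself, the
   orbits of 0 and oo stay on one side of the axis. *)
Lemma positive_entries (G : set 'M[R]_2) (l d : R) :
    (forall A, G A -> \det A = 1) -> (forall A B, G A -> G B -> G (A *m B)) ->
    (forall A, G A -> G (- A)) -> (forall A, G A -> G (invmx A)) ->
    G (mx2 l 0 0 l^-1) -> 1 < l ^+ 2 ->
    0 < d -> (forall A, G A -> (forall i j, `|A i j - (i == j)%:R| < d) -> A = 1%:M) ->
    (forall s : R, s = 1 \/ s = -1 -> ~ forall A, G A ->
       s * (A 0 0 * A 1 0) <= 0 /\ s * (A 0 1 * A 1 1) <= 0) ->
  exists2 A, G A & forall i j, 0 < A i j.
Proof.
move=> Gdet GM GN GV Gb l1 d0 discr side.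
have l0 : l != 0 by apply: contraTneq l1 => ->; rewrite expr0n ltNge ler01.
have l2 : l ^- 2 - 1 != 0.
  by rewrite subr_eq0 -(inj_eq invr_inj) invrK invr1 gt_eqF.
have Gdet2 A : G A -> A 0 0 * A 1 1 - A 0 1 * A 1 0 = 1.
  by move=> GA; rewrite -det2; exact: Gdet.
have Ginv A : G A -> G (mx2 (A 1 1) (- A 0 1) (- A 1 0) (A 0 0)).
  by move=> GA; rewrite -invmx2 ?Gdet //; exact: GV.
have Gbk k : G (mx2 (l ^+ k) 0 0 (l ^- k)).
  elim: k => [|k IH].
    have := GM _ _ Gb (GV _ Gb); rewrite mulmxV ?unitmxE ?Gdet ?unitr1 //.
    by rewrite (_ : 1%:M = mx2 1 0 0 1) ?expr0 ?invr1 // {1}[1%:M]mx2E !mxE.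
  by have := GM _ _ Gb IH; rewrite mx2_mul !(mul0r, mulr0, addr0, add0r) -exprS -invfM -exprS.
have Gbkn k : G (mx2 (l ^- k) 0 0 (l ^+ k)).
  by have := Ginv _ (Gbk k); rewrite !mxE /= oppr0.
have small (e : R) : exists k, `|e * l ^- (2 * k)| < d.
  have [k kP] := expr_gt_unbounded (`|e| / d) l1; exists k.
  have lk0 : 0 < l ^+ (2 * k) by rewrite exprM exprn_gt0 // (lt_trans ltr01).
  rewrite normrM normfV (ger0_norm (ltW lk0)) ltr_pdivrMr //.
  by rewrite mulrC -ltr_pdivrMr // exprM.
(* An element fixing the end 0 also fixes oo. Otherwise the commutator of its inverse with diag(l,
   1/l) is unipotent and nontrivial, and conjugation by powers of diag(l, 1/l) brings it arbitrarily
   close to 1, against discreteness. *)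
have lower A : G A -> A 0 1 = 0 -> A 1 0 = 0.
  move=> GA q0; have D := Gdet2 _ GA; rewrite q0 mul0r subr0 in D.
  have [p0 s0] : A 0 0 != 0 /\ A 1 1 != 0.
    by apply/andP; rewrite -negb_or -mulf_eq0 D oner_eq0.
  apply/eqP; apply: contraT => r0.
  have sE : A 1 1 = (A 0 0)^-1 by apply: (mulfI p0); rewrite D divff.
  set p := A 0 0 in p0 sE *; set r := A 1 0 in r0 *.
  have {}GA : G (mx2 p 0 r p^-1) by rewrite -sE -q0 -mx2E.
  pose e := p * r * (l ^- 2 - 1).
  have [k kP] := small e.
  have lk0 : l ^+ k != 0 by rewrite expf_neq0.
  have Gu : G (mx2 1 0 (e * l ^- (2 * k)) 1).
    have := GM _ _ (GM _ _ (Gbk k) (GM _ _ (GM _ _ (Ginv _ GA) Gb) (GM _ _ GA (Ginv _ Gb)))) (Gbkn k).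
    rewrite !mxE /= !mx2_mul /e mulnC exprM; congr (G (mx2 _ _ _ _));
      by field; rewrite ?l0 ?lk0 ?p0.
  have E : mx2 1 0 (e * l ^- (2 * k)) 1 = 1%:M.
    apply: discr => // i j.
    by case: (ord2_cases i) => ->; case: (ord2_cases j) => ->;
      rewrite !mxE /= ?subrr ?normr0 ?subr0.
  have /eqP := congr1 (fun M : 'M[R]_2 => M 1 0) E; rewrite !mxE /=.
  by rewrite !mulf_eq0 invr_eq0 expf_eq0 (negPf p0) (negPf r0) (negPf l0) andbF (negPf l2) .
have upper A : G A -> A 1 0 = 0 -> A 0 1 = 0.
  move=> GA r0; have D := Gdet2 _ GA; rewrite r0 mulr0 subr0 in D.
  have [p0 s0] : A 0 0 != 0 /\ A 1 1 != 0.
    by apply/andP; rewrite -negb_or -mulf_eq0 D oner_eq0.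
  apply/eqP; apply: contraT => q0.
  have sE : A 1 1 = (A 0 0)^-1 by apply: (mulfI p0); rewrite D divff.
  set p := A 0 0 in p0 sE *; set q := A 0 1 in q0 *.
  have {}GA : G (mx2 p q 0 p^-1) by rewrite -sE -r0 -mx2E.
  pose e := p^-1 * q * (l ^- 2 - 1).
  have [k kP] := small e.
  have lk0 : l ^+ k != 0 by rewrite expf_neq0.
  have Gu : G (mx2 1 (e * l ^- (2 * k)) 0 1).
    have := GM _ _ (GM _ _ (Gbkn k) (GM _ _ (GM _ _ (Ginv _ GA) (Ginv _ Gb)) (GM _ _ GA Gb))) (Gbk k).
    rewrite !mxE /= !mx2_mul /e mulnC exprM; congr (G (mx2 _ _ _ _));
      by field; rewrite ?l0 ?lk0 ?p0.
  have E : mx2 1 (e * l ^- (2 * k)) 0 1 = 1%:M.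
    apply: discr => // i j.
    by case: (ord2_cases i) => ->; case: (ord2_cases j) => ->;
      rewrite !mxE /= ?subrr ?normr0 ?subr0.
  have /eqP := congr1 (fun M : 'M[R]_2 => M 0 1) E; rewrite !mxE /=.
  by rewrite !mulf_eq0 !invr_eq0 expf_eq0 (negPf p0) (negPf q0) (negPf l0) andbF (negPf l2).
(* Given such an [A], the determinant forces the diagonal entries to have equal signs, and the
   off-diagonal ones have equal signs by assumption; a change of sign or an inversion makes all four
   positive. *)
have [[A [GA AP]]|noA] := pselect (exists A, G A /\ 0 < A 0 1 * A 1 0).
  have [B [GB BP Bp]] : exists B, [/\ G B, 0 < B 0 1 * B 1 0 & 0 < B 0 0].
    have := Gdet2 _ GA; have [p0|p0|p0] := ltrgtP (A 0 0) 0 => D.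
    - by exists (- A); rewrite !mxE mulrNN oppr_gt0; split=> //; exact: GN.
    - by exists A.
    - by move: D AP; rewrite p0; lra.
  have Bs : 0 < B 1 1 by have := Gdet2 _ GB; nra.
  have [q0|q0|q0] := ltrgtP (B 0 1) 0; last by move: BP; rewrite q0 mul0r ltxx.
    exists (mx2 (B 1 1) (- B 0 1) (- B 1 0) (B 0 0)); first exact: Ginv.
    move=> i j; have r0 : B 1 0 < 0 by nra.
    by case: (ord2_cases i) => ->; case: (ord2_cases j) => ->; rewrite !mxE //= oppr_gt0.
  exists B => // i j; have r0 : 0 < B 1 0 by nra.
  by case: (ord2_cases i) => ->; case: (ord2_cases j) => ->.
have {}noA A : G A -> A 0 1 * A 1 0 <= 0.
  by move=> GA; rewrite leNgt; apply/negP => AP; apply: noA; exists A.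
(* The two factors have the signs of A(oo) and B(0). If no element of [G] has off-diagonal entries
   of positive product, then C = A diag(l^k, l^-k) B^-1 has diagonal product at most 1 for every k,
   so its leading coefficient in l^(2k) is nonpositive. *)
have F A B : G A -> G B -> 0 <= (A 0 0 * A 1 0) * (B 0 1 * B 1 1).
  move=> GA GB.
  suff : (A 0 0 * A 1 0) * (B 1 1 * - B 0 1) <= 0 by lra.
  apply: (@trace_polynomial_bound (l ^+ 2) _
    (A 0 0 * B 1 1 * A 1 1 * B 0 0 + A 0 1 * - B 1 0 * A 1 0 * - B 0 1)
    (A 0 1 * - B 1 0 * A 1 1 * B 0 0) l1) => k.
  have GC := GM _ _ (GM _ _ GA (Gbk k)) (Ginv _ GB).
  have := noA _ GC; have := Gdet2 _ GC; rewrite !mulmx2E !mxE /=.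
  rewrite !(mul0r, mulr0, addr0, add0r) -!exprM ![(2 * k)%N]mulnC !exprM.
  have : l ^+ k != 0 by rewrite expf_neq0.
  set x := l ^+ k => x0 D C.
  set t := (X in X <= 1).
  have -> : t = (A 0 0 * x * B 1 1 + A 0 1 * x^-1 * - B 1 0) * (A 1 0 * x * - B 0 1 + A 1 1 * x^-1 * B 0 0).
    by rewrite /t; field.
  by lra.
have neg1 : (-1 : R) = 1 \/ (-1 : R) = -1 by right.
have [A [GA AP]] : exists A, G A /\ (0 < A 0 0 * A 1 0 \/ 0 < A 0 1 * A 1 1).
  apply: contrapT => nA; apply: (side 1); first by left.
  move=> A GA; rewrite !mul1r; split; rewrite leNgt; apply/negP => h; apply: nA; exists A; split=> //.
    by left.
  by right.
have [B [GB BP]] : exists B, G B /\ (B 0 0 * B 1 0 < 0 \/ B 0 1 * B 1 1 < 0).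
  apply: contrapT => nB; apply: (side (-1)) => // B GB.
  rewrite !mulN1r !oppr_le0; split; rewrite leNgt; apply/negP => h; apply: nB; exists B; split=> //.
    by left.
  by right.
(* Orbit points of 0 and oo occur on both sides. If the two witnesses lie in different orbits, [F]
   is contradicted at once; if they lie in the same orbit, the other orbit is confined to 0 and oo,
   which [lower] or [upper] excludes. *)
case: AP BP => AP [] BP.
- have z C : G C -> C 0 1 * C 1 1 = 0 by move=> GC; have := F _ _ GA GC; have := F _ _ GB GC; nra.
  have := z _ (Ginv _ GA); rewrite !mxE /= => /eqP; rewrite mulNr oppr_eq0 mulf_eq0 => /orP[/eqP q0|/eqP p0].
    by move: AP; rewrite (lower _ GA q0) mulr0 ltxx.
  by move: AP; rewrite p0 mul0r ltxx.
- by have := F _ _ GA GB; nra.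
- by have := F _ _ GB GA; nra.
- have z C : G C -> C 0 0 * C 1 0 = 0 by move=> GC; have := F _ _ GC GA; have := F _ _ GC GB; nra.
  have := z _ (Ginv _ GA); rewrite !mxE /= => /eqP; rewrite mulrN oppr_eq0 mulf_eq0 => /orP[/eqP s0|/eqP r0].
    by move: AP; rewrite s0 mulr0 ltxx.
  by move: AP; rewrite (upper _ GA r0) mul0r ltxx.
Qed.

End CrossingAlgebra.

(** * Crossing elements from finite area *)

Section Crossing.
Variable R : realType.
Local Open Scope classical_set_scope.
Local Notation T := (measurableTypeR R).
Local Notation mu := (@lebesgue_measure R).

Definition strip (a b : R) : set (T * T) := `]a, b[%classic `*` `]0, 1]%classic.

Lemma measurable_strip a b : measurable (strip a b).
Proof. by apply: measurableX => //; exact: measurable_itv. Qed.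

Lemma strip_upper a b : strip a b `<=` @upper_half R.
Proof. by move=> p [_] /=; rewrite in_itv /= => /andP[]. Qed.

(** On ]0, 1] one has 1 / y^2 >= 1 / y, and the integral of 1 / y is the length of ]-oo, 0]. *)
Lemma plane_area_strip a b : a < b -> plane_area (strip a b) = +oo%E.
Proof.
move=> ab; rewrite plane_areaE; [|exact: measurable_strip|exact: strip_upper].
apply/eqP; rewrite -leye_eq.
have log_oo : (\int[mu]_(y in `]0%R, 1%R]) ((y : R)^-1)%:E = +oo)%E.
  rewrite integral_inv_pos //; last by move=> y /=; rewrite in_itv /= => /andP[].
  transitivity (mu `]-oo, 0%R]); last by rewrite lebesgue_measure_itv /= ltNyr.
  have e1 (s : R) : (expR s <= 1) = (s <= 0) by rewrite -[in LHS]expR0 ler_expR.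
  by congr (mu _); apply/seteqP; split=> s /=; rewrite !in_itv /= expR_gt0 /= e1.
have ba0 : (0 < (b - a)%:E :> \bar R)%E by rewrite lte_fin subr_gt0.
have minv : measurable_fun (`]0, 1]%classic : set T) (fun y : T => ((y : R)^-1)%:E).
  apply/measurable_EFinP; apply: measurable_fun_inv_pos; first exact: measurable_itv.
  by move=> y /=; rewrite in_itv /= => /andP[].
have minv2 : measurable_fun setT (fun y : T => (pos_inv 2 y * mu (ysection (strip a b) y))%E).
  apply: emeasurable_funM; first exact: measurable_pos_inv.
  by apply: measurable_fun_ysection; exact: measurable_strip.
have inv0 (y : T) : `]0, 1]%classic y -> (0 <= ((y : R)^-1)%:E)%E.
  by rewrite /= in_itv /= => /andP[y0 _]; rewrite lee_fin invr_ge0 ltW.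
have int0 (y : T) : (0 <= pos_inv 2 y * mu (ysection (strip a b) y))%E.
  by rewrite mule_ge0 // pos_inv_ge0.
rewrite -(gt0_muley ba0) -log_oo -ge0_integralZl //; last exact: ltW.
apply: (@le_trans _ _ (\int[mu]_(y in `]0%R, 1%R]) (pos_inv 2 y * mu (ysection (strip a b) y)))%E).
  apply: ge0_le_integral => //.
  - by move=> y /inv0 ?; rewrite mule_ge0 // ltW.
  - exact: emeasurable_funM.
  - exact: measurable_funTS.
  move=> y; rewrite /= in_itv /= => /andP[y0 y1].
  have -> : ysection (strip a b) y = `]a, b[%classic.
    apply/seteqP; split=> x; rewrite /ysection /= inE /strip /=; first by case.
    by move=> xab; split=> //; rewrite in_itv /= y0.
  rewrite lebesgue_measure_itv /= lte_fin ab -EFinB muleC /pos_inv y0.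
  apply: lee_wpmul2r; first by rewrite ltW.
  by rewrite lee_fin lef_pV2 ?posrE ?exprn_gt0 // expr2 ler_piMl // ltW.
by apply: ge0_subset_integral.
Qed.

(** Discreteness of [G] read in the chart [P]: the entries of P^-1 N P are bounded by [K] times a
    bound for those of N = A - 1. *)
Lemma near_identity_conj (G : set 'M[R]_2) (P : 'M[R]_2) : isolated G = G -> G 1%:M ->
    P \in unitmx ->
  exists2 d : R, 0 < d & forall A, G (invmx P *m A *m P) ->
    (forall i j, `|A i j - (i == j)%:R| < d) -> A = 1%:M.
Proof.
move=> iG G1 PU; have [e e0 eP] : exists2 e : R, 0 < e &
    forall B, G B -> (forall i j, `|1%:M i j - B i j| < e) -> B = 1%:M.
  by apply: isolated_mx_ball; rewrite iG.
set V := invmx P in eP *.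
pose S (i j : 'I_2) := \sum_k \sum_l `|V i k| * `|P l j|.
have S0 i j : 0 <= S i j by do 2 apply: sumr_ge0 => ? _; rewrite mulr_ge0.
pose K := 1 + \sum_i \sum_j S i j.
have sum0 : 0 <= \sum_i \sum_j S i j by do 2 apply: sumr_ge0 => ? _.
have K0 : 0 < K by rewrite ltr_pwDl.
exists (e / K); first exact: divr_gt0.
move=> A GA A1; pose N := A - 1%:M.
have N1 i j : `|N i j| <= e / K by rewrite !mxE ltW.
have VNP : 1%:M - V *m A *m P = - (V *m N *m P).
  by rewrite mulmxBr mulmxBl mulmx1 mulVmx // opprB.
have /eP E : forall i j, `|1%:M i j - (V *m A *m P) i j| < e.
  move=> i j; rewrite -[X in `|X|](_ : (1%:M - V *m A *m P) i j = _); last by rewrite !mxE.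
  rewrite VNP mxE normrN.
  have : `|(V *m N *m P) i j| <= (e / K) * S i j.
    rewrite mxE /S exchange_big mulr_sumr /=; apply: le_trans (ler_norm_sum _ _ _) _.
    apply: ler_sum => l _; rewrite mxE mulr_suml mulr_sumr.
    apply: le_trans (ler_norm_sum _ _ _) _; apply: ler_sum => k _.
    by rewrite !normrM mulrAC mulrC; apply: ler_wpM2r => //; rewrite mulr_ge0.
  move=> /le_lt_trans; apply; rewrite -[ltRHS](divfK (lt0r_neq0 K0)).
  rewrite ltr_pM2l ?divr_gt0 // /K.
  rewrite (bigD1 i) //= (bigD1 j) //=.
  rewrite -addrA ltr_pwDl // lerDl addr_ge0 //; first by apply: sumr_ge0.
  by do 2 apply: sumr_ge0 => ? _.
have {}E := E GA.
have := congr1 (fun M => P *m M *m V) E.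
by rewrite mulmx1 mulmxV // !mulmxA mulmxV // mul1mx -mulmxA mulmxV // mulmx1.
Qed.

(** The hypotheses say that the matrix (p q; r t) and its inverse send 0 and oo to the closed side
    of sign - s. The last quantity is p r |z|^2 + (p t + q r) x + q t up to the factor s, with first
    and last terms nonpositive; so p t + q r > 0, whence p t > 0. The signs of q t and q p then give
    p t q^2 <= 0, and likewise for r. *)
Lemma half_plane_return (s p q r t x y : R) :
    p * t - q * r = 1 -> s * (p * r) <= 0 -> s * (q * t) <= 0 ->
    s * (t * - r) <= 0 -> s * (- q * p) <= 0 -> 0 < s * x ->
    0 < s * ((p * x + q) * (r * x + t) + p * r * y ^+ 2) ->
  q = 0 /\ r = 0.
Proof.
move=> D pr qt tr qp sx sN.
have pos : 0 < p * t + q * r.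
  have E : s * ((p * x + q) * (r * x + t) + p * r * y ^+ 2) =
    s * (p * r) * (x ^+ 2 + y ^+ 2) + (p * t + q * r) * (s * x) + s * (q * t) by ring.
  rewrite -(pmulr_lgt0 _ sx).
  have : s * (p * r) * (x ^+ 2 + y ^+ 2) <= 0.
    by rewrite mulr_le0_ge0 // addr_ge0 // sqr_ge0.
  by lra.
have z (a b c : R) : s * a <= 0 -> 0 <= s * b -> a * b = p * t * c ^+ 2 -> c = 0.
  move=> sa sb E; apply/eqP; apply: contraT => c0.
  have c2 : 0 < c ^+ 2 by rewrite exprn_even_gt0.
  have : s * a * (s * b) <= 0 by rewrite mulr_le0_ge0.
  have -> : s * a * (s * b) = s ^+ 2 * (p * t * c ^+ 2) by rewrite -E; ring.
  have s2 : 0 < s ^+ 2.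
    by rewrite exprn_even_gt0 //=; apply: contraTneq sx => ->; rewrite mul0r ltxx.
  by rewrite pmulr_rle0 // pmulr_lle0 //; lra.
split; first by apply: (z (q * t) (q * p)) => //; [lra | ring].
by apply: (z (p * r) (t * r)) => //; [lra | ring].
Qed.

Lemma near_one_of_sqr (v d : R) : 0 < v -> 0 < d -> v ^+ 2 < 1 + d ->
  1 < v ^+ 2 * (1 + d) -> `|v - 1| < d.
Proof.
move=> v0 d0 v1 v2; rewrite ltr_norml; apply/andP; split.
  rewrite ltNge; apply/negP => h.
  have : v ^+ 2 <= 1 - d by nra.
  nra.
rewrite ltNge; apply/negP => h; nra.
Qed.

(* In a finite area surface group every axis is crossed: the four entries of
   P a P^-1 are positive, so P a P^-1 has fixed points of opposite signs, while
   those of P b P^-1 are 0 and oo. *)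
Lemma crossing_element (G : set 'M[R]_2) (b P : 'M[R]_2) (l : R) : surface_group G ->
    G b -> \det P = 1 -> P *m b *m invmx P = mx2 l 0 0 l^-1 -> 1 < l ^+ 2 ->
  exists2 a, G a & forall i j, 0 < (P *m a *m invmx P) i j.
Proof.
move=> HG Gb dP Pb l1; have PU : P \in unitmx by rewrite unitmxE dP unitr1.
have dV : \det (invmx P) = 1 by rewrite det_inv dP invr1.
have iG := surface_group_discrete HG; have G1 := surface_group1 HG.
have Gdet := surface_group_det HG; have GN := surface_groupN HG.
have GM := surface_groupM HG; have GV := surface_groupV HG.
have [d d0 dP1] := near_identity_conj iG G1 PU.
pose H : set 'M[R]_2 := [set A | G (invmx P *m A *m P)].
have VP A : P *m (invmx P *m A *m P) *m invmx P = A.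
  by rewrite !mulmxA mulmxV // mul1mx -mulmxA mulmxV // mulmx1.
have PV A : invmx P *m (P *m A *m invmx P) *m P = A.
  by rewrite !mulmxA mulVmx // mul1mx -mulmxA mulVmx // mulmx1.
have Hdet A : H A -> \det A = 1.
  by move=> /Gdet; rewrite !det_mulmx dP dV mulr1 mul1r.
have HM A B : H A -> H B -> H (A *m B).
  by rewrite /H /= => HA HB; have := GM _ _ HA HB; rewrite !mulmxA mulmxK.
have HN A : H A -> H (- A) by rewrite /H /= mulmxN mulNmx; exact: GN.
have HV A : H A -> H (invmx A).
  move=> HA; have AU : A \in unitmx by rewrite unitmxE Hdet ?unitr1.
  have MU : invmx P *m A *m P \in unitmx by rewrite unitmxE Gdet ?unitr1.
  suff E : invmx P *m invmx A *m P = invmx (invmx P *m A *m P) by rewrite /H /= E; exact: GV.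
  apply: (can_inj (mulmxK MU)); rewrite mulVmx //.
  by rewrite !mulmxA mulmxK // mulmxKV // mulVmx.
have Hb : H (mx2 l 0 0 l^-1) by rewrite /H /= -Pb PV.
suff [A HA A0] : exists2 A, H A & forall i j, 0 < A i j.
  by exists (invmx P *m A *m P) => // i j; rewrite VP.
apply: (positive_entries Hdet HM HN HV Hb l1 d0) => [A HA|s s1 sP]; first exact: dP1.
(* The strip lies on the side that the orbits of 0 and oo avoid by [sP]; its width is the [d] given
   by discreteness. [U] is its preimage in the original chart. *)
pose U0 := if s == 1 then strip 1 (1 + d) else strip (- (1 + d)) (- 1).
have U0P p : U0 p -> [/\ 1 < s * (p.1 : R), s * (p.1 : R) < 1 + d & 0 < (p.2 : R)].
  have N1 : (-1 == 1 :> R) = false by apply/negbTE; rewrite lt_eqF //; lra.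
  case: s1 => sE; rewrite /U0 sE ?eqxx ?N1 /strip /= !in_itv /=;
    by case=> /andP[x1 x2] /andP[y0 _]; split => //; lra.
have [mU0 U0H aU0] : [/\ measurable U0, U0 `<=` @upper_half R & plane_area U0 = +oo%E].
  by rewrite /U0; case: ifP => _; split; try exact: measurable_strip;
    try exact: strip_upper; apply: plane_area_strip; lra.
have [PH /(_ _ mU0 U0H)[]] := area_preserving_mobius dP.
set U := _ `&` _ => mU aU; rewrite aU0 in aU.
have UH : U `<=` @upper_half R by move=> p [].
have [g [Gg g1 gN1 [u [u0 Uu] [_ Ugu]]]] := infinite_area_overlap HG mU UH aU.
have [A AE] : exists A, A = P *m g *m invmx P by eexists.
have HA : H A by rewrite /H /= AE PV.
have guE : plane_mobius P (plane_mobius g u) = plane_mobius A (plane_mobius P u).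
  rewrite -!plane_mobiusM ?dP ?(Gdet g Gg) ?(Hdet A HA) //.
  by rewrite AE -!mulmxA mulVmx // mulmx1.
have [w wE] : exists w, w = plane_mobius P u by eexists.
rewrite /= guE -wE in Ugu; rewrite /= -wE in Uu.
have [x1 x2 y0] := U0P _ Uu; have [x1' x2' _] := U0P _ Ugu.
have den0 : 0 < mobius_den A w by apply: mobius_den_gt0; [exact: Hdet|].
have /= [pr0 qs0] := sP A HA; have D := Hdet A HA; rewrite det2 in D.
have HAi : H (invmx A) by exact: HV.
have := sP _ HAi; rewrite invmx2 ?Hdet // !mxE /= => -[sr0 qp0].
have sN : 0 < s * ((A 0 0 * w.1 + A 0 1) * (A 1 0 * w.1 + A 1 1) + A 0 0 * A 1 0 * w.2 ^+ 2).
  have := lt_trans ltr01 x1'; rewrite /plane_mobius /= mulrA pmulr_lgt0 ?invr_gt0 //.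
have [q0 r0] := half_plane_return D pr0 qs0 sr0 qp0 (lt_trans ltr01 x1) sN.
rewrite q0 mul0r subr0 in D.
have p0 : A 0 0 != 0 by apply: contra_eq_neq D => ->; rewrite mul0r eq_sym oner_eq0.
have tE : A 1 1 = (A 0 0)^-1 by apply: (mulfI p0); rewrite D divff.
(* [A] is diagonal and multiplies real parts by the square of its corner entry. Both real parts lie
   between 1 and 1 + d in absolute value, so [A] or [- A] is within [d] of the identity. *)
have xE : s * (plane_mobius A w).1 = A 0 0 ^+ 2 * (s * w.1).
  by rewrite /plane_mobius /mobius_den /= q0 r0 tE !(mul0r, mulr0, addr0, add0r) expr0n /= addr0; field.
rewrite xE in x1' x2'; set x := s * w.1 in x1 x2 x1' x2'.
have p2 : A 0 0 ^+ 2 < 1 + d by have := sqr_ge0 (A 0 0); nra.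
have p2' : 1 < A 0 0 ^+ 2 * (1 + d) by have := sqr_ge0 (A 0 0); nra.
have P2 : 0 < A 0 0 ^+ 2 by rewrite exprn_even_gt0.
have v2 : (A 0 0)^-1 ^+ 2 < 1 + d by rewrite exprVn invf_plt ?posrE //; [rewrite -div1r ltr_pdivrMr|]; lra.
have v2' : 1 < (A 0 0)^-1 ^+ 2 * (1 + d) by rewrite exprVn mulrC ltr_pdivlMr // mul1r.
have near1 B : H B -> B 0 1 = 0 -> B 1 0 = 0 -> 0 < B 0 0 -> B 0 0 ^+ 2 = A 0 0 ^+ 2 -> B = 1%:M.
  move=> HB B01 B10 B0 B2; have := Hdet B HB; rewrite det2 B01 mul0r subr0 => DB.
  have B11 : B 1 1 = (B 0 0)^-1 by apply: (mulfI (lt0r_neq0 B0)); rewrite DB divff // gt_eqF.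
  apply: dP1 => // i j.
  case: (ord2_cases i) => ->; case: (ord2_cases j) => -> /=;
    rewrite ?B01 ?B10 ?subr0 ?normr0 ?B11 //; apply: near_one_of_sqr => //; rewrite ?invr_gt0 //.
  - by rewrite B2.
  - by rewrite B2.
  - by rewrite exprVn B2 -exprVn.
  - by rewrite exprVn B2 -exprVn.
have gE : g = invmx P *m A *m P by rewrite AE PV.
have [p1|p1|p1] := ltrgtP (A 0 0) 0; last by rewrite p1 eqxx in p0.
  have A1 : - A = 1%:M.
    by apply: near1; rewrite ?mxE ?q0 ?r0 ?oppr0 ?oppr_gt0 ?sqrrN //; exact: HN.
  by apply: gN1; rewrite gE -[A]opprK A1 mulmxN mulNmx mulmx1 mulVmx.
have A1 : A = 1%:M by exact: near1.
by apply: g1; rewrite gE A1 mulmx1 mulVmx.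
Qed.

End Crossing.

(** * The boundary circle *)

Section BoundaryAction.
Variable R : realType.
Implicit Types (A B P : 'M[R]_2) (x y z : boundary R) (t l : R).

(** Homogeneous coordinates on the boundary circle, seen as the projective line. *)
Definition bnum x : R := if x is Some t then t else 1.
Definition bden x : R := if x is Some _ then 1 else 0.
Definition bdet x y : R := bnum x * bden y - bden x * bnum y.

Lemma bdet_eq0 x y : bdet x y = 0 -> x = y.
Proof.
by case: x y => [s|] [t|] //; rewrite /bdet /= ?mulr1 ?mul1r ?mulr0 ?mul0r ?subr0 ?sub0r;
  [move/eqP; rewrite subr_eq0 => /eqP -> | move/eqP; rewrite oppr_eq0 oner_eq0
  | move/eqP; rewrite oner_eq0].
Qed.

Lemma boundary_mobius_coords A x : \det A = 1 -> exists2 k, k != 0 &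
  A 0 0 * bnum x + A 0 1 * bden x = k * bnum (boundary_mobius A x) /\
  A 1 0 * bnum x + A 1 1 * bden x = k * bden (boundary_mobius A x).
Proof.
rewrite det2 => dA; case: x => [t|] /=; rewrite ?mulr1 ?mulr0 ?addr0.
- case: eqP => /= [E|/eqP N].
  + exists (A 0 0 * t + A 0 1); last by rewrite mulr1 mulr0.
    apply/eqP => E'; have /eqP := dA; rewrite (_ : A 1 1 = - (A 1 0 * t)); last by lra.
    by rewrite (_ : A 0 1 = - (A 0 0 * t)); [rewrite eq_sym (_ : _ - _ = 0) ?oner_eq0 //; ring | lra].
  + by exists (A 1 0 * t + A 1 1) => //; split; rewrite /= ?mulr1 // [RHS]mulrC divfK.
- case: eqP => /= [E|/eqP N].
  + exists (A 0 0); last by rewrite mulr1 mulr0.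
    by apply/eqP => E'; move: dA; rewrite E E'; lra.
  + by exists (A 1 0) => //; split; rewrite /= ?mulr1 // [RHS]mulrC divfK.
Qed.

Lemma boundary_mobiusM A B x : \det A = 1 -> \det B = 1 ->
  boundary_mobius (A *m B) x = boundary_mobius A (boundary_mobius B x).
Proof.
move=> dA dB; have dAB : \det (A *m B) = 1 by rewrite det_mulmx dA dB mulr1.
have [k k0 [E1 E2]] := boundary_mobius_coords x dAB.
have [k' k'0 [F1 F2]] := boundary_mobius_coords x dB.
have [h h0 [H1 H2]] := boundary_mobius_coords (boundary_mobius B x) dA.
apply: bdet_eq0; apply: (mulfI (mulf_neq0 k0 (mulf_neq0 k'0 h0))); rewrite mulr0 /bdet.
move: E1 E2; rewrite !mulmx2E.
set n := bnum (boundary_mobius (A *m B) x); set d := bden (boundary_mobius (A *m B) x).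
set n' := bnum (boundary_mobius A _) in H1 *; set d' := bden (boundary_mobius A _) in H2 *.
move=> E1 E2.
have -> : k * (k' * h) * (n * d' - d * n') = (k * n) * (k' * (h * d')) - (k * d) * (k' * (h * n')) by ring.
rewrite -E1 -E2 -H1 -H2.
have -> : k' * (A 1 0 * bnum (boundary_mobius B x) + A 1 1 * bden (boundary_mobius B x)) =
  A 1 0 * (k' * bnum (boundary_mobius B x)) + A 1 1 * (k' * bden (boundary_mobius B x)) by ring.
have -> : k' * (A 0 0 * bnum (boundary_mobius B x) + A 0 1 * bden (boundary_mobius B x)) =
  A 0 0 * (k' * bnum (boundary_mobius B x)) + A 0 1 * (k' * bden (boundary_mobius B x)) by ring.
rewrite -F1 -F2; ring.
Qed.

Lemma boundary_mobius1 x : boundary_mobius 1%:M x = x.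
Proof.
case: x => [t|] /=; rewrite !mxE /= ?eqxx //.
by rewrite mul0r add0r oner_eq0 mul1r addr0 divr1.
Qed.

Lemma boundary_mobiusK P x : \det P = 1 -> boundary_mobius P (boundary_mobius (invmx P) x) = x.
Proof.
move=> dP; have uP : P \in unitmx by rewrite unitmxE dP unitr1.
by rewrite -boundary_mobiusM ?det_inv ?dP ?invr1 // mulmxV // boundary_mobius1.
Qed.

Lemma boundary_mobiusVK P x : \det P = 1 -> boundary_mobius (invmx P) (boundary_mobius P x) = x.
Proof.
move=> dP; have uP : P \in unitmx by rewrite unitmxE dP unitr1.
by rewrite -boundary_mobiusM ?det_inv ?dP ?invr1 // mulVmx // boundary_mobius1.
Qed.

Lemma cyclic_order_prod (s t u : R) :
  [\/ s < t < u, t < u < s | u < s < t] <-> 0 < (s - t) * (t - u) * (u - s).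
Proof.
have pos (a b c : R) : a < b < c -> 0 < (a - b) * (b - c) * (c - a).
  move=> /andP[ab bc]; have ac := lt_trans ab bc.
  rewrite -subr_gt0 in ab; rewrite -subr_gt0 in bc; rewrite -subr_gt0 in ac.
  by have := mulr_gt0 (mulr_gt0 ab bc) ac; nra.
have neg (a b c : R) : b <= a -> c <= b -> (a - b) * (b - c) * (c - a) <= 0.
  move=> ba cb; have ca := le_trans cb ba.
  rewrite -subr_ge0 in ba; rewrite -subr_ge0 in cb; rewrite -subr_ge0 in ca.
  by have := mulr_ge0 (mulr_ge0 ba cb) ca; nra.
split=> [[/pos|/pos|/pos]|H]; [nra|nra|nra|].
have n1 := neg s t u; have n2 := neg t u s; have n3 := neg u s t.
have [st|ts] := ltP s t; have [tu|ut] := ltP t u; have [us|su] := ltP u s.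
- by have := lt_trans (lt_trans st tu) us; rewrite ltxx.
- by apply: Or31.
- by apply: Or33.
- by have := n2 ut su; nra.
- by apply: Or32.
- by have := n3 su ts; nra.
- by have := n1 ts ut; nra.
- by have := n1 ts ut; nra.
Qed.

(** Each point occurs twice in the product, so rescaling its homogeneous coordinates multiplies the
    product by a square. This makes the invariance of the orientation under SL(2,R) a one-line
    computation. *)
Lemma positively_orientedE x y z :
  positively_oriented x y z <-> 0 < bdet x y * bdet y z * bdet z x.
Proof.
case: x y z => [s|] [t|] [u|]; rewrite /positively_oriented /bdet /= ?andbT ?andbF
  ?mulr1 ?mul1r ?mulr0 ?mul0r ?subr0 ?sub0r ?subrr ?mul0r ?mulr0 ?ltxx.
- exact: cyclic_order_prod.
all: split.
all: try by case.
all: try by case=> // H; lra.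
all: move=> H; first [by apply: Or31; lra|by apply: Or32; lra|by apply: Or33; lra|lra].
Qed.

Lemma positively_oriented_mobius A x y z : \det A = 1 -> positively_oriented x y z ->
  positively_oriented (boundary_mobius A x) (boundary_mobius A y) (boundary_mobius A z).
Proof.
move=> dA /positively_orientedE H; apply/positively_orientedE.
have [k k0 kE] := boundary_mobius_coords x dA.
have [h h0 hE] := boundary_mobius_coords y dA.
have [m m0 mE] := boundary_mobius_coords z dA.
have inv a b u v : A 0 0 * bnum u + A 0 1 * bden u = a * bnum (boundary_mobius A u) /\
  A 1 0 * bnum u + A 1 1 * bden u = a * bden (boundary_mobius A u) ->
  A 0 0 * bnum v + A 0 1 * bden v = b * bnum (boundary_mobius A v) /\
  A 1 0 * bnum v + A 1 1 * bden v = b * bden (boundary_mobius A v) ->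
  bdet u v = a * b * bdet (boundary_mobius A u) (boundary_mobius A v).
  move=> [a1 a2] [b1 b2]; rewrite /bdet.
  transitivity ((a * bnum (boundary_mobius A u)) * (b * bden (boundary_mobius A v)) -
    (a * bden (boundary_mobius A u)) * (b * bnum (boundary_mobius A v))); last by ring.
  rewrite -a1 -a2 -b1 -b2 -[LHS]mul1r -dA det2; ring.
move: H; rewrite (inv _ _ _ _ kE hE) (inv _ _ _ _ hE mE) (inv _ _ _ _ mE kE).
set X := bdet _ _; set Y := bdet _ _; set Z := bdet _ _.
have -> : k * h * X * (h * m * Y) * (m * k * Z) = (k * h * m) ^+ 2 * (X * Y * Z) by ring.
by rewrite pmulr_rgt0 // exprn_even_gt0 //= !mulf_neq0.
Qed.

Lemma boundary_mobius_conj P b x : \det P = 1 -> \det b = 1 ->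
  boundary_mobius (P *m b *m invmx P) (boundary_mobius P x) = boundary_mobius P (boundary_mobius b x).
Proof.
move=> dP db; have dV : \det (invmx P) = 1 by rewrite det_inv dP invr1.
by rewrite !boundary_mobiusM ?det_mulmx ?dP ?db ?mulr1 // boundary_mobiusVK.
Qed.

Lemma hyperbolic_conj P b : \det P = 1 -> hyperbolic (P *m b *m invmx P) <-> hyperbolic b.
Proof.
move=> dP; have uP : P \in unitmx by rewrite unitmxE dP unitr1.
by rewrite /hyperbolic mxtrace_mulC mulmxA mulVmx // mul1mx.
Qed.

Lemma invmxM m (A B : 'M[R]_m) : A \in unitmx -> B \in unitmx ->
  invmx (A *m B) = invmx B *m invmx A.
Proof.
move=> uA uB; have uAB : A *m B \in unitmx by rewrite unitmx_mul uA.
by apply: (can_inj (mulKmx uAB)); rewrite mulmxV // mulmxA -(mulmxA A) mulmxV // mulmx1 mulmxV.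
Qed.

(** Once x is moved to oo the matrix is upper triangular with diagonal l, 1/l, and l^2 != 1 because
    the trace exceeds 2 in absolute value; a translation then moves the other fixed point to 0. Both
    l^2 < 1 and l^2 > 1 can occur. *)
Lemma hyperbolic_diagonalize b x : \det b = 1 -> hyperbolic b -> boundary_mobius b x = x ->
  exists P l, [/\ \det P = 1, l != 0, l ^+ 2 != 1, P *m b *m invmx P = mx2 l 0 0 l^-1 &
    boundary_mobius P x = None].
Proof.
move=> db hb bx.
have [P0 dP0 P0x] : exists2 P0 : 'M[R]_2, \det P0 = 1 & boundary_mobius P0 x = None.
  case: x {bx} => [t|]; last by exists 1%:M; rewrite ?det1 ?boundary_mobius1.
  exists (mx2 0 1 (-1) t); first by rewrite det_mx2; lra.
  by rewrite /= !mxE /= mulN1r addNr eqxx.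
have dV0 : \det (invmx P0) = 1 by rewrite det_inv dP0 invr1.
have uP0 : P0 \in unitmx by rewrite unitmxE dP0 unitr1.
have [M ME] : exists M, M = P0 *m b *m invmx P0 by eexists.
have dM : \det M = 1 by rewrite ME !det_mulmx dP0 db dV0 !mulr1.
have hM : hyperbolic M by rewrite ME hyperbolic_conj.
have : boundary_mobius M None = None.
  by rewrite ME -P0x boundary_mobius_conj // bx.
rewrite /=; case: eqP => // M10 _.
move: dM; rewrite det2 M10 mulr0 subr0 => dM.
have l0 : M 0 0 != 0 by apply: contra_eq_neq dM => ->; rewrite mul0r eq_sym oner_neq0.
have M11 : M 1 1 = (M 0 0)^-1 by rewrite -[RHS]mul1r -dM mulrC mulKf.
have l1 : M 0 0 ^+ 2 != 1.
  apply/eqP => l1; move: hM; rewrite /hyperbolic /mxtrace big_ord_recl big_ord1 /=.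
  rewrite (_ : lift _ _ = 1 :> 'I_2); last exact: val_inj.
  have -> : M 1 1 = M 0 0 by rewrite -[RHS]mulr1 -dM mulrA -expr2 l1 mul1r.
  rewrite -mulr2n normrMn -mulr_natr; have := normr_ge0 (M 0 0).
  have : `|M 0 0| ^+ 2 = 1 by rewrite -normrX l1 normr1.
  by move: `|_| => y E y0 y2; nra.
(* The other fixed point of [M] is - k, and the translation by k carries it to 0. *)
pose k := M 0 1 / (M 0 0 - (M 0 0)^-1).
have kne : M 0 0 - (M 0 0)^-1 != 0.
  by apply: contra l1; rewrite subr_eq0 => /eqP E; rewrite expr2 {2}E divff.
exists (mx2 1 k 0 1 *m P0), (M 0 0); split=> //.
- by rewrite det_mulmx dP0 det_mx2; lra.
- have dN : \det (mx2 1 k 0 1 : 'M[R]_2) = 1 by rewrite det_mx2; lra.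
  have -> : invmx (mx2 1 k 0 1 *m P0) = invmx P0 *m invmx (mx2 1 k 0 1).
    by rewrite invmxM // unitmxE ?dN ?dP0 unitr1.
  rewrite !mulmxA -2!(mulmxA (mx2 1 k 0 1)) -ME (invmx2 dN) (mx2E M) M10 M11.
  rewrite !mx2_mul !mxE /=; congr mx2; rewrite ?mul0r ?mulr0 ?mul1r ?mulr1 ?oppr0 ?addr0 ?add0r ?mul0r ?mulr0 ?add0r ?addr0 //.
  by have := divfK kne (M 0 1); rewrite -/k; lra.
- by rewrite boundary_mobiusM // ?P0x ?det_mx2 /= ?mxE /= ?eqxx //; lra.
Qed.

End BoundaryAction.

(** * Reduction of vectors and subspaces *)

Section ResidueMap.
Variables (F : rcfType) (O : convexSubring F).
Local Notation res := (@residue F O).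
Implicit Types x y : F.

Definition infinitesimal x := x \in O /\ (x = 0 \/ x^-1 \notin O).

Lemma convex_ring0 : 0 \in O. Proof. exact: rpred0. Qed.
Lemma convex_ring1 : 1 \in O. Proof. exact: rpred1. Qed.

Lemma residueD x y : x \in O -> y \in O -> res (x + y) = res x + res y.
Proof.
move=> Ox Oy; have Oxy : x + y \in O by rewrite rpredD.
by rewrite !residueE -rmorphD; congr residue_class; apply: val_inj.
Qed.

Lemma residueM x y : x \in O -> y \in O -> res (x * y) = res x * res y.
Proof.
move=> Ox Oy; have Oxy : x * y \in O by rewrite rpredM.
by rewrite !residueE -rmorphM; congr residue_class; apply: val_inj.
Qed.

Lemma residueN x : x \in O -> res (- x) = - res x.
Proof.
move=> Ox; have ONx : - x \in O by rewrite rpredN.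
by rewrite !residueE -rmorphN; congr residue_class; apply: val_inj.
Qed.

Lemma residueB x y : x \in O -> y \in O -> res (x - y) = res x - res y.
Proof. by move=> Ox Oy; rewrite residueD ?residueN ?rpredN. Qed.

Lemma residue0 : res 0 = 0.
Proof. by rewrite (residueE convex_ring0) -(rmorph0 (@residue_class F O)); congr residue_class; apply: val_inj. Qed.

Lemma residue1 : res 1 = 1.
Proof. by rewrite (residueE convex_ring1) -(rmorph1 (@residue_class F O)); congr residue_class; apply: val_inj. Qed.

Lemma residue_sum (I : finType) (f : I -> F) : (forall i, f i \in O) ->
  res (\sum_i f i) = \sum_i res (f i).
Proof.
move=> fO.
suff [] : \sum_i f i \in O /\ res (\sum_i f i) = \sum_i res (f i) by [].
elim/big_rec2: _ => [|i y1 y2 _ [Oy <-]]; first by rewrite residue0 rpred0.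
by rewrite rpredD // residueD.
Qed.

Lemma residue_eq0 x : x \in O -> (res x == 0) = ((x == 0) || (x^-1 \notin O)).
Proof. by move=> Ox; rewrite (residueE Ox) residue_class_eq0. Qed.

Lemma residue_infinitesimal x : infinitesimal x <-> x \in O /\ res x = 0.
Proof.
split=> [[Ox xI]|[Ox xI]]; split=> //.
  by apply/eqP; rewrite residue_eq0 //; case: xI => [->|->]; rewrite ?eqxx ?orbT.
by move/eqP: xI; rewrite residue_eq0 // => /orP[/eqP|]; [left|right].
Qed.

Lemma residue_le x y : x \in O -> y \in O -> x <= y -> res x <= res y.
Proof. by move=> Ox Oy xy; rewrite (residueE Ox) (residueE Oy) residue_class_le. Qed.

Lemma residue_surj (k : residue_field O) : exists2 x, x \in O & res x = k.
Proof.
exists (val (residue_lift k)); first exact: valP.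
by rewrite /residue valKd residue_liftK.
Qed.

Lemma convex_ge0_le x y : y \in O -> 0 <= x -> x <= y -> x \in O.
Proof. by move=> Oy x0 xy; apply: (convex_le Oy); rewrite !ger0_norm // (le_trans x0). Qed.

Lemma convex_sqr x : x ^+ 2 \in O -> x \in O.
Proof.
move=> Ox2; have [x1|/ltW x1] := lerP `|x| 1.
  by apply: (convex_le convex_ring1); rewrite normr1.
by apply: (convex_le Ox2); rewrite normrX expr2 ler_peMl.
Qed.

Lemma residue_inv_unit x : x \in O -> x^-1 \in O -> x != 0 -> res x != 0.
Proof. by move=> Ox OVx x0; rewrite residue_eq0 // negb_or x0 negbK. Qed.

Lemma notin_convex_inv x : x \notin O -> infinitesimal x^-1.
Proof.
move=> nOx; have x0 : x != 0 by apply: contraNneq nOx => ->; exact: rpred0.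
split; last by right; rewrite invrK.
have [x1|x1] := lerP `|x| 1.
  by case/negP: nOx; apply: (convex_le convex_ring1); rewrite normr1.
by apply: (convex_le convex_ring1); rewrite normr1 normfV invf_le1 ?normr_gt0 // ltW.
Qed.

End ResidueMap.

Section MaximalMinor.
Variables (F : realFieldType) (m n : nat).

(* Normalise the n x n minor of largest absolute value to the identity: the
   remaining entries are quotients of minors (Cramer), hence at most 1. *)
Lemma normalized_column_basis (M : 'M[F]_(m, n)) : row_full M ->
  exists (f : 'I_n -> 'I_m) (X : 'M[F]_n), [/\ X \in unitmx,
    rowsub f (M *m X) = 1%:M & forall i j, `|(M *m X) i j| <= 1].
Proof.
move=> Mfull.
pose d (f : {ffun 'I_n -> 'I_m}) := `|\det (rowsub f M)|.
pose f0 : {ffun 'I_n -> 'I_m} := fullrankfun Mfull.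
pose f := [arg max_(f > f0 | true) d f]%O.
have [fmax] : (forall g, d g <= d f) /\ 0 < d f0.
  split.
    by rewrite /f; case: arg_maxP => // h _ hP g; exact: hP.
  by rewrite /d normr_gt0 -unitfE -unitmxE -row_full_unit /row_full mxrank_fullrowsub.
move=> d0; have df : 0 < d f by exact: lt_le_trans d0 (fmax f0).
have fU : rowsub f M \in unitmx by rewrite unitmxE unitfE -normr_gt0.
exists f, (invmx (rowsub f M)).
have fE : rowsub f (M *m invmx (rowsub f M)) = 1%:M by rewrite -mul_rowsub_mx mulmxV.
split=> //; first by rewrite unitmx_inv.
move=> i j; set B := M *m _ in fE *.
(* Exchanging the selected row [f j] for row [i] multiplies the minor by [B i j], so maximality of
   the minor bounds this entry. *)
pose g : {ffun 'I_n -> 'I_m} := [ffun k => if k == j then i else f k].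
have dg : \det (rowsub g M) = B i j * \det (rowsub f M).
  have -> : rowsub g M = rowsub g B *m rowsub f M.
    by rewrite mul_rowsub_mx /B mulmxKV.
  rewrite det_mulmx; congr (_ * _).
  have gE k l : rowsub g B k l = if k == j then B i l else (k == l)%:R.
    rewrite !mxE ffunE; case: ifP => // _.
    by have /matrixP/(_ k l) := fE; rewrite !mxE.
  rewrite (expand_det_col _ j) (bigD1 j) //= big1 ?addr0 => [|k /negPf kj]; last first.
    by rewrite gE kj mul0r.
  rewrite gE eqxx /cofactor (_ : row' j (col' j _) = 1%:M).
    by rewrite det1 mulr1 -signr_odd addnn odd_double expr0 mulr1.
  apply/matrixP => k l; rewrite mxE mxE gE eq_sym (negPf (neq_lift _ _)) mxE.
  by rewrite (inj_eq lift_inj).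
have := fmax g; rewrite /d dg normrM.
by rewrite -[leRHS]mul1r ler_pM2r.
Qed.
End MaximalMinor.

Section Reduce.
Variables (F : rcfType) (O : convexSubring F) (V : vectType F) (w : {skew_symmetric V}).
Variables (n : nat) (e : (n + n).-tuple V) (He : symplectic_basis w e).
Local Notation K := (residue_field O).
Local Notation res := (@residue F O).
Implicit Types (u v : V) (L : {vspace V}).

Definition integral_vec v := forall i, coord e i v \in O.

Definition red v : 'cV[K]_(n + n) := \col_i res (coord e i v).

Let bas : basis_of fullv e. Proof. exact: He.1. Qed.

Lemma vec_coordE v : v = \sum_i coord e i v *: tnth e i.
Proof. by rewrite {1}(coord_basis bas (memvf v)); apply: eq_bigr => i _; rewrite -tnth_nth. Qed.

Lemma eq_coordP u v : (forall i, coord e i u = coord e i v) -> u = v.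
Proof. by move=> uv; rewrite (vec_coordE u) (vec_coordE v); apply: eq_bigr => i _; rewrite uv. Qed.

Lemma coord_vec (c : 'I_(n + n) -> F) i : coord e i (\sum_j c j *: tnth e j) = c i.
Proof.
under eq_bigr do rewrite (tnth_nth 0).
by rewrite coord_sum_free //; exact: basis_free bas.
Qed.

Lemma symplectic_coordE u v : w u v =
  \sum_j (\sum_k coord e k u * symplectic_mx F n k j) * coord e j v.
Proof.
rewrite {1}(vec_coordE v) linear_sumr /=; apply: eq_bigr => j _.
rewrite linearZr /= mulrC; congr (_ * _).
rewrite {1}(vec_coordE u) linear_sumlz; apply: eq_bigr => k _.
by rewrite linearZl /= He.2.
Qed.

Lemma symplectic_mx_integral (A : 'M[F]_(n + n)) i j : A = symplectic_mx F n ->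
  A i j \in O /\ res (A i j) = symplectic_mx K n i j.
Proof.
move=> ->; rewrite /symplectic_mx -(splitK i) -(splitK j).
case: (fintype.split i) => k; case: (fintype.split j) => l;
  rewrite /= ?(block_mxEul, block_mxEur, block_mxEdl, block_mxEdr) !mxE.
- by rewrite rpred0 residue0.
- by case: eqP => _; rewrite ?rpred0 ?rpred1 ?residue0 ?residue1.
- by case: eqP => _; rewrite ?rpredN ?rpred0 ?rpred1 residueN ?rpred0 ?rpred1 ?residue0 ?residue1.
- by rewrite rpred0 residue0.
Qed.

Lemma symplectic_integral u v : integral_vec u -> integral_vec v -> w u v \in O.
Proof.
move=> Ou Ov; rewrite symplectic_coordE rpred_sum // => j _; rewrite rpredM // rpred_sum // => k _.
by rewrite rpredM //; have [] := symplectic_mx_integral k j (erefl _).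
Qed.

Lemma residue_symplectic u v : integral_vec u -> integral_vec v ->
  res (w u v) = std_form (red u) (red v).
Proof.
move=> Ou Ov; rewrite symplectic_coordE /std_form mxE.
have OJ k j : symplectic_mx F n k j \in O by have [] := symplectic_mx_integral k j (erefl _).
have Oin j : \sum_k coord e k u * symplectic_mx F n k j \in O.
  by rewrite rpred_sum // => k _; rewrite rpredM.
rewrite residue_sum => [|j]; last by rewrite rpredM.
apply: eq_bigr => j _; rewrite residueM // !mxE; congr (_ * _).
rewrite residue_sum => [|k]; last by rewrite rpredM.
apply: eq_bigr => k _; rewrite residueM //; congr (_ * _); first by rewrite !mxE.
by have [] := symplectic_mx_integral k j (erefl _).
Qed.

Lemma integralD u v : integral_vec u -> integral_vec v -> integral_vec (u + v).
Proof. by move=> Ou Ov i; rewrite linearD /= rpredD. Qed.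

Lemma integralN v : integral_vec v -> integral_vec (- v).
Proof. by move=> Ov i; rewrite linearN /= rpredN. Qed.

Lemma integralB u v : integral_vec u -> integral_vec v -> integral_vec (u - v).
Proof. by move=> Ou Ov; apply: integralD => //; exact: integralN. Qed.

Lemma integralZ a v : a \in O -> integral_vec v -> integral_vec (a *: v).
Proof. by move=> Oa Ov i; rewrite linearZ /= rpredM. Qed.

Lemma redD u v : integral_vec u -> integral_vec v -> red (u + v) = red u + red v.
Proof. by move=> Ou Ov; apply/colP => i; rewrite !mxE linearD /= residueD. Qed.

Lemma redN v : integral_vec v -> red (- v) = - red v.
Proof. by move=> Ov; apply/colP => i; rewrite !mxE linearN /= residueN. Qed.

Lemma redB u v : integral_vec u -> integral_vec v -> red (u - v) = red u - red v.
Proof. by move=> Ou Ov; rewrite redD ?redN //; exact: integralN. Qed.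

Lemma redZ a v : a \in O -> integral_vec v -> red (a *: v) = res a *: red v.
Proof. by move=> Oa Ov; apply/colP => i; rewrite !mxE linearZ /= residueM. Qed.

Lemma integral0 : integral_vec 0.
Proof. by move=> i; rewrite linear0 rpred0. Qed.

Lemma red0 : red 0 = 0.
Proof. by apply/colP => i; rewrite !mxE linear0 residue0. Qed.

Lemma integral_sum (I : finType) (f : I -> V) : (forall i, integral_vec (f i)) ->
  integral_vec (\sum_i f i) /\ red (\sum_i f i) = \sum_i red (f i).
Proof.
move=> Of; elim/big_rec2: _ => [|i y1 y2 _ [Oy <-]]; first by split; [exact: integral0 | exact: red0].
by split; [exact: integralD | rewrite redD].
Qed.

Lemma coord_basis_mx (f : 'End(V)) v i :
  coord e i (f v) = \sum_j basis_mx e f i j * coord e j v.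
Proof.
rewrite {1}(vec_coordE v) !linear_sum /=; apply: eq_bigr => j _.
by rewrite !linearZ /= mxE mulrC.
Qed.

Lemma integral_map (f : 'End(V)) v : integral_in O e f -> integral_vec v -> integral_vec (f v).
Proof. by move=> Of Ov i; rewrite coord_basis_mx rpred_sum // => j _; apply: rpredM; [exact: Of|exact: Ov]. Qed.

Lemma red_map (f : 'End(V)) v : integral_in O e f -> integral_vec v ->
  red (f v) = map_mx res (basis_mx e f) *m red v.
Proof.
move=> Of Ov; apply/colP => i; rewrite [LHS]mxE [RHS]mxE coord_basis_mx.
rewrite residue_sum => [|j]; last by rewrite rpredM.
by apply: eq_bigr => j _; rewrite residueM //; congr (_ * _); rewrite [RHS]mxE.
Qed.

(** Divide by the coordinate of largest absolute value: all coordinates become at most 1 in absolute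
    value, hence integral, and one of them becomes 1. *)
Lemma primitive_multiple v : v != 0 ->
  exists c v', [/\ c != 0, v = c *: v', integral_vec v' & red v' != 0].
Proof.
move=> v0.
have [i0 vi0] : exists i, coord e i v != 0.
  apply: contrapT => nv; case/eqP: v0; apply: eq_coordP => i; rewrite linear0.
  by apply/eqP; apply: contrapT => /negP vi; apply: nv; exists i.
pose i := [arg max_(j > i0 | true) `|coord e j v|]%O.
have imax j : `|coord e j v| <= `|coord e i v|.
  by rewrite /i; case: arg_maxP => // k _ kP; exact: kP.
have vi : coord e i v != 0 by rewrite -normr_gt0 (lt_le_trans _ (imax i0)) // normr_gt0.
exists (coord e i v), ((coord e i v)^-1 *: v); split=> //.
- by rewrite scalerA divff // scale1r.
- move=> j; rewrite linearZ /=; apply: (@convex_le _ _ _ 1); first exact: rpred1.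
  by rewrite normr1 normrM normfV ler_pdivrMl ?normr_gt0 // mulr1.
apply/eqP => /colP/(_ i); rewrite !mxE linearZ /= mulVf // residue1.
by move/eqP; rewrite oner_eq0.
Qed.

(** The identity block in the rows [f] has two uses: the coordinates in [b] of an integral vector of
    [L] are among its coordinates in [e], hence integral, and the reductions of the basis vectors
    stay free. *)
Lemma integral_basis L : exists (b : (\dim L).-tuple V) (f : 'I_(\dim L) -> 'I_(n + n)),
  [/\ basis_of L b, forall j k, coord e (f j) (tnth b k) = (j == k)%:R &
      forall k, integral_vec (tnth b k)].
Proof.
pose M : 'M[F]_(n + n, \dim L) := \matrix_(i, k) coord e i (tnth (vbasis L) k).
have Mfull : row_full M.
  rewrite /row_full -mxrank_tr; apply: inj_row_free => c cM.
  have c0 : \sum_k c 0 k *: (vbasis L)`_k = 0.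
    apply: eq_coordP => i; rewrite linear0 linear_sum /=.
    transitivity ((c *m M^T) 0 i); last by rewrite cM mxE.
    by rewrite mxE; apply: eq_bigr => k _; rewrite linearZ /= !mxE (tnth_nth 0).
  have /freeP fr := basis_free (vbasisP L).
  by apply/rowP => k; rewrite (fr _ c0) mxE.
have [f [X [XU fE le1]]] := normalized_column_basis Mfull.
pose b := [tuple \sum_j X j k *: tnth (vbasis L) j | k < \dim L].
have bE i k : coord e i (tnth b k) = (M *m X) i k.
  rewrite tnth_mktuple linear_sum /= mxE; apply: eq_bigr => j _.
  by rewrite linearZ /= mxE mulrC.
have bL k : tnth b k \in L.
  by rewrite tnth_mktuple rpred_sum // => j _; rewrite rpredZ // vbasis_mem // mem_tnth.
exists b, f; move: b bE bL => b bE bL; split.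
- rewrite basisEfree size_tuple leqnn andbT; apply/andP; split.
    apply/freeP => c cb j.
    have := congr1 (coord e (f j)) cb; rewrite linear0 linear_sum /= => <-.
    transitivity (\sum_k c k * (j == k)%:R); last first.
      apply: eq_bigr => k _; rewrite linearZ /= -tnth_nth bE.
      by have /matrixP/(_ j k) := fE; rewrite !mxE => <-.
    rewrite (bigD1 j) //= eqxx mulr1 big1 ?addr0 // => k /negPf.
    by rewrite eq_sym => ->; rewrite mulr0.
  by apply/span_subvP => v /tnthP[k ->]; exact: bL.
- by move=> j k; rewrite bE; have /matrixP/(_ j k) := fE; rewrite !mxE.
- move=> k i; rewrite bE; apply: (@convex_le _ _ _ 1); first exact: rpred1.
  by rewrite normr1.
Qed.

End Reduce.

(** * Dimensions of orthogonals and Lagrangians *)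

Section LagrangianDim.
Variables (F : rcfType) (V : vectType F) (w : {skew_symmetric V}).
Implicit Types (U L : {vspace V}).

Lemma formDl u v x : w (u + v) x = w u x + w v x. Proof. exact: linearDl. Qed.
Lemma formDr x u v : w x (u + v) = w x u + w x v. Proof. exact: linearDr. Qed.
Lemma formNl u x : w (- u) x = - w u x. Proof. exact: linearNl. Qed.
Lemma formNr x u : w x (- u) = - w x u. Proof. exact: linearNr. Qed.
Lemma formZl a u x : w (a *: u) x = a * w u x. Proof. exact: linearZl. Qed.
Lemma formZr a x u : w x (a *: u) = a * w x u. Proof. exact: linearZr. Qed.

Lemma skewC u v : w u v = - w v u.
Proof. by rewrite hermC expr1 mulN1r. Qed.

Lemma skewvv u : w u u = 0.
Proof.
have /eqP := skewC u u; rewrite -addr_eq0 -mulr2n mulrn_eq0 /= => /eqP //.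
Qed.

Lemma dim_orthov_span (X : seq V) U :
  (\dim U <= \dim (U :&: orthov w <<X>>) + size X)%N.
Proof.
elim: X U => [|x X IH] U; first by rewrite span_nil orthov0 capvf addn0.
have := leq_dim_orthov1 w x U; have := IH (U :&: orthov w <[x]>)%VS.
have : (\dim (U :&: orthov w <[x]> :&: orthov w <<X>>) <= \dim (U :&: orthov w <<x :: X>>))%N.
  apply/dimvS/subvP => v; rewrite !memv_cap => /andP[/andP[-> vx] vX] /=.
  by rewrite mem_orthov_sym span_cons subv_add -!mem_orthov_sym vx.
rewrite /=; lia.
Qed.

(** The lower bound [low], applied to [U] and to a complement, adds up to the full dimension. The
    two orthogonals meet trivially by nondegeneracy, so both bounds are equalities. *)
Lemma dim_orthov U : nondegenerate w -> (\dim U + \dim (orthov w U) = \dim {:V})%N.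
Proof.
move=> nd.
have low U' : (\dim {:V} <= \dim (orthov w U') + \dim U')%N.
  have := dim_orthov_span (vbasis U') fullv.
  by rewrite size_tuple capfv (span_basis (vbasisP U')).
have := low U; have := low U^C%VS; have := dimv_compl U.
have := dimvS (subvf U); have : (\dim (orthov w U) + \dim (orthov w U^C) <= \dim {:V})%N.
  rewrite -dimv_sum_cap.
  have -> : (orthov w U :&: orthov w U^C)%VS = 0%VS.
    apply/eqP; rewrite -subv0 -(eqP nd); apply/subvP => v.
    rewrite memv_cap => /andP[vU vC].
    by rewrite mem_orthov_sym -(addv_complf U) subv_add -!mem_orthov_sym vU.
  by rewrite dimv0 addn0 dimvS // subvf.
lia.
Qed.

Lemma lagrangian_dim n L : nondegenerate w -> \dim {:V} = (n + n)%N ->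
  lagrangian w L -> \dim L = n.
Proof. by move=> nd dV LL; have := dim_orthov L nd; rewrite LL dV; lia. Qed.

Lemma lagrangian_of_dim n L : nondegenerate w -> \dim {:V} = (n + n)%N ->
  \dim L = n -> (forall u v, u \in L -> v \in L -> w u v = 0) -> lagrangian w L.
Proof.
move=> nd dV dL iso; apply/esym/eqP; rewrite eqEdim; apply/andP; split.
  by apply/subvP => u uL; apply/mem_orthovP => v vL; exact: iso.
by have := dim_orthov L nd; rewrite dV; lia.
Qed.

Lemma lagrangian_iso L u v : lagrangian w L -> u \in L -> v \in L -> w u v = 0.
Proof. by move=> LL uL vL; apply: (mem_orthovP _) vL; rewrite LL. Qed.

Lemma lagrangian_max L v : lagrangian w L -> (forall u, u \in L -> w v u = 0) -> v \in L.
Proof. by move=> LL vL; rewrite -LL; apply/mem_orthovP. Qed.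

Lemma transverse_sum n L1 L2 : \dim {:V} = (n + n)%N -> \dim L1 = n -> \dim L2 = n ->
  transverse L1 L2 -> (L1 + L2)%VS = fullv.
Proof.
move=> dV d1 d2 tr; apply/eqP; rewrite eqEdim subvf /=.
by have := dimv_sum_cap L1 L2; rewrite tr dimv0 d1 d2 dV; lia.
Qed.

End LagrangianDim.

Section ReduceSubspace.
Variables (F : rcfType) (O : convexSubring F) (V : vectType F) (w : {skew_symmetric V}).
Variables (n : nat) (e : (n + n).-tuple V) (He : symplectic_basis w e).
Hypothesis nd : nondegenerate w.
Local Notation K := (residue_field O).
Local Notation res := (@residue F O).
Local Notation integral_vec := (integral_vec O e).
Local Notation red := (red O e).
Local Notation W := 'cV[K]_(n + n).
Local Notation std := (@std_form K n).
Implicit Types (u v : V) (L : {vspace V}).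

(** The span of the reductions of a chosen integral basis. [reduceP] identifies it with the set of
    reductions of all integral vectors of [L], which does not depend on the choice. *)
Definition reduce L : {vspace W} :=
  <<[seq red v | v <- sval (cid (integral_basis O He L))]>>%VS.

Lemma reduce_basis L : exists (f : 'I_(\dim L) -> 'I_(n + n)) (b : (\dim L).-tuple V),
  [/\ basis_of L b, forall j k, coord e (f j) (tnth b k) = (j == k)%:R,
      forall k, integral_vec (tnth b k) &
      reduce L = <<[seq red v | v <- b]>>%VS].
Proof.
by rewrite /reduce; case: (cid _) => b /= [f [bL fb Ob]]; exists f, b; split.
Qed.

Lemma reduceP L x : reflect (exists v, [/\ v \in L, integral_vec v & red v = x]) (x \in reduce L).
Proof.
apply: (iffP idP); have [f [b [bL fb Ob ->]]] := reduce_basis L;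
  have mapE k : tnth (map_tuple red b) k = red (tnth b k) by rewrite tnth_map.
  rewrite -[map _ _]/(tval (map_tuple red b)) => /coord_span ->.
  have /choice[c cP] k : exists a, a \in O /\ res a = coord (map_tuple red b) k x.
    by have [a Oa aE] := residue_surj (coord (map_tuple red b) k x); exists a.
  have Oc k : integral_vec (c k *: tnth b k) by apply: integralZ => //; exact: (cP k).1.
  exists (\sum_k c k *: tnth b k); have [Os ->] := integral_sum Oc; split=> //.
    by rewrite rpred_sum // => k _; rewrite rpredZ // (basis_mem bL) // mem_tnth.
  apply: eq_bigr => k _; rewrite redZ //; last exact: (cP k).1.
  by rewrite (cP k).2 -tnth_nth mapE.
move=> [v [vL Ov <-]].
have vE : v = \sum_k coord b k v *: tnth b k.
  by rewrite {1}(coord_basis bL vL); apply: eq_bigr => k _; rewrite -tnth_nth.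
have cE j : coord b j v = coord e (f j) v.
  rewrite [in RHS]vE linear_sum /= (bigD1 j) //= big1 => [|k /negPf kj].
    by rewrite linearZ /= fb eqxx mulr1 addr0.
  by rewrite linearZ /= fb eq_sym kj mulr0.
have Oc k : integral_vec (coord b k v *: tnth b k) by apply: integralZ => //; rewrite cE.
have [_] := integral_sum Oc; rewrite -vE => ->.
rewrite rpred_sum // => k _; rewrite redZ ?cE // rpredZ // memv_span //.
by rewrite map_f // mem_tnth.
Qed.

Lemma dim_reduce L : \dim (reduce L) = \dim L.
Proof.
have [f [b [bL fb Ob ->]]] := reduce_basis L.
rewrite -[map _ _]/(tval (map_tuple red b)).
suff : free (map_tuple red b) by move/eqP => ->; rewrite size_tuple.
apply/freeP => c cb j; have /colP/(_ (f j)) := cb; rewrite summxE [RHS]mxE => <-.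
transitivity (\sum_k c k * (j == k)%:R).
  rewrite (bigD1 j) //= eqxx mulr1 big1 ?addr0 // => k /negPf.
  by rewrite eq_sym => ->; rewrite mulr0.
apply: eq_bigr => k _; rewrite -tnth_nth tnth_map !mxE fb.
by case: (j == k); rewrite ?residue1 ?residue0.
Qed.

Lemma mem_reduce L v : v \in L -> integral_vec v -> red v \in reduce L.
Proof. by move=> vL Ov; apply/reduceP; exists v. Qed.

Lemma dim_fullV : \dim {:V} = (n + n)%N.
Proof. by have [bas _] := He; rewrite (size_basis bas). Qed.

Lemma reduce_lagrangian L : lagrangian w L -> lagrangian std (reduce L).
Proof.
move=> LL; have [ndW _ _] := std_form_psymplectic K n.
apply: (@lagrangian_of_dim _ _ _ n) => //.
- by rewrite dimvf /= /dim /= muln1.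
- by rewrite dim_reduce; apply: lagrangian_dim nd dim_fullV LL.
- move=> x y /reduceP[u [uL Ou <-]] /reduceP[v [vL Ov <-]].
  apply: etrans (esym (residue_symplectic He Ou Ov)) _.
  by rewrite (lagrangian_iso LL) ?residue0.
Qed.

Definition red_lfun (f : 'End(V)) : 'End(W) := linfun (mulmx (map_mx res (basis_mx e f))).

Lemma red_lfunE f v : integral_in O e f -> integral_vec v -> red_lfun f (red v) = red (f v).
Proof. by move=> Of Ov; rewrite lfunE /= (red_map He). Qed.

(** Integrality of the inverse [g] ensures that an integral vector of the image of [L] comes from an
    integral vector of [L]. *)
Lemma reduce_map (f g : 'End(V)) L : integral_in O e f -> integral_in O e g ->
  (f \o g)%VF = \1%VF -> (g \o f)%VF = \1%VF ->
  reduce (f @: L)%VS = (red_lfun f @: reduce L)%VS.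
Proof.
move=> Of Og fg gf.
have gK v : g (f v) = v by rewrite -comp_lfunE gf id_lfunE.
apply/vspaceP => x; apply/reduceP/memv_imgP.
  move=> [v [/memv_imgP[u uL vE] Ov <-]].
  have Ou : integral_vec u by rewrite -(gK u) -vE; apply: (integral_map He).
  by exists (red u); [exact: mem_reduce | rewrite red_lfunE // vE].
move=> [y /reduceP[u [uL Ou <-]] ->]; exists (f u); split.
- by rewrite memv_img.
- exact: (integral_map He).
- by rewrite red_lfunE.
Qed.

End ReduceSubspace.

(** * Maximal triples *)

Lemma cauchy_schwarz_scalar (F : realFieldType) (A B C : F) :
  (forall a b : F, 0 <= a ^+ 2 * A + a * b * (B + B) + b ^+ 2 * C) -> B ^+ 2 <= A * C.
Proof.
move=> H; have A0 : 0 <= A by have := H 1 0; lra.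
have C0 : 0 <= C by have := H 0 1; lra.
move: C0; rewrite le_eqVlt => /orP[/eqP C0|C0].
  have [->|B0] := eqVneq B 0; first by rewrite -C0 expr0n mulr0.
  (* Here [C] is 0 and this choice of b gives the form the value -1. *)
  have := H 1 (- (A + 1) / (B + B)); rewrite -C0 mulr0 addr0 expr1n !mul1r divfK; first by lra.
  by rewrite -mulr2n mulrn_eq0.
have : 0 <= C * (A * C - B ^+ 2).
  have -> : C * (A * C - B ^+ 2) = C ^+ 2 * A + C * (- B) * (B + B) + (- B) ^+ 2 * C by ring.
  exact: H.
by rewrite pmulr_rge0 // subr_ge0.
Qed.

Section Triples.
Variables (F : rcfType) (V : vectType F) (w : {skew_symmetric V}) (n : nat).
Hypotheses (nd : nondegenerate w) (dimV : \dim {:V} = (n + n)%N).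
Implicit Types (u v t : V) (l : {vspace V}).

Lemma lagrangian_sum l l' : lagrangian w l -> lagrangian w l' -> transverse l l' ->
  (l + l')%VS = fullv.
Proof.
by move=> Ll Ll'; apply: (transverse_sum dimV); apply: lagrangian_dim nd dimV _.
Qed.

Lemma transverse_graph l l' u : lagrangian w l -> lagrangian w l' -> transverse l l' ->
  exists2 t, t \in l' & u + t \in l.
Proof.
move=> Ll Ll' tr; have := triple_mapP u tr (lagrangian_sum Ll Ll' tr) (triple_map l l' u).
by rewrite eqxx => /andP[]; exists (triple_map l l' u).
Qed.

Lemma maximal_triple_gt0 l1 l2 l3 u t : maximal_triple w l1 l2 l3 ->
  u \in l1 -> t \in l3 -> u + t \in l2 -> u != 0 -> 0 < w u t.
Proof.
move=> [[L1 L2 L3] [tr12 tr23 tr13] pos] u1 t3 ut2 u0.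
have := triple_mapP u tr23 (lagrangian_sum L2 L3 tr23) t; rewrite t3 ut2 => /esym/eqP ->.
exact: pos.
Qed.

Lemma maximal_triple_ge0 l1 l2 l3 u t : maximal_triple w l1 l2 l3 ->
  u \in l1 -> t \in l3 -> u + t \in l2 -> 0 <= w u t.
Proof.
move=> M u1 t3 ut2; have [->|u0] := eqVneq u 0; first by rewrite linear0l.
by apply/ltW/(maximal_triple_gt0 M).
Qed.

(** [l] is regarded as the graph of a map from [p] to [q], and (u, u') -> w u t' as the bilinear
    form of this graph; its symmetry is the isotropy of [l]. *)
Lemma graph_form_sym l p q u t u' t' : lagrangian w l -> lagrangian w p -> lagrangian w q ->
  u \in p -> u' \in p -> t \in q -> t' \in q -> u + t \in l -> u' + t' \in l ->
  w u t' = w u' t.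
Proof.
move=> Ll Lp Lq up u'p tq t'q ut ut'; have := lagrangian_iso Ll ut ut'.
rewrite !(formDl w, formDr w) (lagrangian_iso Lp up u'p) (lagrangian_iso Lq tq t'q).
by rewrite add0r addr0 (skewC w t u') => /eqP; rewrite subr_eq0 => /eqP.
Qed.

Lemma semidefinite_graph_cs (s : F) l p q u t u' t' :
  lagrangian w l -> lagrangian w p -> lagrangian w q ->
  (forall v v', v \in p -> v' \in q -> v + v' \in l -> 0 <= s * w v v') ->
  u \in p -> u' \in p -> t \in q -> t' \in q -> u + t \in l -> u' + t' \in l ->
  (s * w u t') ^+ 2 <= (s * w u t) * (s * w u' t').
Proof.
move=> Ll Lp Lq pos up u'p tq t'q ut ut'; apply: cauchy_schwarz_scalar => a b.
have Es := graph_form_sym Ll Lp Lq up u'p tq t'q ut ut'.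
have H0 : a *: u + b *: u' \in p by rewrite rpredD // rpredZ.
have H1 : a *: t + b *: t' \in q by rewrite rpredD // rpredZ.
have H2 : (a *: u + b *: u') + (a *: t + b *: t') \in l.
  by rewrite addrACA -!scalerDr rpredD // rpredZ.
have := pos _ _ H0 H1 H2.
rewrite !(formDl w, formDr w, formZl w, formZr w) -Es.
by congr (0 <= _); ring.
Qed.

(** The difference of the two sides is the graph form of [l'] over [l], evaluated at u + t, whose
    partner in [q] is t' - t. *)
Lemma graph_form_mono (s : F) l l' q u t t' : lagrangian w l -> lagrangian w q ->
  (forall v v', v \in l -> v' \in q -> v + v' \in l' -> 0 <= s * w v v') ->
  t \in q -> t' \in q -> u + t \in l -> u + t' \in l' -> s * w u t <= s * w u t'.
Proof.
move=> Ll Lq pos tq t'q ut ut'; rewrite -subr_ge0.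
have := pos (u + t) (t' - t) ut; rewrite rpredB // (_ : u + t + _ = u + t'); last first.
  by rewrite addrA addrAC -(addrA u) addrAC -addrA subrr addr0.
move=> /(_ isT ut'); rewrite !(formDl w, formDr w, formNr w) (lagrangian_iso Lq tq tq).
rewrite (lagrangian_iso Lq tq t'q); lra.
Qed.

End Triples.

Section ReduceTriples.
Variables (F : rcfType) (O : convexSubring F) (V : vectType F) (w : {skew_symmetric V}).
Variables (n : nat) (e : (n + n).-tuple V) (He : symplectic_basis w e).
Hypothesis nd : nondegenerate w.
Local Notation K := (residue_field O).
Local Notation res := (@residue F O).
Local Notation integral_vec := (integral_vec O e).
Local Notation red := (red O e).
Local Notation reduce := (reduce O He).
Local Notation std := (@std_form K n).
Implicit Types (u v : V) (P Q X Y L : {vspace V}).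

(** If p is not integral, write p = c p' with p' primitive and c outside [O]. Division by c makes
    the sum reduce to 0, so the nonzero vector red p' lies in both reductions. *)
Lemma integral_decomposition P Q p q : transverse (reduce P) (reduce Q) ->
  p \in P -> q \in Q -> integral_vec (p + q) -> integral_vec p /\ integral_vec q.
Proof.
move=> tr pP qQ Opq.
suff Op : integral_vec p.
  by split=> //; rewrite (_ : q = (p + q) - p); [exact: integralB | rewrite addrC addKr].
have [->|p0] := eqVneq p 0; first exact: integral0.
have [c [p' [c0 pE Op' redp']]] := primitive_multiple O He p0.
have [Oc|nOc] := boolP (c \in O); first by rewrite pE; exact: integralZ.
have /residue_infinitesimal[OVc resVc] := notin_convex_inv nOc.
have qE : c^-1 *: q = c^-1 *: (p + q) - p'.
  by rewrite scalerDr pE scalerA mulVf // scale1r addrC addKr.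
have Oq : integral_vec (c^-1 *: q) by rewrite qE; apply: integralB => //; exact: integralZ.
have /eqP[] : red p' != 0 by [].
apply/eqP; rewrite -memv0 -tr memv_cap; apply/andP; split.
  by apply: mem_reduce => //; rewrite (_ : p' = c^-1 *: p) ?rpredZ // pE scalerA mulVf // scale1r.
have -> : red p' = - red (c^-1 *: q).
  rewrite qE redB //; last exact: integralZ.
  by rewrite redZ // resVc scale0r sub0r opprK.
by rewrite rpredN; apply: mem_reduce => //; rewrite rpredZ.
Qed.

(* Lift the vector to x in X. Its component p along P reduces to 0, as red x lies in
   reduce Q; by Cauchy-Schwarz x then pairs infinitesimally with the integral vectors of Y,
   and reduce Y is its own orthogonal. *)
Lemma reduce_meet_mono (s : F) P Q X Y : s = 1 \/ s = -1 ->
    [/\ lagrangian w P, lagrangian w Q, lagrangian w X & lagrangian w Y] ->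
    transverse P Q -> transverse X Q -> transverse (reduce P) (reduce Q) ->
    (forall v v', v \in P -> v' \in Q -> v + v' \in X -> 0 <= s * w v v') ->
    (forall v v', v \in X -> v' \in Q -> v + v' \in Y -> 0 <= s * w v v') ->
  forall x, x \in reduce X -> x \in reduce Q -> x \in reduce Y.
Proof.
move=> s1 [LP LQ LX LY] trPQ trXQ trR posX posXY _ /(reduceP He)[x [xX Ox <-]] xQ.
have dimV := dim_fullV He.
have LRY := reduce_lagrangian O He nd LY.
have sum := lagrangian_sum nd dimV LP LQ trPQ.
have dec v : integral_vec v -> exists p q, [/\ p \in P, q \in Q, v = p + q, integral_vec p & integral_vec q].
  move=> Ov; have /memv_addP[p pP [q qQ vE]] : v \in (P + Q)%VS by rewrite sum memvf.
  have [Op Oq] : integral_vec p /\ integral_vec q.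
    by apply: (integral_decomposition trR) => //; rewrite -vE.
  by exists p, q.
have [p [q [pP qQ xE Op Oq]]] := dec x Ox.
have p0 : red p = 0.
  apply/eqP; rewrite -memv0 -trR memv_cap mem_reduce //=.
  have -> : red p = red x - red q by rewrite xE redD // addrK.
  by rewrite rpredB // mem_reduce.
have xq : red x = red q by rewrite xE redD // p0 add0r.
rewrite xq; apply: (lagrangian_max LRY) => _ /(reduceP He)[y [yY Oy <-]].
have [a [b [aP bQ yE Oa Ob]]] := dec y Oy.
have [t tQ atX] := transverse_graph nd dimV a LX LQ trXQ.
have CS := semidefinite_graph_cs LX LP LQ posX aP pP tQ qQ atX.
rewrite -xE in CS; have {}CS := CS xX.
have mono := graph_form_mono LX LQ posXY tQ bQ atX.
rewrite -yE in mono; have {}mono := mono yY.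
have O_s : s \in O by case: s1 => ->; rewrite ?rpredN ?rpred1.
have Oaq := symplectic_integral He Oa Oq; have Oab := symplectic_integral He Oa Ob.
have Opq := symplectic_integral He Op Oq.
apply: etrans (esym (residue_symplectic He Oq Oy)) _.
have -> : w q y = - w a q.
  by rewrite yE formDr (lagrangian_iso LQ qQ bQ) addr0 skewC.
rewrite residueN // ; apply/eqP; rewrite oppr_eq0 -sqrf_eq0 expr2 -residueM //.
have rpq : res (s * w p q) = 0.
  rewrite residueM // (residue_symplectic He) // p0.
  by rewrite [X in _ * X](linear0l (std : {skew_symmetric _})) mulr0.
have ss : s * s = 1 by case: s1 => ->; rewrite ?mulrNN mulr1.
have le1 : w a q * w a q <= (s * w a b) * (s * w p q).
  apply: (@le_trans _ _ ((s * w a q) ^+ 2)).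
    by rewrite exprMn [s ^+ 2]expr2 ss mul1r expr2.
  apply: le_trans CS _; apply: ler_wpM2r => //.
  by apply: posX => //; rewrite -xE.
rewrite eq_le; apply/andP; split; last first.
  by rewrite -residue0; apply: residue_le; rewrite ?rpred0 ?rpredM // -expr2 sqr_ge0.
have : res (w a q * w a q) <= res ((s * w a b) * (s * w p q)).
  by apply: residue_le => //; rewrite !rpredM.
by rewrite [X in _ <= X -> _]residueM ?rpredM // rpq mulr0.
Qed.

Lemma reduce_maximal L1 L2 L3 : maximal_triple w L1 L2 L3 ->
    transverse (reduce L1) (reduce L2) -> transverse (reduce L2) (reduce L3) ->
    transverse (reduce L1) (reduce L3) ->
  maximal_triple std (reduce L1) (reduce L2) (reduce L3).
Proof.
move=> M tr12 tr23 tr13; have [[LL1 LL2 LL3] [t12 t23 t13] _] := M.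
have dimV := dim_fullV He.
have [ndK _ _] := std_form_psymplectic K n.
have dimK : \dim {:'cV[K]_(n + n)} = (n + n)%N by rewrite dimvf /= /dim /= muln1.
have R1 := reduce_lagrangian O He nd LL1; have R2 := reduce_lagrangian O He nd LL2.
have R3 := reduce_lagrangian O He nd LL3.
split=> //.
have pos x y : x \in reduce L1 -> y \in reduce L3 -> x + y \in reduce L2 -> 0 <= std x y.
  move=> /(reduceP He)[v [v1 Ov <-]] y3 vy2.
  have [t t3 vt2] := transverse_graph nd dimV v LL2 LL3 t23.
  have [Ovt ONt] : integral_vec (v + t) /\ integral_vec (- t).
    by apply: (integral_decomposition tr23) => //; rewrite ?rpredN // addrK.
  have Ot : integral_vec t by rewrite -[t]opprK; exact: integralN.
  have -> : y = red t.
    apply/eqP; rewrite -subr_eq0 -memv0 -tr23 memv_cap; apply/andP; split.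
      have -> : y - red t = (red v + y) - red (v + t) by rewrite redD // opprD addrACA subrr add0r.
      by rewrite rpredB // mem_reduce.
    by rewrite rpredB // mem_reduce.
  rewrite [leRHS](_ : _ = res (w v t)); last exact: esym (residue_symplectic He Ov Ot).
  rewrite -residue0; apply: residue_le; rewrite ?rpred0 //.
    exact: (symplectic_integral He).
  exact: (maximal_triple_ge0 nd dimV M v1 t3 vt2).
move=> x x1 x0; rewrite /triple_form; set y := triple_map _ _ _.
have [y3 xy2] : y \in reduce L3 /\ x + y \in reduce L2.
  by apply/andP; rewrite (triple_mapP x tr23 (lagrangian_sum ndK dimK R2 R3 tr23)).
rewrite lt_neqAle pos // andbT eq_sym; apply: contra x0 => /eqP xy0.
(* By Cauchy-Schwarz an isotropic vector of a semidefinite form lies in its radical; hence [y], the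
   partner of [x], is orthogonal to the Lagrangian [reduce L1]. *)
have y1 : y \in reduce L1.
  apply: (lagrangian_max R1) => x' x'1; rewrite skewC; apply/eqP; rewrite oppr_eq0.
  have [y' y'3 xy'2] := transverse_graph ndK dimK x' R2 R3 tr23.
  have pos1 z z' : z \in reduce L1 -> z' \in reduce L3 -> z + z' \in reduce L2 -> 0 <= 1 * std z z'.
    by rewrite mul1r; exact: pos.
  have := semidefinite_graph_cs R2 R1 R3 pos1 x'1 x1 y'3 y3 xy'2 xy2.
  rewrite !mul1r xy0 mulr0 => h; rewrite -sqrf_eq0; apply/eqP/le_anti.
  by rewrite h sqr_ge0.
have y0 : y = 0 by apply/eqP; rewrite -memv0 -tr13 memv_cap y1 y3.
by rewrite -memv0 -tr12 memv_cap x1; rewrite y0 addr0 in xy2.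
Qed.

End ReduceTriples.

(** * Positive definite forms over an order convex subring *)

Section QuadraticForms.
Variable F : rcfType.

Definition bform m (S : 'M[F]_m) (x y : 'cV[F]_m) : F := (x^T *m S *m y) 0 0.

Definition posdef m (S : 'M[F]_m) := S^T = S /\ forall x, x != 0 -> 0 < bform S x x.

Lemma bformDl m (S : 'M[F]_m) x y z : bform S (x + y) z = bform S x z + bform S y z.
Proof. by rewrite /bform linearD !mulmxDl mxE. Qed.
Lemma bformDr m (S : 'M[F]_m) x y z : bform S z (x + y) = bform S z x + bform S z y.
Proof. by rewrite /bform mulmxDr mxE. Qed.
Lemma bformZl m (S : 'M[F]_m) a x z : bform S (a *: x) z = a * bform S x z.
Proof. by rewrite /bform linearZ /= -!scalemxAl mxE. Qed.
Lemma bformZr m (S : 'M[F]_m) a x z : bform S z (a *: x) = a * bform S z x.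
Proof. by rewrite /bform -scalemxAr mxE. Qed.

Lemma bformC m (S : 'M[F]_m) x y : S^T = S -> bform S x y = bform S y x.
Proof.
move=> SS; rewrite /bform -[x^T *m S *m y]trmxK mxE.
by rewrite !trmx_mul trmxK SS mulmxA.
Qed.

Lemma bform_ge0 m (S : 'M[F]_m) x : posdef S -> 0 <= bform S x x.
Proof.
move=> [_ pos]; have [->|/pos/ltW//] := eqVneq x 0.
by rewrite /bform mulmx0 mxE.
Qed.

Lemma bform_congr m (S T : 'M[F]_m) x y : bform (T^T *m S *m T) x y = bform S (T *m x) (T *m y).
Proof. by rewrite /bform trmx_mul !mulmxA. Qed.

Lemma bform_block m p (A : 'M[F]_m) (D : 'M[F]_p) x y :
  bform (block_mx A 0 0 D) (col_mx x y) (col_mx x y) = bform A x x + bform D y y.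
Proof.
rewrite /bform tr_col_mx mul_row_block !mulmx0 addr0 add0r mul_row_col mxE.
by [].
Qed.

Lemma orthonormal_basis m (S : 'M[F]_m) : posdef S ->
  exists2 T, T \in unitmx & T^T *m S *m T = 1%:M.
Proof.
elim: m S => [|m IH] S; first by exists 1%:M; [exact: unitmx1 | apply/matrixP => -[]].
rewrite -[m.+1]/(1 + m)%N in S *; move=> [SS pos].
pose a := S 0 0; pose b := dlsubmx S; pose C := drsubmx S.
have SE : S = block_mx a%:M b^T b C :> 'M[F]_(1 + m).
  rewrite -[LHS](@submxK _ 1 m 1 m); congr block_mx.
    by apply/matrixP => i j; rewrite !ord1 !mxE /= ?eqxx mulr1n; congr (S _ _); apply: val_inj.
  by rewrite -[in LHS]SS -trmx_dlsub.
have CC : C^T = C by rewrite /C trmx_drsub SS.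
have a0 : 0 < a.
  have e0 : (col_mx (1 : 'cV[F]_1) (0 : 'cV[F]_m)) != 0.
    by apply/eqP => /matrixP/(_ (lshift m 0) 0); rewrite col_mxEu !mxE => /eqP; rewrite oner_eq0.
  have := pos _ e0; rewrite SE /bform tr_col_mx mul_row_block mul_row_col.
  by rewrite !trmx0 !mul0mx !mulmx0 !addr0 trmx1 !mul1mx mulmx1 mxE eqxx mulr1n.
pose r := Num.sqrt a; have r0 : 0 < r by rewrite sqrtr_gt0.
have rr : r ^+ 2 = a by rewrite sqr_sqrtr // ltW.
(* Completing the square: [T1] makes [S] block diagonal, with the Schur complement [C'] as second
   block. *)
pose T1 : 'M[F]_(1 + m) := block_mx 1%:M (- a^-1 *: b^T) 0 1%:M.
pose C' := C - a^-1 *: (b *m b^T).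
have E1 : T1^T *m S *m T1 = block_mx a%:M 0 0 C'.
  have tE : (- a^-1 *: b^T)^T = - a^-1 *: b by rewrite linearZ /= trmxK.
  rewrite SE /T1 tr_block_mx !mulmx_block !trmx1 !trmx0 tE.
  rewrite !(mul1mx, mulmx1, mul0mx, mulmx0, addr0, add0r).
  rewrite -!scalemxAl -!scalemxAr mul_mx_scalar mul_scalar_mx !scalerA.
  rewrite mulNr mulVf ?mulrN ?divff ?gt_eqF // !scaleN1r !addNr mul0mx scaler0 add0r.
  by rewrite /C' addrC scaleNr.
have T1U : T1 \in unitmx.
  by rewrite unitmxE det_ublock !det1 mulr1 unitr1.
have [T' T'U E'] : exists2 T, T \in unitmx & T^T *m C' *m T = 1%:M.
  apply: IH; split.
    by rewrite /C' linearB linearZ /= CC trmx_mul trmxK.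
  move=> y y0; have z0 : T1 *m col_mx 0 y != 0.
    apply: contra y0 => /eqP z0; have : col_mx (0 : 'cV[F]_1) y = 0.
      by rewrite -(mulKmx T1U (col_mx 0 y)) z0 mulmx0.
    by rewrite -[RHS]col_mx0 => /eq_col_mx[_ ->].
  by have := pos _ z0; rewrite -bform_congr E1 bform_block {1}/bform mulmx0 mxE add0r.
pose T2 := block_mx (r^-1)%:M 0 0 T' : 'M[F]_(1 + m).
exists (T1 *m T2).
  by rewrite unitmx_mul T1U unitmxE det_ublock det_scalar unitrM -unitmxE T'U andbT unitfE expr1 invr_eq0 gt_eqF.
have -> : (T1 *m T2)^T *m S *m (T1 *m T2) = T2^T *m (T1^T *m S *m T1) *m T2 by rewrite trmx_mul !mulmxA.
rewrite E1 /T2 tr_block_mx !mulmx_block !trmx0 !(mul0mx, mulmx0, addr0, add0r) E'.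
rewrite tr_scalar_mx -!scalar_mxM -rr expr2 mulrA mulVf ?mul1r ?divff ?gt_eqF //.
by rewrite [RHS](@scalar_mx_block _ 1 m).
Qed.

Variable O : convexSubring F.

Lemma det_integral m (A : 'M[F]_m) : (forall i j, A i j \in O) -> \det A \in O.
Proof.
by move=> OA; rewrite rpred_sum // => s _; rewrite rpredM ?rpred_prod // rpredX // rpredN rpred1.
Qed.

(** In an orthonormal basis of [S] the matrix becomes [B], whose entries have squares at most C. The
    change of basis [T] may fail to be integral, but the determinant does not see it. *)
Lemma bounded_det_integral m (S A : 'M[F]_m) (C : F) : posdef S -> C \in O ->
  (forall x, bform S (A *m x) (A *m x) <= C * bform S x x) -> \det A \in O.
Proof.
move=> /orthonormal_basis[T TU TST] OC AC.
pose B := invmx T *m A *m T.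
have -> : \det A = \det B.
  rewrite !det_mulmx mulrC mulrA -det_mulmx mulmxV // det1 mul1r //.
apply: det_integral => i j.
have one x : bform 1%:M x x = \sum_k x k 0 ^+ 2.
  by rewrite /bform mulmx1 mxE; apply: eq_bigr => k _; rewrite mxE expr2.
pose d : 'cV[F]_m := delta_mx j 0.
have : bform 1%:M (B *m d) (B *m d) <= C.
  have := AC (T *m d).
  have -> : A *m (T *m d) = T *m (B *m d).
    by rewrite /B !mulmxA mulmxV // mul1mx.
  rewrite -!bform_congr TST => /le_trans; apply.
  rewrite one (bigD1 j) //= big1 => [|k kj].
    by rewrite mxE !eqxx expr1n addr0 mulr1.
  by rewrite mxE (negPf kj) expr0n.
rewrite one (bigD1 i) //= /d -colE mxE => le.
apply: convex_sqr; apply: (convex_ge0_le OC); first exact: sqr_ge0.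
apply: le_trans le; rewrite lerDl; apply: sumr_ge0 => k _; exact: sqr_ge0.
Qed.

(** The previous lemma applied to the inverse of [N] shows that det N is a unit of [O]. *)
Lemma expanding_det_unit m (S N : 'M[F]_m) (C : F) : posdef S -> C \in O ->
  (forall i j, N i j \in O) ->
  (forall x, bform S x x <= C * bform S (N *m x) (N *m x)) -> residue O (\det N) != 0.
Proof.
move=> pS OC ON NC.
have NU : N \in unitmx.
  rewrite -unitmx_tr -row_free_unit; apply: inj_row_free => v vN.
  have Nv : N *m v^T = 0 by rewrite -[N]trmxK -trmx_mul vN trmx0.
  have z : bform S 0 0 = 0 by rewrite /bform mulmx0 mxE.
  have := NC v^T; rewrite Nv z mulr0 => h.
  apply/eqP; rewrite -trmx_eq0; apply: contraLR h => v0.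
  by rewrite -ltNge; exact: pS.2.
have Od := det_integral ON.
have OVd : (\det N)^-1 \in O.
  rewrite -det_inv; apply: (bounded_det_integral pS OC) => x.
  by apply: le_trans (NC _) _; rewrite mulmxA mulmxV // mul1mx.
by apply: residue_inv_unit => //; rewrite -unitfE -unitmxE.
Qed.

(** Young's inequality: expand the nonnegative value of the form at x - t y and divide by t. *)
Lemma bform_sub_lower m (S : 'M[F]_m) (t : F) x y : posdef S -> 0 < t ->
  (1 - t) * bform S y y - (t^-1 - 1) * bform S x x <= bform S (x - y) (x - y).
Proof.
move=> pS t0; have := bform_ge0 (x + (- t) *: y) pS.
rewrite -[in X in _ -> X](scaleN1r y) !(bformDl, bformDr, bformZl, bformZr).
rewrite (bformC y x pS.1); set a := bform S x x; set b := bform S x y; set c := bform S y y.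
move=> h; have : 0 <= t^-1 * (a + - t * b + (- t * b + - t * (- t * c))).
  by rewrite mulr_ge0 // ?invr_ge0 ltW // .
have -> : t^-1 * (a + - t * b + (- t * b + - t * (- t * c))) = t^-1 * a - b - b + t * c.
  by field; rewrite gt_eqF.
lra.
Qed.

(* ||(M - z) xi|| >= (|z| - ||M||) ||xi|| on the complexification, with z = a + ib
   and xi = x + iy. *)
Lemma complex_shift_lower m (S M : 'M[F]_m) (C a b : F) x y X Y : posdef S -> 1 <= C ->
    (forall x, (C + 1) * bform S (M *m x) (M *m x) <= C * bform S x x) ->
    1 - (4 * (C + 1))^-1 <= a ^+ 2 + b ^+ 2 ->
    X = M *m x - (a *: x - b *: y) -> Y = M *m y - (a *: y + b *: x) ->
  bform S x x + bform S y y <=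
    ((2 * C + 1) * (4 * (C + 1))) * (bform S X X + bform S Y Y).
Proof.
move=> pS C1 MC ab XE YE.
have C0 : 0 < C by lra.
(* This value makes the lower bound explicit: (1 - t) (1 - 1 / (4 (C + 1))) - (1 / t - 1) C / (C +
   1) equals 1 / ((2 C + 1) 4 (C + 1)). *)
pose t := 2 * C / (2 * C + 1); have t0 : 0 < t by rewrite divr_gt0; lra.
have t1 : 1 - t = (2 * C + 1)^-1 by rewrite /t; field; lra.
have hX := bform_sub_lower (M *m x) (a *: x - b *: y) pS t0.
have hY := bform_sub_lower (M *m y) (a *: y + b *: x) pS t0.
rewrite -XE in hX; rewrite -YE in hY.
have Mx := MC x; have My := MC y.
have E : bform S (a *: x - b *: y) (a *: x - b *: y) + bform S (a *: y + b *: x) (a *: y + b *: x) =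
    (a ^+ 2 + b ^+ 2) * (bform S x x + bform S y y).
  by rewrite -scaleNr !(bformDl, bformDr, bformZl, bformZr) (bformC y x pS.1); ring.
set p := bform S x x + bform S y y in E *.
have p0 : 0 <= p by rewrite addr_ge0 ?bform_ge0.
set qx := bform S (M *m x) (M *m x) in hX Mx; set qy := bform S (M *m y) (M *m y) in hY My.
have q1 : qx + qy <= C / (C + 1) * p.
  rewrite mulrAC ler_pdivlMr; last lra.
  by rewrite /p; lra.
have v1 : t^-1 - 1 = (2 * C)^-1 by rewrite /t; field; lra.
have m1 : (1 - (4 * (C + 1))^-1) * p <= (a ^+ 2 + b ^+ 2) * p by rewrite ler_wpM2r.
have low : (1 - t) * ((1 - (4 * (C + 1))^-1) * p) - (t^-1 - 1) * (C / (C + 1) * p) <= bform S X X + bform S Y Y.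
  have h1 : (1 - t) * ((1 - (4 * (C + 1))^-1) * p) <= (1 - t) * ((a ^+ 2 + b ^+ 2) * p).
    by rewrite ler_wpM2l // t1 invr_ge0; lra.
  have h2 : (t^-1 - 1) * (qx + qy) <= (t^-1 - 1) * (C / (C + 1) * p).
    by rewrite ler_wpM2l // v1 invr_ge0; lra.
  rewrite -E in h1; lra.
have K0 : 0 < (2 * C + 1) * (4 * (C + 1)) by rewrite mulr_gt0; lra.
rewrite -(ler_pM2l K0) in low; apply: le_trans low.
rewrite t1 v1 [leRHS](_ : _ = p) //; field; lra.
Qed.

(** The matrix is (M - z) (M - conj z) with z = a + i b. Each factor expands the form up to a
    constant of [O], so the determinant is a unit. *)
Lemma resolvent_unit m (S M : 'M[F]_m) (C a b : F) : posdef S -> C \in O -> 1 <= C ->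
    (forall i j, M i j \in O) ->
    (forall x, (C + 1) * bform S (M *m x) (M *m x) <= C * bform S x x) ->
    a \in O -> b \in O -> 1 <= residue O a ^+ 2 + residue O b ^+ 2 ->
  residue O (\det ((M - a%:M) *m (M - a%:M) + (b ^+ 2)%:M)) != 0.
Proof.
move=> pS OC C1 OM MC Oa Ob ab1.
have C0 : 0 < C by lra.
have Om : a ^+ 2 + b ^+ 2 \in O by rewrite rpredD ?rpredX.
(* |z| >= 1 is known only after reduction, so |z|^2 may fall short of 1 by an infinitesimal. The
   tolerance 1 / (4 (C + 1)) has its inverse in [O], so it exceeds every infinitesimal. *)
have ab : 1 - (4 * (C + 1))^-1 <= a ^+ 2 + b ^+ 2.
  rewrite leNgt; apply/negP => h; set i := 1 - (a ^+ 2 + b ^+ 2).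
  have i0 : (4 * (C + 1))^-1 < i by rewrite /i; lra.
  have d0 : 0 < (4 * (C + 1))^-1 by rewrite invr_gt0; lra.
  have Oi : i \in O by rewrite rpredB ?rpred1.
  have i1 : 0 < i by lra.
  have Vi : i^-1 \in O.
    apply: (@convex_ge0_le _ _ _ (4 * (C + 1))); first by rewrite rpredM ?rpred_nat ?rpredD ?rpred1.
      by rewrite invr_ge0 ltW.
    by rewrite -[leRHS]invrK lef_pV2 ?posrE // ltW.
  have := residue_inv_unit Oi Vi (lt0r_neq0 i1).
  have : 0 <= residue O i by rewrite -(residue0 O); apply: residue_le; rewrite ?rpred0 // ltW.
  rewrite /i residueB ?rpred1 // residue1 residueD ?rpredX // !expr2 !residueM // -!expr2 => h1 h2.
  by move: h1; rewrite subr_ge0 => h1; move: h2; rewrite subr_eq0 eq_le h1 ab1.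
pose E := (2 * C + 1) * (4 * (C + 1)).
have OE : E \in O by rewrite rpredM // ?rpredD ?rpredM ?rpred_nat ?rpredD ?rpred1.
apply: (@expanding_det_unit _ S _ (E * E) pS).
- exact: rpredM.
- move=> i j; have Ma k l : (M - a%:M) k l \in O.
    by rewrite !mxE rpredB // rpredMn.
  rewrite mxE rpredD //; first by rewrite mxE rpred_sum // => k _; rewrite rpredM.
  by rewrite mxE rpredMn // rpredX.
- move=> x; have E0 : 0 <= E by rewrite mulr_ge0; lra.
  (* The shift by z is applied to the real vector x, then the shift by the conjugate to the result;
     the imaginary part of the outcome vanishes. *)
  have h1 := complex_shift_lower (x := x) (y := 0) pS C1 MC ab (erefl _) (erefl _).
  have abN : 1 - (4 * (C + 1))^-1 <= a ^+ 2 + (- b) ^+ 2 by rewrite sqrrN.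
  pose X := (M - a%:M) *m x; pose Y := - (b *: x).
  have h2 := complex_shift_lower (x := X) (y := Y) pS C1 MC abN (erefl _) (erefl _).
  have z : bform S (0 : 'cV[F]_m) (0 : 'cV[F]_m) = 0 by rewrite /bform mulmx0 mxE.
  move: h1 h2 => /=; rewrite !(scaler0, subr0, addr0, add0r, mulmx0, sub0r) z !(addr0, add0r).
  have -> : M *m x - a *: x = X by rewrite /X mulmxBl mul_scalar_mx.
  rewrite -/Y.
  have -> : M *m X - (a *: X - - b *: Y) = ((M - a%:M) *m (M - a%:M) + (b ^+ 2)%:M) *m x.
    rewrite mulmxDl mul_scalar_mx -mulmxA -/X mulmxBl mul_scalar_mx /Y.
    by rewrite scalerN scaleNr opprK opprD opprK scalerA -expr2 addrA.
  have -> : M *m Y - (a *: Y + - b *: X) = 0.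
    rewrite /Y /X mulmxBl mul_scalar_mx mulmxN -scalemxAr scalerN scaleNr scalerBr !scalerA.
    by rewrite [b * a]mulrC opprB opprK subrK addNr.
  rewrite z addr0 => h1 h2; apply: le_trans h1 _.
  by apply: le_trans (ler_wpM2l E0 h2) _; rewrite [leLHS]mulrA.
Qed.

End QuadraticForms.

(** * Bounds in [O] from Cayley-Hamilton *)

Section CayleyHamiltonBound.
Variables (F : rcfType) (O : convexSubring F).

Lemma char_poly_integral m (A : 'M[F]_m) i : (forall j k, A j k \in O) -> (char_poly A)`_i \in O.
Proof.
move=> OA; pose A' : 'M[convex_ring O]_m := map_mx (insubd 0) A.
have -> : A = map_mx val A' by apply/matrixP => j k; rewrite !mxE insubdK.
by rewrite -map_char_poly coef_map; exact: valP.
Qed.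

Lemma bform_sum_le m (S : 'M[F]_m) k (y : 'I_k -> 'cV[F]_m) : posdef S ->
  bform S (\sum_i y i) (\sum_i y i) <= 2 ^+ k * \sum_i bform S (y i) (y i).
Proof.
move=> pS; have add2 u v : bform S (u + v) (u + v) <= 2 * bform S u u + 2 * bform S v v.
  have := bform_ge0 (u + (-1) *: v) pS.
  rewrite !(bformDl, bformDr, bformZl, bformZr) (bformC v u pS.1); lra.
elim: k y => [|k IH] y; first by rewrite !big_ord0 /bform mulmx0 mxE mulr0.
rewrite !big_ord_recl; apply: le_trans (add2 _ _) _; rewrite mulrDr exprS.
apply: lerD; last by rewrite -mulrA ler_wpM2l //; exact: IH.
rewrite ler_wpM2r ?bform_ge0 // ler_peMr // exprn_ege1 //; lra.
Qed.

Lemma horner_mx_sum m (A : 'M[F]_m.+1) p : horner_mx A p = \sum_(i < size p) p`_i *: A ^+ i.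
Proof.
rewrite -{1}[p]coefK poly_def rmorph_sum; apply: eq_bigr => i _.
by rewrite /= linearZ /= rmorphXn /= horner_mx_X.
Qed.

(* By Cayley-Hamilton M^m x is an integral combination of the M^i x, i < m, and the
   latter have increasing norms. *)
Lemma expanding_bounded m (S M : 'M[F]_m) : posdef S -> (forall i j, M i j \in O) ->
    (forall x, bform S x x <= bform S (M *m x) (M *m x)) ->
  exists C, [/\ C \in O, 1 <= C & forall x, bform S (M *m x) (M *m x) <= C * bform S x x].
Proof.
case: m S M => [|m] S M pS OM incr.
  exists 1; split=> [||x]; rewrite ?rpred1 //.
  by rewrite (_ : M *m x = x) ?mul1r //; apply/matrixP => -[].
pose c i := (char_poly M)`_i; pose C := 1 + 2 ^+ m.+1 * \sum_(i < m.+1) c i ^+ 2.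
have s0 : 0 <= \sum_(i < m.+1) c i ^+ 2 by apply: sumr_ge0 => i _; exact: sqr_ge0.
have p0 : 0 <= 2 ^+ m.+1 :> F by rewrite exprn_ge0.
exists C; split.
- rewrite rpredD ?rpred1 // rpredM ?rpredX ?rpred_nat // rpred_sum // => i _.
  by rewrite rpredX // char_poly_integral.
- by rewrite lerDl mulr_ge0.
move=> x.
have MU : M \in unitmx.
  rewrite -unitmx_tr -row_free_unit; apply: inj_row_free => v vM.
  have Mv : M *m v^T = 0 by rewrite -[M]trmxK -trmx_mul vM trmx0.
  have := incr v^T; rewrite Mv {2}/bform mulmx0 mxE => h.
  apply/eqP; rewrite -trmx_eq0; apply: contraLR h => v0.
  by rewrite -ltNge; exact: pS.2.
have MmU : M ^+ m \in unitmx by rewrite -[_ \in _]/(M ^+ m \is a GRing.unit) unitrX.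
(* The matrix has size m + 1. With x = M^m y, the relation for M^(m+1) y = M x involves only the M^i
   y with i <= m, whose norms are at most that of x. *)
pose y := invmx (M ^+ m) *m x.
have xE : x = M ^+ m *m y by rewrite mulKVmx.
have mono i k : (i <= k)%N ->
    bform S (M ^+ i *m y) (M ^+ i *m y) <= bform S (M ^+ k *m y) (M ^+ k *m y).
  elim: k => [|k IH]; first by rewrite leqn0 => /eqP->.
  rewrite leq_eqVlt ltnS => /predU1P[->//|/IH/le_trans]; apply.
  by rewrite exprS -mulmxA; exact: incr.
have -> : M *m x = - \sum_(i < m.+1) c i *: (M ^+ i *m y).
  have := Cayley_Hamilton M; rewrite horner_mx_sum size_char_poly big_ord_recr /=.
  have := monicP (char_poly_monic M); rewrite lead_coefE size_char_poly /= => ->.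
  rewrite scale1r addrC => /eqP; rewrite addr_eq0 => /eqP E.
  rewrite xE mulmxA -[M *m _]/(M * M ^+ m) -exprS E mulNmx mulmx_suml.
  by congr (- _); apply: eq_bigr => i _; rewrite scalemxAl.
rewrite -scaleN1r bformZl bformZr mulrA mulrNN mulr1 mul1r.
apply: le_trans (bform_sum_le _ pS) _.
apply: (@le_trans _ _ (2 ^+ m.+1 * \sum_(i < m.+1) c i ^+ 2 * bform S x x)).
  rewrite ler_wpM2l //; apply: ler_sum => i _.
  by rewrite bformZl bformZr mulrA -expr2 ler_wpM2l ?sqr_ge0 // [in leRHS]xE mono // -ltnS.
by rewrite -mulr_suml mulrA ler_wpM2r ?bform_ge0 // lerDr.
Qed.

End CayleyHamiltonBound.

(** * Transfer of the matrix estimates to subspaces *)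

Section FormsOnSubspaces.
Variables (F : rcfType) (O : convexSubring F) (V : vectType F) (w : {skew_symmetric V}).
Variables (n : nat) (e : (n + n).-tuple V) (He : symplectic_basis w e).
Local Notation K := (residue_field O).
Local Notation integral_vec := (integral_vec O e).
Local Notation red := (red O e).
Local Notation reduce := (reduce O He).
Local Notation red_lfun := (red_lfun O e).

(** [B] is a bare function on [V], constrained on [L] only: the forms of triples are bilinear on all
    of [V] but symmetric only on a subspace. Linearity on the right comes from symmetry. *)
Definition pos_form_on (L : {vspace V}) (B : V -> V -> F) :=
  [/\ forall a u v x, u \in L -> v \in L -> x \in L -> B (a *: u + v) x = a * B u x + B v x,
      {in L &, forall u v, B u v = B v u} &
      forall u, u \in L -> u != 0 -> 0 < B u u].

Section Coordinates.
Variables (L : {vspace V}) (B : V -> V -> F) (g : 'End(V)).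
Hypotheses (posB : pos_form_on L B) (Og : integral_in O e g) (gL : forall u, u \in L -> g u \in L).
Variables (f : 'I_(\dim L) -> 'I_(n + n)) (b : (\dim L).-tuple V).
Hypotheses (bL : basis_of L b) (fb : forall j k, coord e (f j) (tnth b k) = (j == k)%:R).
Hypotheses (Ob : forall k, integral_vec (tnth b k)) (redL : reduce L = <<[seq red v | v <- b]>>%VS).
Local Notation m := (\dim L).

Let iota (x : 'cV[F]_m) : V := \sum_k x k 0 *: tnth b k.
(** The coordinates in [b] of a vector of [L] are read off at the rows [f]; this is why the matrix
    [M] of [g] on [L] is integral. *)
Let kappa (u : V) : 'cV[F]_m := \col_j coord e (f j) u.

Let bmem k : tnth b k \in L. Proof. by rewrite (basis_mem bL) // mem_tnth. Qed.

Let iota_mem x : iota x \in L.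
Proof. by rewrite rpred_sum // => k _; rewrite rpredZ. Qed.

Let kappaK u : u \in L -> iota (kappa u) = u.
Proof.
move=> uL; have uE : u = \sum_k coord b k u *: tnth b k.
  by rewrite {1}(coord_basis bL uL); apply: eq_bigr => k _; rewrite -tnth_nth.
rewrite [RHS]uE; apply: eq_bigr => k _; congr (_ *: _).
rewrite mxE [in LHS]uE linear_sum /= (bigD1 k) //= big1 => [|j /negPf jk].
  by rewrite linearZ /= fb eqxx mulr1 addr0.
by rewrite linearZ /= fb eq_sym jk mulr0.
Qed.

Let S : 'M[F]_m := \matrix_(j, k) B (tnth b j) (tnth b k).
Let M : 'M[F]_m := \matrix_(j, k) coord e (f j) (g (tnth b k)).

Let OM j k : M j k \in O.
Proof. by rewrite mxE; have := integral_map He Og (Ob k); exact. Qed.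

Let iotaM x : iota (M *m x) = g (iota x).
Proof.
rewrite /iota linear_sum /=.
under [RHS]eq_bigr => k _ do rewrite linearZ /= -(kappaK (gL (bmem k))) scaler_sumr.
rewrite exchange_big /=; apply: eq_bigr => j _; rewrite mxE scaler_suml.
by apply: eq_bigr => k _; rewrite scalerA !mxE mulrC.
Qed.

Let B0l x : x \in L -> B 0 x = 0.
Proof.
have [lin _ _] := posB; move=> xL; have := lin 1 0 0 x (mem0v _) (mem0v _) xL.
by rewrite scaler0 addr0 mul1r => /eqP; rewrite -subr_eq subrr eq_sym => /eqP.
Qed.

Let B_suml (I : finType) (c : I -> F) (u : I -> V) x : x \in L -> (forall i, u i \in L) ->
  B (\sum_i c i *: u i) x = \sum_i c i * B (u i) x.
Proof.
have [lin _ _] := posB; move=> xL uL.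
suff [] : \sum_i c i *: u i \in L /\ B (\sum_i c i *: u i) x = \sum_i c i * B (u i) x by [].
elim/big_rec2: _ => [|i y1 y2 _ [yL <-]]; first by rewrite B0l // mem0v.
by rewrite rpredD ?rpredZ // lin.
Qed.

Let BE x y : B (iota x) (iota y) = bform S x y.
Proof.
have [_ sym _] := posB; rewrite B_suml ?iota_mem // /bform mxE.
under eq_bigr => j _ do rewrite sym ?iota_mem // B_suml ?iota_mem // mulr_sumr.
rewrite exchange_big; apply: eq_bigr => k _; rewrite mxE mulr_suml.
by apply: eq_bigr => j _; rewrite !mxE mulrA mulrAC sym // mulrC !mulrA.
Qed.

Let posS : posdef S.
Proof.
have [_ sym pos] := posB; split; first by apply/matrixP => j k; rewrite !mxE sym.
move=> x x0; rewrite -BE pos //; apply: contra x0 => /eqP ix0.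
apply/eqP/colP => j; rewrite mxE -(linear0 (coord e (f j))) -ix0 linear_sum /=.
rewrite (bigD1 j) //= big1 => [|k /negPf kj]; first by rewrite linearZ /= fb eqxx mulr1 addr0.
by rewrite linearZ /= fb eq_sym kj mulr0.
Qed.

Lemma expanding_bounded_coord : (forall u, u \in L -> B u u <= B (g u) (g u)) ->
  exists C, [/\ C \in O, 1 <= C & forall u, u \in L -> B (g u) (g u) <= C * B u u].
Proof.
move=> incr; have [|C [OC C1 CP]] := expanding_bounded posS OM.
  by move=> x; rewrite -!BE iotaM incr.
by exists C; split=> // u uL; rewrite -(kappaK uL) -iotaM !BE.
Qed.

(** In the reduced basis, (g - a)^2 + c^2 acts on [reduce L] by the reduction of the resolvent
    matrix of [M], which has nonzero determinant by [resolvent_unit]. *)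
Lemma resolvent_coord (C : F) (a c : K) (x : 'cV[K]_(n + n)) : C \in O -> 1 <= C ->
    (forall u, u \in L -> (C + 1) * B (g u) (g u) <= C * B u u) ->
    1 <= a ^+ 2 + c ^+ 2 -> x \in reduce L ->
    let d y := red_lfun g y - a *: y in d (d x) + c ^+ 2 *: x = 0 ->
  x = 0.
Proof.
move=> OC C1 contr ac xL d dx.
have [a' OA aE] := residue_surj a; have [c' OC' cE] := residue_surj c.
have contrM y : (C + 1) * bform S (M *m y) (M *m y) <= C * bform S y y.
  by rewrite -!BE iotaM contr.
have := resolvent_unit posS OC C1 OM contrM OA OC'; rewrite aE cE => /(_ ac).
(* [M] with its entries typed in [O]: there reduction is a ring morphism and commutes with the
   determinant. *)
pose M' : 'M[convex_ring O]_m := map_mx (insubd 0) M.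
have MM' : M = map_mx val M' by apply/matrixP => j k; rewrite [RHS]mxE [X in val X]mxE insubdK //; exact: OM.
pose N' := (M' - (ConvexRing OA)%:M) *m (M' - (ConvexRing OA)%:M) + (ConvexRing OC' ^+ 2)%:M.
have -> : (M - a'%:M) *m (M - a'%:M) + (c' ^+ 2)%:M = map_mx val N'.
  by rewrite /N' map_mxD map_mxM map_mxB -MM' !map_scalar_mx.
rewrite det_map_mx /residue valKd -det_map_mx.
pose Mb := map_mx (@residue_class F O) M'.
have -> : map_mx (@residue_class F O) N' = (Mb - a%:M) *m (Mb - a%:M) + (c ^+ 2)%:M.
  rewrite /N' map_mxD map_mxM map_mxB !map_scalar_mx /=.
  have aE' : residue_class (ConvexRing OA) = a by rewrite -residueE.
  have cE' : residue_class (ConvexRing OC') = c by rewrite -residueE.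
  by rewrite rmorphXn /= aE' cE'.
rewrite -unitfE -unitmxE; set N := (X in X \in _) => NU.
pose iotab (y : 'cV[K]_m) : 'cV[K]_(n + n) := \sum_k y k 0 *: red (tnth b k).
have iotabD y z : iotab (y + z) = iotab y + iotab z.
  by rewrite /iotab -big_split; apply: eq_bigr => k _; rewrite mxE scalerDl.
have iotabZ l y : iotab (l *: y) = l *: iotab y.
  by rewrite /iotab scaler_sumr; apply: eq_bigr => k _; rewrite mxE scalerA.
have iotab_inj y : iotab y = 0 -> y = 0.
  move=> y0; apply/colP => j; rewrite [RHS]mxE.
  transitivity (iotab y (f j) 0); last by rewrite y0 mxE.
  rewrite summxE (bigD1 j) //= big1 => [|k /negPf kj].
    by rewrite !mxE fb eqxx residue1 mulr1 addr0.
  by rewrite !mxE fb eq_sym kj residue0 mulr0.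
have iotabM y : iotab (Mb *m y) = red_lfun g (iotab y).
  rewrite /iotab linear_sum /=.
  transitivity (\sum_k y k 0 *: \sum_j Mb j k *: red (tnth b j)).
    under [RHS]eq_bigr => k _ do rewrite scaler_sumr.
    rewrite exchange_big /=; apply: eq_bigr => j _; rewrite mxE scaler_suml.
    by apply: eq_bigr => k _; rewrite scalerA mulrC.
  apply: eq_bigr => k _; rewrite linearZ /= (red_lfunE He) //; congr (_ *: _).
  have Ogk := integral_map He Og (Ob k).
  have Oc j : integral_vec (kappa (g (tnth b k)) j 0 *: tnth b j).
    by apply: integralZ => //; rewrite mxE.
  rewrite -[in RHS](kappaK (gL (bmem k))).
  have [_ ->] := integral_sum Oc; apply: eq_bigr => j _.
  rewrite redZ //; last by rewrite mxE.
  congr (_ *: _); rewrite mxE /M' mxE -/(residue O _); congr (residue O _).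
  by rewrite !mxE.
have [y xE] : exists y, x = iotab y.
  move: xL; rewrite redL -[map _ _]/(tval (map_tuple red b)) => /coord_span xE.
  exists (\col_k coord (map_tuple red b) k x); rewrite {1}xE; apply: eq_bigr => k _.
  by rewrite mxE -tnth_nth tnth_map.
have dE z : d (iotab z) = iotab ((Mb - a%:M) *m z).
  by rewrite /d mulmxBl mul_scalar_mx -[in RHS]scaleNr iotabD iotabZ iotabM scaleNr.
move: dx; rewrite xE !dE -iotabZ -iotabD => /iotab_inj Ny.
have {}Ny : N *m y = 0 by rewrite mulmxDl mul_scalar_mx -mulmxA.
by rewrite -(mulKmx NU y) Ny mulmx0 /iotab big1 // => k _; rewrite mxE scale0r.
Qed.
End Coordinates.

Lemma expanding_bounded_on L B (g : 'End(V)) : pos_form_on L B -> integral_in O e g ->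
    (forall u, u \in L -> g u \in L) -> (forall u, u \in L -> B u u <= B (g u) (g u)) ->
  exists C, [/\ C \in O, 1 <= C & forall u, u \in L -> B (g u) (g u) <= C * B u u].
Proof.
have [f [b [bL fb Ob _]]] := reduce_basis O He L.
by move=> posB Og gL; exact: (expanding_bounded_coord posB Og gL bL fb Ob).
Qed.

Lemma contracting_resolvent_on L B (g : 'End(V)) (C : F) (a c : K) (x : 'cV[K]_(n + n)) :
    pos_form_on L B -> integral_in O e g -> (forall u, u \in L -> g u \in L) ->
    C \in O -> 1 <= C -> (forall u, u \in L -> (C + 1) * B (g u) (g u) <= C * B u u) ->
    1 <= a ^+ 2 + c ^+ 2 -> x \in reduce L ->
    red_lfun g (red_lfun g x - a *: x) - a *: (red_lfun g x - a *: x) + c ^+ 2 *: x = 0 ->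
  x = 0.
Proof.
have [f [b [bL fb Ob redL]]] := reduce_basis O He L.
move=> posB Og gL OC C1 contr ac xL; exact: (resolvent_coord posB Og gL bL fb Ob redL OC C1 contr ac xL).
Qed.

End FormsOnSubspaces.

(** * Contraction *)

Section Collar.
Variables (F : rcfType) (O : convexSubring F) (V : vectType F) (w : {skew_symmetric V}).
Variables (n : nat) (e : (n + n).-tuple V) (He : symplectic_basis w e).
Hypothesis nd : nondegenerate w.
Implicit Types (L : {vspace V}) (u v s t : V) (g h : 'End(V)).

Let dimV := dim_fullV He.

Lemma triple_map_graph L2 L3 u : lagrangian w L2 -> lagrangian w L3 -> transverse L2 L3 ->
  triple_map L2 L3 u \in L3 /\ u + triple_map L2 L3 u \in L2.
Proof.
move=> LL2 LL3 tr; apply/andP.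
by rewrite (triple_mapP u tr (lagrangian_sum nd dimV LL2 LL3 tr)).
Qed.

Lemma triple_map_unique L2 L3 u t : lagrangian w L2 -> lagrangian w L3 -> transverse L2 L3 ->
  t \in L3 -> u + t \in L2 -> t = triple_map L2 L3 u.
Proof.
move=> LL2 LL3 tr t3 ut; apply/eqP.
by rewrite -(triple_mapP u tr (lagrangian_sum nd dimV LL2 LL3 tr)) t3 ut.
Qed.

Lemma triple_mapD L2 L3 a u v :
  triple_map L2 L3 (a *: u + v) = a *: triple_map L2 L3 u + triple_map L2 L3 v.
Proof. by rewrite /triple_map linearP opprD scalerN. Qed.

Lemma triple_pos_form L1 L2 L3 : maximal_triple w L1 L2 L3 ->
  pos_form_on L1 (fun u v => w u (triple_map L2 L3 v)).
Proof.
move=> M; have [[LL1 LL2 LL3] [_ tr23 _] _] := M.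
have G u := triple_map_graph u LL2 LL3 tr23.
split=> [a u v x uL vL xL|u v uL vL|u uL u0].
- by rewrite formDl formZl.
- by apply: (graph_form_sym LL2 LL1 LL3) => //; have [] := G u; have [] := G v.
- by apply: (maximal_triple_gt0 nd dimV M) => //; have [] := G u.
Qed.

(** The form of the triple transported from [L1] to [L3]. Applied to the triple (b+, a+, b-), it
    yields the form on the value of the framing at b-. *)
Lemma triple_pos_form_swap L1 L2 L3 : maximal_triple w L1 L2 L3 ->
  pos_form_on L3 (fun u v => w (triple_map L2 L1 u) v).
Proof.
move=> M; have [[LL1 LL2 LL3] [tr12 _ _] _] := M.
have tr21 : transverse L2 L1 by rewrite /transverse capvC.
have G u := triple_map_graph u LL2 LL1 tr21.
split=> [a u v x uL vL xL|u v uL vL|u uL u0].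
- by rewrite triple_mapD formDl formZl.
- rewrite skewC (skewC w (triple_map _ _ v)); congr (- _).
  by apply: (graph_form_sym LL2 LL3 LL1) => //; have [] := G u; have [] := G v.
- have [t1 ut] := G u; apply: (maximal_triple_gt0 nd dimV M) => //; first by rewrite addrC.
  apply: contra u0 => /eqP t0; rewrite t0 addr0 in ut.
  have [_ [_ tr23 _] _] := M.
  by rewrite -memv0 -tr23 memv_cap ut.
Qed.

(* In the application the subspaces are the values of the framing at points of the circle
   in the cyclic order Bm, Am, Bp, X1, X2, Ap: Bm, Bp are fixed by h, Am, Ap are fixed by g,
   X1 = h Ap and g X2 = Bp. *)
Section Config.
Variables Bm Am Bp X1 X2 Ap : {vspace V}.
Variables g h : 'End(V).
Hypotheses (M1 : maximal_triple w Am Bp Ap) (M2 : maximal_triple w Bp X2 Ap)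
  (M3 : maximal_triple w Ap Bm Am)
  (M5 : maximal_triple w Bp X1 X2).
Hypotheses (gw : forall u v, w (g u) (g v) = w u v) (Og : integral_in O e g)
  (gAm : forall u, u \in Am -> g u \in Am) (gAp : forall u, u \in Ap -> g u \in Ap)
  (gX2 : forall u, u \in X2 -> g u \in Bp).
Hypotheses (hw : forall u v, w (h u) (h v) = w u v)
  (hBm : forall u, u \in Bm -> h u \in Bm) (hBp : forall u, u \in Bp -> h u \in Bp)
  (hAp : forall u, u \in Ap -> h u \in X1).

Let LAm : lagrangian w Am. Proof. by case: M1 => -[]. Qed.
Let LBp : lagrangian w Bp. Proof. by case: M1 => -[]. Qed.
Let LAp : lagrangian w Ap. Proof. by case: M1 => -[]. Qed.
Let LX2 : lagrangian w X2. Proof. by case: M2 => -[]. Qed.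
Let trBpAp : transverse Bp Ap. Proof. by case: M1 => _ []. Qed.
Let trAmAp : transverse Am Ap. Proof. by case: M1 => _ []. Qed.
Let trX2Ap : transverse X2 Ap. Proof. by case: M2 => _ []. Qed.
Let trX2Bp : transverse X2 Bp. Proof. by case: M2 => _ []; rewrite /transverse capvC. Qed.

Let mono s t t' : t \in Ap -> t' \in Ap -> s + t \in Bp -> s + t' \in X2 -> w s t <= w s t'.
Proof.
move=> tA t'A st st'.
have := @graph_form_mono _ _ w 1 Bp X2 Ap s t t' LBp LAp.
rewrite !mul1r; apply=> // v v' vB v'A vv'; rewrite mul1r.
exact: (maximal_triple_ge0 nd dimV M2 vB v'A vv').
Qed.

(** Write P(s) = w s t and R(s) = w s t' for the graph forms of [Bp] and [X2] over [Am]. As [g]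
    carries [X2] to [Bp], R(s) = P(g s); and P <= R by maximality. So [g] expands P on [Am], and
    integrality bounds the expansion. *)
Lemma graph_form_bounded : exists C, [/\ C \in O, 1 <= C &
  forall s t t', s \in Am -> t \in Ap -> t' \in Ap -> s + t \in Bp -> s + t' \in X2 ->
    w s t' <= C * w s t].
Proof.
have posP := triple_pos_form M1.
have gE s t' : s \in Am -> t' \in Ap -> s + t' \in X2 -> w (g s) (triple_map Bp Ap (g s)) = w s t'.
  move=> sA t'A st'; rewrite -(triple_map_unique LBp LAp trBpAp (gAp t'A)) ?gw //.
  by rewrite -linearD gX2.
have [|C [OC C1 CP]] := expanding_bounded_on He posP Og gAm.
  move=> s sA; have [t'A st'] := triple_map_graph s LX2 LAp trX2Ap.
  have [tA st] := triple_map_graph s LBp LAp trBpAp.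
  by rewrite (gE _ _ sA t'A st'); apply: mono.
exists C; split=> // s t t' sA tA t'A st st'.
by rewrite (triple_map_unique LBp LAp trBpAp tA st) -(gE _ _ sA t'A st'); exact: CP.
Qed.

(** Put q(u) = w t u for u in [Bm], with t in [Bp] and u + t in [Ap]. Applying [h] to both arguments
    turns q(u) into the value at y = h u of the same form with [X1] in place of [Ap]. Since [X2]
    separates [X1] from [Ap], the claim follows from a gap between the forms of [X2] and [Ap], which
    is derived from P <= R <= C P. *)
Lemma collar_contraction : exists C, [/\ C \in O, 1 <= C & forall u, u \in Bm ->
  (C + 1) * w (triple_map Ap Bp (h u)) (h u) <= C * w (triple_map Ap Bp u) u].
Proof.
have [C [OC C1 RP]] := graph_form_bounded.
exists C; split=> // u uB.
have trApBp : transverse Ap Bp by rewrite /transverse capvC.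
have [t1uB ut1u] := triple_map_graph u LAp LBp trApBp.
set t1u := triple_map Ap Bp u in t1uB ut1u *.
set y := h u; have yB : y \in Bm by exact: hBm.
have [t1B yt1] := triple_map_graph y LAp LBp trApBp.
set t1 := triple_map Ap Bp y in t1B yt1 *.
have [t2 t2B yt2] := transverse_graph nd dimV y LX2 LBp trX2Bp.
pose t3 := h t1u; have t3B : t3 \in Bp by exact: hBp.
have yt3 : y + t3 \in X1 by rewrite -linearD; exact: hAp.
rewrite -[w t1u u]hw -/y -/t3.
(* The form of [X1] dominates that of [X2], by maximality of (Bp, X1, X2). *)
have step1 : w t2 y <= w t3 y.
  have := maximal_triple_ge0 nd dimV M5 (u := t3 - t2) (t := y + t2).
  rewrite rpredB // yt2 (_ : t3 - t2 + (y + t2) = y + t3); last first.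
    by rewrite addrCA subrK.
  move=> /(_ isT isT yt3).
  rewrite !(formDl w, formDr w, formNl w) (lagrangian_iso LBp t3B t2B) skewvv; lra.
have Ap_sum := lagrangian_sum nd dimV LAm LAp trAmAp.
have decomp v : exists vm vp, [/\ vm \in Am, vp \in Ap & v = vm + vp].
  have /memv_addP[vm vmA [vp vpA vE]] : v \in (Am + Ap)%VS by rewrite Ap_sum memvf.
  by exists vm, vp.
pose v := y + t1; pose d := t1 - t2.
have vA : v \in Ap by [].
have dB : d \in Bp by rewrite rpredB.
have [dm [dp [dmA dpA dE]]] := decomp d.
have [tm [tp [tmA tpA tE]]] := decomp t1.
have [r rA tmr] := transverse_graph nd dimV tm LX2 LAp trX2Ap.
(* [dm] has partner [dp] in the graph of [Bp] and [dp - v] in the graph of [X2]; so R - P pairs [dm]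
   with any s of [Am] to - w s v. *)
have gP : dm + dp \in Bp by rewrite -dE.
have gR : dm + (dp - v) \in X2.
  rewrite addrA -dE; have -> : d - v = - (y + t2) by rewrite /d /v opprD [- y - t1]addrC addrACA subrr add0r -opprD [t2 + y]addrC.
  by rewrite rpredN.
have tP : tm + tp \in Bp by rewrite -tE.
have dvA : dp - v \in Ap by rewrite rpredB.
have qy : w t1 y = w tm v.
  have -> : w t1 y = w t1 v by rewrite /v formDr skewvv addr0.
  by rewrite tE formDl (lagrangian_iso LAp tpA vA) addr0.
have yd : w y d = - w dm v.
  have -> : w y d = w v d by rewrite /v formDl (lagrangian_iso LBp t1B dB) addr0.
  by rewrite dE formDr (lagrangian_iso LAp vA dpA) addr0 skewC.
(* P(tm) <= q(y): the difference is the form of the triple (Ap, Bm, Am) at tp - v, whose partner is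
   tm. *)
have qP : w tm tp <= w t1 y.
  have := maximal_triple_ge0 nd dimV M3 (u := tp - v) (t := tm).
  have -> : tp - v + tm = - y.
    by rewrite addrAC [tp + tm]addrC -tE /v opprD addrCA subrr addr0.
  rewrite rpredB // tmA rpredN yB => /(_ isT isT isT).
  rewrite formDl formNl (skewC w tp) (skewC w v) qy; lra.
(* Cauchy-Schwarz for the semidefinite form R - P at [tm] and [dm]. The mixed term is - q(y), the
   value at [dm] is w y d, and the value at [tm] is at most C q(y) by [fR]. Division by q(y) gives
   [step2]. *)
have CS : (- w tm v) ^+ 2 <= (w tm (r - tp)) * (- w dm v).
  apply: cauchy_schwarz_scalar => a b.
  have h1 : a *: tp + b *: dp \in Ap by rewrite rpredD ?rpredZ.
  have h2 : a *: r + b *: (dp - v) \in Ap by rewrite rpredD ?rpredZ.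
  have h3 : (a *: tm + b *: dm) + (a *: tp + b *: dp) \in Bp.
    by rewrite addrACA -!scalerDr rpredD ?rpredZ.
  have h4 : (a *: tm + b *: dm) + (a *: r + b *: (dp - v)) \in X2.
    by rewrite addrACA -!scalerDr rpredD ?rpredZ.
  have := mono h1 h2 h3 h4; rewrite -subr_ge0.
  rewrite !(formDl w, formDr w, formZl w, formZr w, formNr w).
  have sP := graph_form_sym LBp LAm LAp dmA tmA dpA tpA gP tP.
  have sR := graph_form_sym LX2 LAm LAp dmA tmA dvA rA gR tmr.
  rewrite sP sR !(formDr w, formNr w).
  by congr (0 <= _); ring.
have P0 : 0 <= w tm tp by exact: (maximal_triple_ge0 nd dimV M1 tmA tpA tP).
have fR : w tm (r - tp) <= C * w t1 y.
  rewrite formDr formNr; have := RP tm tp r tmA tpA rA tP tmr.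
  have : C * w tm tp <= C * w t1 y by rewrite ler_wpM2l //; lra.
  lra.
have f0 : 0 <= - w dm v.
  have := mono dpA dvA gP gR; rewrite formDr formNr; lra.
have q0 : 0 <= w t1 y by lra.
have step2 : w t1 y <= C * w y d.
  rewrite yd; move: CS; rewrite sqrrN -qy => CS.
  have {}CS : w t1 y ^+ 2 <= C * w t1 y * - w dm v by apply: le_trans CS _; rewrite ler_wpM2r.
  move: q0; rewrite le_eqVlt => /predU1P[<-|q0]; first by rewrite mulr_ge0 //; lra.
  by rewrite -(ler_pM2l q0) -expr2 mulrCA mulrA.
have : C * w t2 y <= C * w t3 y by rewrite ler_wpM2l //; lra.
have dyE : w d y = w t1 y - w t2 y by rewrite /d formDl (formNl w t2 y).
rewrite (skewC w y d) dyE in step2; lra.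
Qed.

End Config.
End Collar.

(** * Complex eigenvalues over a real closed field *)

Section RealFactors.
Local Open Scope complex_scope.
Variable K : rcfType.

(** (X - z) (X - conj z), with z given by its real and imaginary parts. *)
Definition real_quadratic (z : K * K) : {poly K} := ('X - (z.1)%:P) ^+ 2 + (z.2 ^+ 2)%:P.

(** Over K[i] the polynomial p equals its own conjugate, so p^2 = p conj(p) pairs every root with
    its conjugate. Squaring treats real and nonreal roots alike. *)
Lemma sqr_poly_real_factors (p : {poly K}) : p \is monic ->
  exists s : seq (K * K), p ^+ 2 = \prod_(z <- s) real_quadratic z.
Proof.
move=> pm; pose P : {poly K[i]} := map_poly (real_complex K) p.
have [r rP] := closed_field_poly_normal P.
have lP : lead_coef P = 1 by apply/monicP; rewrite map_monic.
rewrite lP scale1r in rP.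
have cP : map_poly (@conjc K) P = P.
  by apply/polyP => i; rewrite !coef_map /= oppr0.
exists [seq (complex.Re z, complex.Im z) | z <- r].
apply: (map_poly_inj (real_complex K)); rewrite rmorphXn /= expr2 -/P -{2}cP rP.
rewrite !rmorph_prod /= -big_split big_map /=; apply: eq_bigr => -[a b] _.
rewrite rmorphB /= map_polyX map_polyC /= /real_quadratic /= rmorphD rmorphXn rmorphB /= map_polyX !map_polyC /=.
have -> : (a +i* b)%:P = a%:C%:P + ('i * b%:C)%:P :> {poly K[i]}.
  by rewrite -polyCD; congr _%:P; simpc.
have -> : (a -i* b)%:P = a%:C%:P - ('i * b%:C)%:P :> {poly K[i]}.
  by rewrite -polyCB; congr _%:P; simpc.
have -> : (b ^+ 2)%:C%:P = - ('i * b%:C)%:P ^+ 2 :> {poly K[i]}.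
  by rewrite -polyC_exp -polyCN; congr _%:P; rewrite exprMn sqr_i mulN1r opprK rmorphXn.
ring.
Qed.

(** By Cayley-Hamilton the product of the quadratic factors of the squared characteristic polynomial
    kills [x0]. Applying them one at a time inside [E], the last nonzero vector is killed by a
    single factor. *)
Lemma exists_quadratic_eigenvector m (G : 'M[K]_m) (E : {vspace 'cV[K]_m}) x0 :
    x0 \in E -> x0 != 0 -> (forall x, x \in E -> G *m x \in E) ->
  exists a c x, [/\ x \in E, x != 0 &
    G *m (G *m x - a *: x) - a *: (G *m x - a *: x) + c ^+ 2 *: x = 0].
Proof.
case: m G E x0 => [|m] G E x0 xE nz GE.
  by case/eqP: nz; apply/matrixP => -[].
have [s sP] := sqr_poly_real_factors (char_poly_monic G).
have : horner_mx G (\prod_(z <- s) real_quadratic z) *m x0 = 0.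
  by rewrite -sP rmorphXn /= Cayley_Hamilton expr0n mul0mx.
elim: s {sP} x0 xE nz => [|z s IH] x0 xE nz.
  by rewrite big_nil rmorph1 mul1mx => /eqP; rewrite (negPf nz).
rewrite big_cons mulrC rmorphM /= -mulmxA.
set y := horner_mx G (real_quadratic z) *m x0 => sy.
have yE : y = G *m (G *m x0 - z.1 *: x0) - z.1 *: (G *m x0 - z.1 *: x0) + z.2 ^+ 2 *: x0.
  rewrite /y /real_quadratic rmorphD rmorphXn rmorphB /= horner_mx_X !horner_mx_C expr2.
  by rewrite mulmxDl mul_scalar_mx -mulmxA !mulmxBl !mul_scalar_mx.
have [y0|y0] := eqVneq y 0; first by exists z.1, z.2, x0; split=> //; rewrite -yE.
apply: (IH y) => //; rewrite yE rpredD ?rpredZ // rpredB ?rpredZ ?rpredB ?rpredZ //; try exact: GE.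
by apply: (GE); rewrite rpredB ?rpredZ // GE.
Qed.

End RealFactors.

(** * Transversality from contraction *)

Section ContractingTransverse.
Variables (F : rcfType) (O : convexSubring F) (V : vectType F) (w : {skew_symmetric V}).
Variables (n : nat) (e : (n + n).-tuple V) (He : symplectic_basis w e).
Local Notation K := (residue_field O).
Local Notation reduce := (reduce O He).
Local Notation red_lfun := (red_lfun O e).

(** The factor C / (C + 1) differs from 1 by 1 / (C + 1), whose inverse lies in [O]; the contraction
    therefore remains strict after reduction. *)
Definition contracts (L : {vspace V}) (g : 'End(V)) := exists B C,
  [/\ pos_form_on L B, C \in O, 1 <= C & forall u, u \in L ->
    (C + 1) * B (g u) (g u) <= C * B u u].

(* A common subspace of the reductions carries a, possibly complex, eigenvalue z of the
   reduction of g. The contraction excludes |z| >= 1 on reduce L, and |1/z| >= 1 on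
   reduce L'. *)
Lemma contracting_transverse (L L' : {vspace V}) (g h : 'End(V)) :
    integral_in O e g -> integral_in O e h ->
    (forall u, g (h u) = u) -> (forall u, h (g u) = u) ->
    (forall u, u \in L -> g u \in L) -> (forall u, u \in L' -> h u \in L') ->
    (forall u, u \in L' -> g u \in L') ->
    contracts L g -> contracts L' h ->
  transverse (reduce L) (reduce L').
Proof.
move=> Og Oh gh hg gL hL' gL' [B [C [posB OC C1 BC]]] [B' [C' [posB' OC' C1' BC']]].
have inv f (X : {vspace V}) : integral_in O e f -> (forall u, u \in X -> f u \in X) ->
    forall x, x \in reduce X -> red_lfun f x \in reduce X.
  move=> Of fX x /(reduceP He)[u [uX Ou <-]].
  by rewrite (red_lfunE He) // mem_reduce //; [exact: fX | exact: (integral_map He)].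
have hgK x : red_lfun h (red_lfun g x) = x.
  have [v [_ Ov <-]] : exists v, [/\ v \in fullv, integral_vec O e v & red O e v = x].
    have cx i := residue_surj (x i 0).
    have [c cO cr] : exists2 c : 'I_(n + n) -> F, forall i, c i \in O & forall i, residue O (c i) = x i 0.
      by exists (fun i => projT1 (cid2 (cx i))) => i; case: cid2.
    exists (\sum_j c j *: tnth e j); split; first exact: memvf.
      by move=> i; rewrite (coord_vec He).
    by apply/colP => i; rewrite mxE (coord_vec He) cr.
  by rewrite !(red_lfunE He) ?hg //; exact: (integral_map He).
apply/eqP; rewrite -subv0; apply/subvP => x0 /[!memv_cap] /andP[x0L x0L'].
rewrite memv0; apply: contraT => x0nz.
pose G := map_mx (@residue F O) (basis_mx e g).
have GE x : G *m x = red_lfun g x by rewrite lfunE.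
have [||a [c [x [xE xnz]]]] := @exists_quadratic_eigenvector _ _ G (reduce L :&: reduce L')%VS x0 _ x0nz.
- by rewrite memv_cap x0L.
- by move=> x; rewrite !memv_cap GE => /andP[xL xL']; rewrite !inv.
rewrite !GE => Nx; move: xE; rewrite memv_cap => /andP[xL xL'].
case/eqP: xnz; have [ac|ac] := lerP 1 (a ^+ 2 + c ^+ 2).
  exact: (contracting_resolvent_on posB Og gL OC C1 BC ac xL Nx).
(* k = |z|^2 < 1. The inverse has on x the eigenvalues 1/z and its conjugate, with real part a / k,
   imaginary parts c / k up to sign, and squared modulus 1 / k >= 1. If k = 0 the equation for [h]
   already gives x = 0. *)
pose k := a ^+ 2 + c ^+ 2.
have Nx' : red_lfun g (red_lfun g x) - (a + a) *: red_lfun g x + k *: x = 0.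
  rewrite -Nx /k.
  have -> : red_lfun g (red_lfun g x - a *: x) = red_lfun g (red_lfun g x) - a *: red_lfun g x.
    by rewrite linearB linearZ.
  move: (red_lfun g (red_lfun g x)) (red_lfun g x) => p q.
  by apply/matrixP => i j; rewrite !mxE; ring.
have hx : x - (a + a) *: red_lfun h x + k *: red_lfun h (red_lfun h x) = 0.
  have := congr1 (fun y => red_lfun h (red_lfun h y)) Nx'; rewrite /= !linear0 => <-.
  have hD (f : 'End('cV[K]_(n + n))) u1 u2 u3 : f (u1 - (a + a) *: u2 + k *: u3) = f u1 - (a + a) *: f u2 + k *: f u3.
    by rewrite linearD linearB !linearZ.
  by rewrite !hD !hgK.
have k0 : 0 <= k by rewrite addr_ge0 ?sqr_ge0.
have [k00|knz] := eqVneq k 0.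
  have /andP[/eqP a0 _] : (a == 0) && (c == 0).
    by move: k00; rewrite /k => /eqP; rewrite paddr_eq0 ?sqr_ge0 // !sqrf_eq0.
  by move: hx; rewrite k00 a0 addr0 !scale0r addr0 subr0.
have akE : k * (a / k) = a by rewrite mulrC divfK.
have kV : (a / k) ^+ 2 + (c / k) ^+ 2 = k^-1.
  by rewrite !expr_div_n -mulrDl -/k expr2 invfM mulrA divff ?mul1r.
have ac1 : 1 <= (a / k) ^+ 2 + (c / k) ^+ 2 by rewrite kV invf_ge1 ?lt_def ?knz // ltW.
have kE : k * ((a / k) ^+ 2 + (c / k) ^+ 2) = 1 by rewrite kV divff.
have Mx : red_lfun h (red_lfun h x - (a / k) *: x) - (a / k) *: (red_lfun h x - (a / k) *: x)
    + (c / k) ^+ 2 *: x = 0.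
  have -> : red_lfun h (red_lfun h x - (a / k) *: x) = red_lfun h (red_lfun h x) - (a / k) *: red_lfun h x.
    by rewrite linearB linearZ.
  apply: (scalerI knz); rewrite scaler0 -[RHS]hx.
  move: (red_lfun h (red_lfun h x)) (red_lfun h x) => p q.
  move: (a / k) (c / k) akE kE => a' c' akE kE.
  rewrite -[in RHS](scale1r x) -kE -akE; move: (k) => k'.
  apply/matrixP => i j; rewrite !mxE; ring.
exact: (contracting_resolvent_on posB' Oh hL' OC' C1' BC' ac1 xL' Mx).
Qed.

End ContractingTransverse.

(** * Framings in a chart of the boundary *)

(* z1 and z2 are the fixed points of the Moebius map of (p q; r s), and - s / r is
   its pole. *)
Lemma fixed_point_roots (R : rcfType) (p q r s : R) : 0 < q -> 0 < r -> 0 < s -> p * s - q * r = 1 ->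
  exists z1 z2, [/\ z1 < 0, 0 < z2, - s / r < z1,
    r * z1 ^+ 2 + (s - p) * z1 - q = 0 & r * z2 ^+ 2 + (s - p) * z2 - q = 0].
Proof.
move=> q0 r0 s0 D; have qr := mulr_gt0 q0 r0; pose d := Num.sqrt ((s - p) ^+ 2 + 4 * (q * r)).
have p0 : 0 < p by nra.
have d0 : 0 <= d by exact: sqrtr_ge0.
have dE : d ^+ 2 = (s - p) ^+ 2 + 4 * (q * r).
  by rewrite sqr_sqrtr // addr_ge0 ?sqr_ge0 // mulr_ge0 // ltW.
have dlt : d < p + s.
  rewrite ltNge; apply/negP => h.
  have : (p + s) * (p + s) <= d * d by rewrite ler_pM // addr_ge0 // ltW.
  by rewrite -[d * d]expr2 dE; lra.
have gtd c : c ^+ 2 = (s - p) ^+ 2 -> c < d.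
  move=> cE; rewrite ltNge; apply/negP => h.
  have : d * d <= c * c by rewrite ler_pM.
  by rewrite -!expr2 dE cE; lra.
have d1 := gtd _ (erefl _); have d2 : p - s < d by apply: gtd; ring.
have rr : 0 < r * 2 by lra.
exists ((p - s - d) / (r * 2)), ((p - s + d) / (r * 2)).
have root c : c ^+ 2 = d ^+ 2 ->
    r * ((p - s + c) / (r * 2)) ^+ 2 + (s - p) * ((p - s + c) / (r * 2)) - q = 0.
  move=> cE; transitivity ((c ^+ 2 - d ^+ 2) / (r * 4)); last by rewrite cE subrr mul0r.
  by rewrite dE; field; rewrite lt0r_neq0.
split.
- by rewrite pmulr_llt0 ?invr_gt0 //; lra.
- by rewrite divr_gt0 //; lra.
- by rewrite ltr_pdivlMr // mulrA divfK ?lt0r_neq0 //; lra.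
- by apply: root; rewrite sqrrN.
- exact: root.
Qed.

Section Framed.
Variables (R : realType) (F : rcfType) (O : convexSubring F) (V : vectType F).
Variables (w : {skew_symmetric V}) (n : nat) (e : (n + n).-tuple V).
Hypotheses (He : symplectic_basis w e) (nd : nondegenerate w).
Implicit Types (G : set 'M[R]_2) (A P a b : 'M[R]_2) (S : set (boundary R)).
Implicit Types (rho : 'M[R]_2 -> 'End(V)) (phi : boundary R -> {vspace V}).

(* What remains of the hypotheses of the theorem when the charts of the boundary are
   changed by elements of SL(2,R) outside G. *)
Record framed G rho S phi : Prop := Framed {
  framed_det : forall A, G A -> \det A = 1;
  framed1 : G 1%:M;
  framedN : forall A, G A -> G (- A);
  framedM : forall A B, G A -> G B -> G (A *m B);
  framedV : forall A, G A -> G (invmx A);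
  framed_symplectic : symplectic_representation G w rho;
  framed_integral : forall A, G A -> integral_in O e (rho A);
  framed_maximal : maximal_framing G w rho S phi
}.

Section Facts.
Variables (G : set 'M[R]_2) (rho : 'M[R]_2 -> 'End(V)).
Variables (S : set (boundary R)) (phi : boundary R -> {vspace V}).
Hypothesis fr : framed G rho S phi.

Lemma framed_rho1 : rho 1%:M = \1%VF.
Proof.
have [_ rM rN] := framed_symplectic fr.
have GN1 := framedN fr (framed1 fr).
have -> : 1%:M = - 1%:M *m - 1%:M :> 'M[R]_2 by rewrite mulmxN mulNmx opprK mulmx1.
by rewrite rM // rN comp_lfun1l.
Qed.

Lemma framed_unit A : G A -> A \in unitmx.
Proof. by move=> /(framed_det fr) dA; rewrite unitmxE dA unitr1. Qed.

Lemma framed_rhoV A : G A -> (rho (invmx A) \o rho A)%VF = \1%VF.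
Proof.
move=> GA; have [_ rM _] := framed_symplectic fr.
by rewrite -rM ?mulVmx ?framed_rho1 ?framed_unit //; exact: (framedV fr).
Qed.

Lemma framed_rhoVr A : G A -> (rho A \o rho (invmx A))%VF = \1%VF.
Proof.
move=> GA; have [_ rM _] := framed_symplectic fr.
by rewrite -rM ?mulmxV ?framed_rho1 ?framed_unit //; exact: (framedV fr).
Qed.

Lemma framed_act A x u : G A -> S x -> u \in phi x -> rho A u \in phi (boundary_mobius A x).
Proof. by move=> GA Sx ux; have [_ _ _ E _] := framed_maximal fr; rewrite E // memv_img. Qed.

Lemma framed_transverse x y z : S x -> S y -> S z -> positively_oriented x y z ->
  maximal_triple w (phi x) (phi y) (phi z).
Proof. by have [_ _ _ _ M] := framed_maximal fr; exact: M. Qed.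

End Facts.

Lemma framed_conj G rho S phi P : framed G rho S phi -> \det P = 1 ->
  framed (fun M => G (invmx P *m M *m P)) (fun M => rho (invmx P *m M *m P))
    (fun t => S (boundary_mobius (invmx P) t)) (fun t => phi (boundary_mobius (invmx P) t)).
Proof.
move=> [Gd G1 GN GM GV [rw rM rN] Oi [SG Sf Sl Se Sm]] dP.
have uP : P \in unitmx by rewrite unitmxE dP unitr1.
have dV : \det (invmx P) = 1 by rewrite det_inv dP invr1.
have cM A B : invmx P *m (A *m B) *m P = (invmx P *m A *m P) *m (invmx P *m B *m P).
  by rewrite !mulmxA mulmxK.
have cd A : G (invmx P *m A *m P) -> \det A = 1.
  by move=> /Gd; rewrite !det_mulmx dV dP mulr1 mul1r.
have act A x : G (invmx P *m A *m P) ->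
  boundary_mobius (invmx P) (boundary_mobius A x) =
  boundary_mobius (invmx P *m A *m P) (boundary_mobius (invmx P) x).
  move=> GA; have := boundary_mobius_conj x dV (cd _ GA); rewrite invmxK => <-.
  by [].
split.
- exact: cd.
- by rewrite mulmx1 mulVmx.
- by move=> A GA; rewrite mulmxN mulNmx; exact: GN.
- by move=> A B GA GB; rewrite cM; exact: GM.
- move=> A GA; have uA : A \in unitmx by rewrite unitmxE (cd _ GA) unitr1.
  have := GV _ GA; rewrite invmxM ?unitmx_mul ?unitmx_inv ?uP //.
  by rewrite invmxM ?unitmx_inv // invmxK mulmxA.
- split=> [A GA|A B GA GB|]; [exact: rw|by rewrite cM; exact: rM|].
  by rewrite mulmxN mulmx1 mulNmx mulVmx.
- by move=> A; exact: Oi.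
- split.
  + by move=> A x GA Sx; rewrite act //; exact: SG.
  + move=> A x GA hA Ax; apply: (Sf _ _ GA); last by rewrite -act // Ax.
    by have := hyperbolic_conj A dV; rewrite invmxK => -[_]; exact.
  + by move=> x; exact: Sl.
  + by move=> A x GA Sx; rewrite act // Se.
  + move=> x y z Sx Sy Sz o; apply: Sm => //; exact: positively_oriented_mobius.
Qed.

Section Diagonal.
Variables (G : set 'M[R]_2) (rho : 'M[R]_2 -> 'End(V)).
Variables (S : set (boundary R)) (phi : boundary R -> {vspace V}).
Hypothesis fr : framed G rho S phi.
Variable l : R.
Hypotheses (l1 : 1 < l ^+ 2) (Gl : G (mx2 l 0 0 l^-1)).

Let diag k : 'M[R]_2 := mx2 (l ^+ k) 0 0 (l ^- k).

Let l0 : l != 0.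
Proof. by apply: contraTneq l1 => ->; rewrite expr0n /= ltr10. Qed.

Lemma diag_mem k : G (diag k).
Proof.
elim: k => [|k IH].
  rewrite /diag expr0 invr1; have -> : mx2 1 0 0 1 = 1%:M :> 'M[R]_2; last exact: (framed1 fr).
  by rewrite [RHS]mx2E !mxE.
have -> : diag k.+1 = mx2 l 0 0 l^-1 *m diag k; last exact: (framedM fr).
by rewrite /diag mx2_mul !mulr0 !mul0r !addr0 !add0r exprS invfM.
Qed.

Lemma boundary_mobius_diag k t : boundary_mobius (diag k) (Some t) = Some (l ^+ 2 ^+ k * t).
Proof.
rewrite /= !mxE /= mul0r add0r addr0 invr_eq0 expf_eq0 (negPf l0) andbF.
by rewrite invrK mulrAC -expr2 exprAC.
Qed.

Lemma boundary_mobius_diag_inf k : boundary_mobius (diag k) None = None.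
Proof. by rewrite /= !mxE /= eqxx. Qed.

Lemma hyperbolic_diag : hyperbolic (mx2 l 0 0 l^-1).
Proof.
rewrite /hyperbolic /mxtrace big_ord_recl big_ord1 !mxE /=.
have lV : l * l^-1 = 1 by rewrite divff.
rewrite -[X in X < _]ger0_norm // -ltr_sqr ?nnegrE ?normr_ge0 // !real_normK ?num_real //.
have : 0 < (l - l^-1) ^+ 2.
  rewrite exprn_even_gt0 //= subr_eq0; apply/eqP => E.
  by move: l1; rewrite expr2 {2}E lV ltxx.
by rewrite sqrrB sqrrD lV; lra.
Qed.

Lemma framed_zero : S (Some 0).
Proof.
have [_ Sf _ _ _] := framed_maximal fr; apply: (Sf _ _ Gl hyperbolic_diag).
by have := boundary_mobius_diag 1 0; rewrite /diag expr1 mulr0.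
Qed.

Lemma framed_inf : S None.
Proof.
have [_ Sf _ _ _] := framed_maximal fr; apply: (Sf _ _ Gl hyperbolic_diag).
by have := boundary_mobius_diag_inf 1; rewrite /diag expr1.
Qed.

Variable a : 'M[R]_2.
Hypotheses (Ga : G a) (a0 : forall i j, 0 < a i j).

Lemma hyperbolic_positive : hyperbolic a.
Proof.
have := framed_det fr Ga; rewrite det2 /hyperbolic /mxtrace big_ord_recl big_ord1.
rewrite (_ : lift _ _ = 1 :> 'I_2); last exact: val_inj.
have p := a0 0 0; have q := a0 0 1; have r := a0 1 0; have s := a0 1 1 => d.
rewrite ger0_norm; last by rewrite addr_ge0 // ltW.
rewrite ltNge; apply/negP => h.
have := mulr_gt0 q r; have := sqr_ge0 (a 0 0 - a 1 1).
have : (a 0 0 + a 1 1) * (a 0 0 + a 1 1) <= 2 * 2 by rewrite ler_pM // addr_ge0 // ltW.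
by lra.
Qed.

(** z1 < 0 < z2 are the fixed points of [a], and - s / r is its preimage of oo, where the framing is
    defined by invariance of [S]. The statement covers all large k so that a common k can serve both
    ends of the axis. *)
Lemma contracting_eventually : exists k0, forall k, (k0 <= k)%N ->
  contracts O (phi (Some 0)) (rho (diag k)).
Proof.
have da := framed_det fr Ga; rewrite det2 in da.
have ha := hyperbolic_positive.
have [SM SF _ _ _] := framed_maximal fr; have [rw _ _] := framed_symplectic fr.
have [p pE] : exists p, p = a 0 0 by eexists.
have [q qE] : exists q, q = a 0 1 by eexists.
have [r rE] : exists r, r = a 1 0 by eexists.
have [s sE] : exists s, s = a 1 1 by eexists.
have p0 : 0 < p by rewrite pE. have q0 : 0 < q by rewrite qE.
have r0 : 0 < r by rewrite rE. have s0 : 0 < s by rewrite sE.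
rewrite -pE -qE -rE -sE in da.
have [z1 [z2 [z10 z20 sz E1 E2]]] := fixed_point_roots q0 r0 s0 da.
have fix_root z : - s / r < z -> r * z ^+ 2 + (s - p) * z - q = 0 -> boundary_mobius a (Some z) = Some z.
  rewrite ltr_pdivrMr // => sz' Ez; have d0 : 0 < r * z + s by lra.
  rewrite /= -pE -qE -rE -sE (negPf (lt0r_neq0 d0)); congr Some.
  by apply: (mulIf (lt0r_neq0 d0)); rewrite divfK ?lt0r_neq0 //; lra.
have az1 := fix_root _ sz E1.
have az2 : boundary_mobius a (Some z2) = Some z2 by apply: fix_root => //; lra.
have ax : boundary_mobius a (Some (- s / r)) = None.
  by rewrite /= -rE -sE mulrC divfK ?lt0r_neq0 // addNr eqxx.
have S0 := framed_zero; have Si := framed_inf.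
have Sz1 : S (Some z1) by exact: (SF _ _ Ga).
have Sz2 : S (Some z2) by exact: (SF _ _ Ga).
have Sx : S (Some (- s / r)).
  rewrite -(boundary_mobiusVK (Some _) (framed_det fr Ga)) ax; apply: SM => //; exact: (framedV fr).
(* From this power on, the image of z1 lies beyond - s / r, which is the cyclic order demanded by
   [collar_contraction]. *)
have [k0 k0P] := expr_gt_unbounded (s / r / - z1) l1.
exists k0 => k kk0; set b := diag k; have Gb : G b := diag_mem k.
have lk : s / r / - z1 < l ^+ 2 ^+ k.
  by rewrite (lt_le_trans k0P) // ler_weXn2l // ltW.
have b0 : boundary_mobius b (Some 0) = Some 0 by rewrite boundary_mobius_diag mulr0.
have bz1 : boundary_mobius b (Some z1) = Some (l ^+ 2 ^+ k * z1) by exact: boundary_mobius_diag.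
have Sbz : S (Some (l ^+ 2 ^+ k * z1)) by rewrite -bz1; exact: SM.
have lz : l ^+ 2 ^+ k * z1 < - s / r.
  by move: lk; rewrite ltr_pdivrMr ?oppr_gt0 // mulNr mulrN; lra.
have max x y z := @framed_transverse _ _ _ _ fr x y z.
have M1 : maximal_triple w (phi (Some z2)) (phi None) (phi (Some z1)).
  by apply: max => //; apply: Or33 => /=; rewrite andbT; lra.
have M2 : maximal_triple w (phi None) (phi (Some (- s / r))) (phi (Some z1)).
  by apply: max => //; apply: Or32 => /=; rewrite andbT; lra.
have M3 : maximal_triple w (phi (Some z1)) (phi (Some 0)) (phi (Some z2)).
  by apply: max => //; apply: Or31 => /=; apply/andP.
have M4 : maximal_triple w (phi None) (phi (Some z1)) (phi (Some 0)).
  by apply: max => //; apply: Or32 => /=; rewrite andbT.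
have M5 : maximal_triple w (phi None) (phi (Some (l ^+ 2 ^+ k * z1))) (phi (Some (- s / r))).
  by apply: max => //; apply: Or32 => /=; rewrite andbT.
have act A x y : G A -> S x -> boundary_mobius A x = y -> forall u, u \in phi x -> rho A u \in phi y.
  by move=> GA Sx' <- u; exact: (framed_act fr).
have [C [OC C1 CP]] := collar_contraction He nd M1 M2 M3 M5 (rw a Ga) (framed_integral fr Ga)
  (act _ _ _ Ga Sz2 az2) (act _ _ _ Ga Sz1 az1) (act _ _ _ Ga Sx ax) (rw b Gb)
  (act _ _ _ Gb S0 b0) (act _ _ _ Gb Si (boundary_mobius_diag_inf k))
  (act _ _ _ Gb Sz1 bz1).
exists (fun u v => w (triple_map (phi (Some z1)) (phi None) u) v), C; split=> //.
exact: (triple_pos_form_swap He nd M4).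
Qed.

End Diagonal.
End Framed.

(** * Transversality of the reduced framing *)

Section Pairs.
Variables (R : realType) (F : rcfType) (O : convexSubring F) (V : vectType F).
Variables (w : {skew_symmetric V}) (n : nat) (e : (n + n).-tuple V).
Hypotheses (He : symplectic_basis w e) (nd : nondegenerate w).
Implicit Types (G : set 'M[R]_2) (A P a b : 'M[R]_2) (S : set (boundary R)).
Implicit Types (rho : 'M[R]_2 -> 'End(V)) (phi : boundary R -> {vspace V}).
Local Notation framed := (framed O w e).
Local Notation reduce := (reduce O He).

Lemma conjK P a : P \in unitmx -> invmx P *m (P *m a *m invmx P) *m P = a.
Proof. by move=> uP; rewrite !mulmxA mulVmx // mul1mx mulmxKV. Qed.

(** The contraction is needed at both ends. The rotation [J] exchanges 0 and oo, and turns the chart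
    [P] for b into a chart for the inverse of b, in which the other end sits at 0. *)
Lemma opposite_transverse G rho S phi b P (l : R) : surface_group G -> framed G rho S phi ->
    G b -> \det P = 1 -> P *m b *m invmx P = mx2 l 0 0 l^-1 -> 1 < l ^+ 2 ->
  transverse (reduce (phi (boundary_mobius (invmx P) (Some 0))))
    (reduce (phi (boundary_mobius (invmx P) None))).
Proof.
move=> HG fr Gb dP Pb l1.
have l0 : l != 0 by apply: contraTneq l1 => ->; rewrite expr0n /= ltr10.
have uP : P \in unitmx by rewrite unitmxE dP unitr1.
pose J : 'M[R]_2 := mx2 0 1 (-1) 0.
have dJ : \det J = 1 by rewrite det_mx2; lra.
have uJ : J \in unitmx by rewrite unitmxE dJ unitr1.
have JV : invmx J = mx2 0 (-1) 1 0 by rewrite (invmx2 dJ) !mxE /= opprK.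
have dQ : \det (J *m P) = 1 by rewrite det_mulmx dJ dP mulr1.
have uQ : J *m P \in unitmx by rewrite unitmxE dQ unitr1.
have VQ : invmx (J *m P) = invmx P *m invmx J by rewrite invmxM.
have GbV : G (invmx b) by exact: (framedV fr).
have ub : b \in unitmx := framed_unit fr Gb.
have dD (c : R) : c != 0 -> \det (mx2 c 0 0 c^-1) = 1.
  by move=> c0; rewrite det_mx2 divff // mulr0 subr0.
have VD (c : R) : c != 0 -> invmx (mx2 c 0 0 c^-1) = mx2 c^-1 0 0 c.
  by move=> c0; rewrite (invmx2 (dD c c0)) !mxE /= oppr0.
have PbV : P *m invmx b *m invmx P = mx2 l^-1 0 0 l.
  rewrite -VD // -Pb invmxM ?unitmx_mul ?uP ?unitmx_inv //.
  by rewrite invmxM // invmxK mulmxA.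
have conjJ (c d : R) : J *m mx2 c 0 0 d *m invmx J = mx2 d 0 0 c.
  by rewrite JV !mx2_mul; congr mx2; ring.
have QbV : J *m P *m invmx b *m invmx (J *m P) = mx2 l 0 0 l^-1.
  by rewrite VQ -!mulmxA (mulmxA P) (mulmxA (P *m invmx b)) PbV mulmxA conjJ.
have [a Ga a0] := crossing_element HG Gb dP Pb l1.
have [a' Ga' a'0] := crossing_element HG GbV dQ QbV l1.
have fr1 := framed_conj fr dP; have fr2 := framed_conj fr dQ.
have Gl1 : G (invmx P *m mx2 l 0 0 l^-1 *m P) by rewrite -Pb conjK.
have Gl2 : G (invmx (J *m P) *m mx2 l 0 0 l^-1 *m (J *m P)) by rewrite -QbV conjK.
have Ga1 : G (invmx P *m (P *m a *m invmx P) *m P) by rewrite conjK.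
have Ga2 : G (invmx (J *m P) *m (J *m P *m a' *m invmx (J *m P)) *m (J *m P)) by rewrite conjK.
have [k1 c1] := contracting_eventually He nd fr1 l1 Gl1 Ga1 a0.
have [k2 c2] := contracting_eventually He nd fr2 l1 Gl2 Ga2 a'0.
have [k [kk1 kk2]] : exists k, (k1 <= k)%N /\ (k2 <= k)%N.
  by exists (maxn k1 k2); rewrite leq_maxl leq_maxr.
have QV0 : boundary_mobius (invmx (J *m P)) (Some 0) = boundary_mobius (invmx P) None.
  rewrite VQ boundary_mobiusM ?det_inv ?dP ?dJ ?invr1 // JV.
  by congr boundary_mobius; rewrite /= !mxE /= mulr0 addr0 eqxx.
have := c2 _ kk2; have := c1 _ kk1; rewrite QV0.
have Gg := diag_mem fr1 Gl1 k; have Gh := diag_mem fr2 Gl2 k.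
have Sz := framed_zero fr1 l1 Gl1; have Si := framed_inf fr1 l1 Gl1.
have Sh := framed_zero fr2 l1 Gl2.
have D0 := boundary_mobius_diag l1 k 0; rewrite mulr0 in D0.
have Di := boundary_mobius_diag_inf l k.
have stab0 u := @framed_act _ _ _ _ _ _ _ _ _ _ _ fr1 _ _ u Gg Sz.
have stabi u := @framed_act _ _ _ _ _ _ _ _ _ _ _ fr1 _ _ u Gg Si.
have stabh u := @framed_act _ _ _ _ _ _ _ _ _ _ _ fr2 _ _ u Gh Sh.
rewrite D0 in stab0; rewrite Di in stabi; rewrite D0 QV0 in stabh.
move: Gg Gh stab0 stabi stabh; cbv beta.
set D := mx2 (l ^+ k) 0 0 (l ^- k).
have -> : invmx (J *m P) *m D *m (J *m P) = invmx (invmx P *m D *m P).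
  have lk : l ^+ k != 0 by rewrite expf_neq0.
  have uD : D \in unitmx by rewrite unitmxE dD ?unitr1.
  rewrite [RHS]invmxM ?unitmx_mul ?unitmx_inv ?uP // (invmxM _ uD) ?unitmx_inv // invmxK VD //.
  have -> : mx2 (l ^- k) 0 0 (l ^+ k) = invmx J *m D *m J.
    by rewrite JV /D !mx2_mul; congr mx2; ring.
  by rewrite VQ !mulmxA.
move: (invmx P *m D *m P) => g Gg Gh stab0 stabi stabh c1' c2'.
apply: (contracting_transverse (g := rho g) (h := rho (invmx g)) He _ _ _ _ stab0 stabh stabi c1' c2').
- exact: (framed_integral fr Gg).
- exact: (framed_integral fr Gh).
- by move=> u; rewrite -comp_lfunE (framed_rhoVr fr Gg) id_lfunE.
- by move=> u; rewrite -comp_lfunE (framed_rhoV fr Gg) id_lfunE.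
Qed.

(** If x is repelling, that is l^2 < 1, b is replaced by its inverse, which has the same fixed
    points. *)
Lemma hyperbolic_chart G rho S phi b x : framed G rho S phi ->
    G b -> hyperbolic b -> boundary_mobius b x = x ->
  exists b' P l, [/\ G b', \det P = 1, P *m b' *m invmx P = mx2 l 0 0 l^-1, 1 < l ^+ 2 &
    boundary_mobius P x = None /\ forall y, boundary_mobius b y = y -> boundary_mobius b' y = y].
Proof.
move=> fr Gb hb bx; have db := framed_det fr Gb.
have [P [l [dP l0 l1 Pb Px]]] := hyperbolic_diagonalize db hb bx.
move: l1; rewrite neq_lt => /orP[l1|l1]; last by exists b, P, l.
have uP : P \in unitmx by rewrite unitmxE dP unitr1.
have ub := framed_unit fr Gb.
exists (invmx b), P, l^-1; split=> //; first exact: (framedV fr).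
- rewrite invrK; have -> : mx2 l^-1 0 0 l = invmx (mx2 l 0 0 l^-1).
    by rewrite invmx2 ?det_mx2 ?mxE /= ?oppr0 // divff // mulr0 subr0.
  by rewrite -Pb invmxM ?unitmx_mul ?uP ?unitmx_inv // invmxM // invmxK mulmxA.
- by rewrite exprVn invf_gt1 // exprn_even_gt0.
- by split=> // y by_; rewrite -{1}by_ boundary_mobiusVK.
Qed.

Lemma fixed_pair_transverse G rho S phi b x y : surface_group G -> framed G rho S phi ->
    G b -> hyperbolic b -> boundary_mobius b x = x -> boundary_mobius b y = y -> x <> y ->
  transverse (reduce (phi x)) (reduce (phi y)).
Proof.
move=> HG fr Gb hb bx by_ xy.
have [c [P [l [Gc dP Pc l1 [Px cfix]]]]] := hyperbolic_chart fr Gb hb bx.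
have l0 : l != 0 by apply: contraTneq l1 => ->; rewrite expr0n /= ltr10.
have xE : x = boundary_mobius (invmx P) None by rewrite -Px boundary_mobiusVK.
have [t Py] : exists t, boundary_mobius P y = Some t.
  case E : (boundary_mobius P y) => [t|]; first by exists t.
  by case: xy; rewrite xE -E boundary_mobiusVK.
have t0 : t = 0.
  have := boundary_mobius_conj y dP (framed_det fr Gc); rewrite cfix // Pc Py /= !mxE /= mul0r add0r addr0.
  rewrite invr_eq0 (negPf l0) invrK => -[E]; apply/eqP.
  have : (l ^+ 2 - 1) * t == 0 by rewrite expr2; apply/eqP; lra.
  by rewrite mulf_eq0 subr_eq0 (gt_eqF l1).
have yE : y = boundary_mobius (invmx P) (Some 0) by rewrite -t0 -Py boundary_mobiusVK.
rewrite /transverse capvC xE yE; exact: (opposite_transverse HG fr Gc dP Pc l1).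
Qed.

Section HalfLine.
Variables (G : set 'M[R]_2) (rho : 'M[R]_2 -> 'End(V)).
Variables (S : set (boundary R)) (phi : boundary R -> {vspace V}).
Hypothesis fr : framed G rho S phi.
Hypothesis pairs : forall b x y, G b -> hyperbolic b ->
  boundary_mobius b x = x -> boundary_mobius b y = y -> x <> y ->
  transverse (reduce (phi x)) (reduce (phi y)).
Variable l : R.
Hypotheses (l1 : 1 < l ^+ 2) (Gl : G (mx2 l 0 0 l^-1)).

Let b : 'M[R]_2 := mx2 l 0 0 l^-1.
Let b0 : boundary_mobius b (Some 0) = Some 0.
Proof. by have := boundary_mobius_diag l1 1 0; rewrite !expr1 mulr0. Qed.
Let binf : boundary_mobius b None = None.
Proof. by have := boundary_mobius_diag_inf l 1; rewrite !expr1. Qed.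

(** [sg] is true on the negative half-line. The conjugate of b by c fixes y1 = c(0) and y2 = c(oo),
    both farther from 0 than t on the same side; [reduce_meet_mono] is used with the values of the
    framing at 0, oo, t and y1 or y2. *)
Lemma beyond_transverse (sg : bool) (t : R) c y1 y2 : G c -> S (Some t) ->
    boundary_mobius c (Some 0) = Some y1 -> boundary_mobius c None = Some y2 ->
    0 < (-1) ^+ sg * t -> (-1) ^+ sg * t < (-1) ^+ sg * y1 -> (-1) ^+ sg * t < (-1) ^+ sg * y2 ->
  transverse (reduce (phi (Some t))) (reduce (phi None)).
Proof.
move=> Gc St c0 ci st ty1 ty2; have dc := framed_det fr Gc.
have S0 := framed_zero fr l1 Gl; have Si := framed_inf fr l1 Gl.
have [SM _ SL _ _] := framed_maximal fr.
have S1 : S (Some y1) by rewrite -c0; exact: SM.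
have S2 : S (Some y2) by rewrite -ci; exact: SM.
have max x y z := @framed_transverse _ _ _ _ _ _ _ _ _ _ _ fr x y z.
have pos u z : S (Some u) -> S (Some z) -> (-1) ^+ sg * u < (-1) ^+ sg * z ->
    [/\ transverse (phi (Some u)) (phi None), transverse (phi (Some z)) (phi None) &
    forall v v', v \in phi (Some u) ->
    v' \in phi None -> v + v' \in phi (Some z) -> 0 <= (-1) ^+ sg * w v v'].
  move=> Su Sz; case: (sg); rewrite ?expr0 ?expr1 ?mul1r ?mulN1r ?ltrN2 => uz; last first.
    have M : maximal_triple w (phi (Some u)) (phi (Some z)) (phi None).
      by apply: max => //; apply: Or31; rewrite /= andbT.
    have [_ [_ tr2 tr1] _] := M; split=> // v v' vu v'i vz; rewrite mul1r.
    exact: (maximal_triple_ge0 nd (dim_fullV He) M).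
  have M : maximal_triple w (phi None) (phi (Some z)) (phi (Some u)).
    by apply: max => //; apply: Or32; rewrite /= andbT.
  have [_ [tr1 _ tr2] _] := M; split=> [||v v' vu v'i vz]; [by rewrite /transverse capvC..|].
  rewrite mulN1r -skewC.
  by apply: (maximal_triple_ge0 nd (dim_fullV He) M); rewrite // addrC.
have tr0i : transverse (reduce (phi (Some 0))) (reduce (phi None)).
  by apply: (pairs Gl (hyperbolic_diag l1)).
have s1 : (-1) ^+ sg = 1 :> F \/ (-1) ^+ sg = -1 :> F by case: (sg); [right|left].
have [tr0 trt pos0] : [/\ transverse (phi (Some 0)) (phi None), transverse (phi (Some t)) (phi None) &
    forall v v', v \in phi (Some 0) ->
    v' \in phi None -> v + v' \in phi (Some t) -> 0 <= (-1) ^+ sg * w v v'].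
  by apply: pos; rewrite ?mulr0.
have sub y : S (Some y) -> (-1) ^+ sg * t < (-1) ^+ sg * y -> forall x,
    x \in reduce (phi (Some t)) -> x \in reduce (phi None) -> x \in reduce (phi (Some y)).
  move=> Sy ty; have [_ _ posy] := pos t y St Sy ty.
  have L4 : [/\ lagrangian w (phi (Some 0)), lagrangian w (phi None), lagrangian w (phi (Some t)) & lagrangian w (phi (Some y))] by split; exact: SL.
  exact: (reduce_meet_mono nd s1 L4 tr0 trt tr0i pos0 posy).
have y12 : transverse (reduce (phi (Some y1))) (reduce (phi (Some y2))).
  have ub : b \in unitmx by exact: (framed_unit fr Gl).
  have db : \det b = 1 by exact: (framed_det fr Gl).
  have Gcbc : G (c *m b *m invmx c) by apply: (framedM fr); [exact: (framedM fr)|exact: (framedV fr)].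
  apply: (pairs Gcbc); first by apply/hyperbolic_conj => //; exact: hyperbolic_diag.
  - by rewrite -c0 boundary_mobius_conj // b0.
  - by rewrite -ci boundary_mobius_conj // binf.
  - move=> y12; have := congr1 (boundary_mobius (invmx c)) (etrans c0 (etrans y12 (esym ci))).
    by rewrite !boundary_mobiusVK.
apply/eqP; rewrite -subv0 -y12; apply/subvP => x; rewrite !memv_cap => /andP[xt xi].
by apply/andP; split; exact: sub.
Qed.

Variable a : 'M[R]_2.
Hypotheses (Ga : G a) (a0 : forall i j, 0 < a i j).

(** [a] has positive entries, so it sends 0 and oo to positive points, and its inverse sends them to
    negative ones. A power of diag(l, 1/l) then pushes both images beyond t. *)
Lemma half_line_transverse t : S (Some t) -> t != 0 ->
  transverse (reduce (phi (Some t))) (reduce (phi None)).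
Proof.
move=> St; have da := framed_det fr Ga.
have act c k y : G c -> \det c = 1 -> boundary_mobius (mx2 (l ^+ k) 0 0 (l ^- k) *m c) y =
    boundary_mobius (mx2 (l ^+ k) 0 0 (l ^- k)) (boundary_mobius c y).
  move=> Gc dc; rewrite boundary_mobiusM //; exact: (framed_det fr (diag_mem fr Gl k)).
have grow u y : 0 < y -> exists k0, forall k, (k0 <= k)%N -> u < l ^+ 2 ^+ k * y.
  move=> y0; have [k0 k0P] := expr_gt_unbounded (u / y) l1; exists k0 => k k0k.
  by rewrite -ltr_pdivrMr // (lt_le_trans k0P) // ler_weXn2l // ltW.
have big u y y' : 0 < y -> 0 < y' -> exists k, u < l ^+ 2 ^+ k * y /\ u < l ^+ 2 ^+ k * y'.
  move=> y0 y'0; have [k kP] := grow u y y0; have [k' k'P] := grow u y' y'0.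
  by exists (maxn k k'); split; [apply: kP; exact: leq_maxl|apply: k'P; exact: leq_maxr].
have p0 := a0 0 0; have q0 := a0 0 1; have r0 := a0 1 0; have s0 := a0 1 1.
rewrite neq_lt => /orP[t0|t0].
- have GaV : G (invmx a) by exact: (framedV fr).
  have [k [k1 k2]] := big (- t) (a 0 1 / a 0 0) (a 1 1 / a 1 0) (divr_gt0 q0 p0) (divr_gt0 s0 r0).
  have dV := framed_det fr GaV.
  apply: (@beyond_transverse true t (mx2 (l ^+ k) 0 0 (l ^- k) *m invmx a)
    (l ^+ 2 ^+ k * - (a 0 1 / a 0 0)) (l ^+ 2 ^+ k * - (a 1 1 / a 1 0))) => //;
    rewrite ?expr1 ?mulN1r ?oppr_gt0 ?mulrN ?opprK //.
  + by apply: (framedM fr) => //; exact: (diag_mem fr Gl).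
  + rewrite act // (invmx2 da) [in X in boundary_mobius _ X]/= !mxE /= mulr0 add0r.
    rewrite (negPf (lt0r_neq0 p0)) boundary_mobius_diag // mulr0 add0r mulNr mulrN //.
  + rewrite act // (invmx2 da) [in X in boundary_mobius _ X]/= !mxE /= oppr_eq0.
    by rewrite (negPf (lt0r_neq0 r0)) boundary_mobius_diag // invrN mulrN mulrN.
- have [k [k1 k2]] := big t (a 0 1 / a 1 1) (a 0 0 / a 1 0) (divr_gt0 q0 s0) (divr_gt0 p0 r0).
  apply: (@beyond_transverse false t (mx2 (l ^+ k) 0 0 (l ^- k) *m a)
    (l ^+ 2 ^+ k * (a 0 1 / a 1 1)) (l ^+ 2 ^+ k * (a 0 0 / a 1 0))) => //;
    rewrite ?expr0 ?mul1r //.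
  + by apply: (framedM fr) => //; exact: (diag_mem fr Gl).
  + rewrite act // [in X in boundary_mobius _ X]/= mulr0 !add0r.
    by rewrite (negPf (lt0r_neq0 s0)) boundary_mobius_diag // mulr0 add0r.
  + rewrite act // [in X in boundary_mobius _ X]/=.
    by rewrite (negPf (lt0r_neq0 r0)) boundary_mobius_diag.
Qed.

End HalfLine.

Lemma hyperbolic_points_transverse G rho S phi b x y : surface_group G -> framed G rho S phi ->
    G b -> hyperbolic b -> boundary_mobius b x = x -> S y -> x <> y ->
  transverse (reduce (phi x)) (reduce (phi y)).
Proof.
move=> HG fr Gb hb bx Sy xy.
have [c [P [l [Gc dP Pc l1 [Px cfix]]]]] := hyperbolic_chart fr Gb hb bx.
have uP : P \in unitmx by rewrite unitmxE dP unitr1.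
have xE : x = boundary_mobius (invmx P) None by rewrite -Px boundary_mobiusVK.
have [t Py] : exists t, boundary_mobius P y = Some t.
  case E : (boundary_mobius P y) => [t|]; first by exists t.
  by case: xy; rewrite xE -E boundary_mobiusVK.
have yE : y = boundary_mobius (invmx P) (Some t) by rewrite -Py boundary_mobiusVK.
rewrite /transverse capvC; have [t0|tn0] := eqVneq t 0.
  by rewrite xE yE t0; exact: (opposite_transverse HG fr Gc dP Pc l1).
have fr1 := framed_conj fr dP.
have [a Ga a0] := crossing_element HG Gc dP Pc l1.
have dV : \det (invmx P) = 1 by rewrite det_inv dP invr1.
rewrite xE yE; apply: (half_line_transverse fr1 _ l1 _ _ a0 _ tn0).
- move=> d z1 z2 Gd hd d1 d2 z12.
  have dd := framed_det fr1 Gd.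
  apply: (fixed_pair_transverse HG fr Gd).
  + by have := hyperbolic_conj d dV; rewrite invmxK => -[_]; exact.
  + by have := boundary_mobius_conj z1 dV dd; rewrite invmxK d1.
  + by have := boundary_mobius_conj z2 dV dd; rewrite invmxK d2.
  + by move=> /(congr1 (boundary_mobius P)); rewrite !boundary_mobiusK.
- by rewrite -Pc conjK.
- by rewrite conjK.
- by rewrite -yE.
Qed.
End Pairs.

Theorem theorem1p6 (R : realType) (G : set 'M[R]_2) (HG : surface_group G)
    (F : rcfType) (n : nat) (V : vectType F) (w : {skew_symmetric V})
    (Hw : is_psymplectic w) (dimV : \dim {:V} = (2 * n)%N)
    (O : convexSubring F) (rho : 'M[R]_2 -> 'End(V))
    (Hrho : symplectic_representation G w rho)
    (e : (n + n).-tuple V) (He : symplectic_basis w e)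
    (HO : forall A, G A -> integral_in O e (rho A)) :
  admits_maximal_framing G w rho ->
  admits_maximal_framing G (@std_form (residue_field O) n) (reduction O e rho).
Proof.
move=> [S [phi Mphi]]; have [nd _ _] := Hw.
have [SM Sfix Slag Seq Smax] := Mphi.
have fr : framed O w e G rho S phi.
  by split=> //; have [] := HG.
(* The domain shrinks to the fixed points of hyperbolic elements, where transversality is available;
   conjugation shows that it is invariant. *)
pose T x := exists2 b, G b & hyperbolic b /\ boundary_mobius b x = x.
have TS x : T x -> S x by move=> [b Gb [hb bx]]; exact: (Sfix b).
have tr x y : T x -> T y -> x <> y -> transverse (reduce O He (phi x)) (reduce O He (phi y)).
  move=> [b Gb [hb bx]] /TS Sy; exact: (hyperbolic_points_transverse He nd HG fr Gb hb bx Sy).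
exists T, (fun x => reduce O He (phi x)); split.
- move=> A x GA [b Gb [hb bx]]; have dA := framed_det fr GA.
  exists (A *m b *m invmx A).
    by apply: (framedM fr); [exact: (framedM fr)|exact: (framedV fr)].
  by split; [exact/hyperbolic_conj|rewrite boundary_mobius_conj ?bx //; exact: (framed_det fr)].
- by move=> A x GA hA Ax; exists A.
- by move=> x /TS /Slag; exact: reduce_lagrangian.
- move=> A x GA /TS Sx; rewrite Seq //.
  by apply: reduce_map (HO _ GA) (HO _ (framedV fr GA)) (framed_rhoVr fr GA) (framed_rhoV fr GA).
- move=> x y z Tx Ty Tz xyz.
  have [xy yz xz] : [/\ x <> y, y <> z & x <> z].
    by move/positively_orientedE: xyz; split=> E; move: xyz; rewrite E /bdet; nra.
  by apply: reduce_maximal; [exact: nd|apply: Smax; auto|apply: tr..].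
Qed.
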